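(* Let $(t_k)_{k=1}^\infty$ be a sequence of real numbers with $1>t_1>t_2>t_3>\dots>0$ and $\lim_{k\to\infty}t_k=0$. Let $n\ge1$, $a>1$, $1<p<2$, $r>0$, and $$s=\frac n2+r-\frac np.$$ (i) If $f\in L^p_r(\mathbb{R}^n)$ and $s>1/2$, then $\lim_{k\to\infty}S_{t_k}f(x)=f(x)$ for almost every $x\in\mathbb{R}^n$. (ii) If $0<s\le1/2$, set $\gamma=2s/(a-s)$. If moreover $\sum_{k=1}^\infty t_k^\gamma<\infty$ and $f\in L^p_r(\mathbb{R}^n)$, then $\lim_{k\to\infty}S_{t_k}f(x)=f(x)$ for almost every $x\in\mathbb{R}^n$.
   Context: The Fourier transform is $\hat f(\xi)=\int_{\mathbb{R}^n}e^{-i\xi\cdot x}f(x)\,dx$, also denoted $\mathscr{F}f$. For $r>0$ let $k_r(\xi)=(1+|\xi|^2)^{-r/2}$ and let $\mathscr{J}_r$ be the operator $\mathscr{J}_rg=\mathscr{F}^{-1}(k_r\hat g)$, $g\in L^2\cap L^p$, which extends to a bounded operator on $L^p(\mathbb{R}^n)$ (the extension is also denoted $\mathscr{J}_r$). The Bessel potential space is $L^p_r=\{\mathscr{J}_rg : g\in L^p(\mathbb{R}^n)\}$. For $s=n/2+r-n/p>0$ one has $L^p_r\subset L^2(\mathbb{R}^n)$, and $S_tf$ is, for $f\in L^2(\mathbb{R}^n)$, the $L^2$ function $S_tf(x)=(2\pi)^{-n}\int_{\mathbb{R}^n}e^{i\xi\cdot x}e^{it|\xi|^a}\hat f(\xi)\,d\xi$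 with Fourier transform $e^{it|\xi|^a}\hat f(\xi)$. *)

(* Defs.v *)
From HB Require Import structures.
From mathcomp Require Import all_boot all_order all_algebra.
From mathcomp Require Import all_classical all_reals all_analysis.
From mathcomp Require Import complex.

Set Implicit Arguments.
Unset Strict Implicit.
Unset Printing Implicit Defensive.
Import Order.TTheory GRing.Theory Num.Theory.
Import numFieldNormedType.Exports.
Local Open Scope classical_set_scope.
Local Open Scope ring_scope.

(** [measurable] on [Rn R n] is the product of the Borel sigma-algebras. *)
Notation Rn R n := (n.-tuple (measurableTypeR R)).

Section lebesgue_measure_Rn.
Variable R : realType.

Definition cons_Rn n (x : measurableTypeR R * Rn R n) : Rn R n.+1 :=
  [tuple of x.1 :: x.2].

Definition uncons_Rn n (x : Rn R n.+1) : measurableTypeR R * Rn R n :=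
  (thead x, [tuple of behead x]).

Lemma cons_RnK n : cancel (@cons_Rn n) (@uncons_Rn n).
Proof. by move=> [x y]; congr pair; apply/val_inj. Qed.

Lemma measurable_cons_Rn n : measurable_fun [set: _] (@cons_Rn n).
Proof. exact: measurable_cons. Qed.

Lemma measurable_uncons_Rn n : measurable_fun [set: _] (@uncons_Rn n).
Proof.
apply/measurable_fun_pairP; split; last exact: measurable_behead.
exact: measurable_tnth.
Qed.

Section lebesgue_cons.
Variables (n : nat) (m : {sigma_finite_measure set (Rn R n) -> \bar R}).

Definition lebesgue_cons : set (Rn R n.+1) -> \bar R :=
  pushforward (lebesgue_measure \x m)%E (@cons_Rn n).

Let push : {measure set (Rn R n.+1) -> \bar R} :=
  measure_function_pushforward__canonical__measure_function_Measure
    (lebesgue_measure \x m)%E (@measurable_cons_Rn n).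

HB.instance Definition _ := isMeasure.Build _ _ _ lebesgue_cons
  (measure0 push) (measure_ge0 push) (@measure_semi_sigma_additive _ _ _ push).

Let lebesgue_cons_sigma_finite : sigma_finite setT lebesgue_cons.
Proof.
have /sigma_finiteP[F [TF ndF Foo]] := @sigma_finiteT _ _ _ (@lebesgue_measure R).
have /sigma_finiteP[G [TG ndG Goo]] := sigma_finiteT m.
exists (fun k => @uncons_Rn n @^-1` (F k `*` G k)).
  rewrite -preimage_bigcup (_ : \bigcup_k (F k `*` G k) = setT) ?preimage_setT//.
  rewrite -subTset => -[x y] _.
  have [i _ Fix] : (\bigcup_k F k) x by rewrite -TF.
  have [j _ Gjy] : (\bigcup_k G k) y by rewrite -TG.
  exists (maxn i j) => //; split => /=.
    by move: Fix; exact/subsetPset/ndF/leq_maxl.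
  by move: Gjy; exact/subsetPset/ndG/leq_maxr.
move=> k; have [mF Fk] := Foo k; have [mG Gk] := Goo k; split.
  rewrite -[X in measurable X]setTI; apply: measurable_uncons_Rn => //.
  exact: measurableX.
rewrite /lebesgue_cons /pushforward -comp_preimage.
rewrite (_ : _ \o _ = id); last exact/funext/cons_RnK.
rewrite preimage_id product_measure1E//.
by rewrite lte_mul_pinfty// ge0_fin_numE.
Qed.

HB.instance Definition _ := Measure_isSigmaFinite.Build _ _ _ lebesgue_cons
  lebesgue_cons_sigma_finite.
End lebesgue_cons.

Fixpoint lebesgue_measure_Rn n : {sigma_finite_measure set (Rn R n) -> \bar R} :=
  if n is n'.+1 then lebesgue_cons (lebesgue_measure_Rn n')
  else dirac [tuple].

(** The value on boxes determines the measure. *)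
Lemma lebesgue_measure_Rn_box n (A : 'I_n -> set (measurableTypeR R)) :
  (forall i, measurable (A i)) ->
  lebesgue_measure_Rn n [set x | forall i, A i (tnth x i)] =
  (\prod_(i < n) lebesgue_measure (A i))%E.
Proof.
elim: n A => [|n IH] A mA /=.
  by rewrite big_ord0 diracE mem_set//= => -[].
rewrite big_ord_recl -IH// /lebesgue_cons /pushforward.
set B := [set x : Rn R n | forall i, A (lift ord0 i) (tnth x i)].
have mB : measurable B.
  rewrite (_ : B = \bigcap_(i in [set: 'I_n])
      ((fun x => tnth x i) @^-1` A (lift ord0 i))).
    apply: fin_bigcap_measurable => // i _.
    by rewrite -[X in measurable X]setTI; exact: measurable_tnth.
  apply/seteqP; split => x Bx i; first by move=> _; exact: Bx.
  exact: (Bx i I).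
rewrite (_ : _ @^-1` _ = A ord0 `*` B); first by rewrite product_measure1E.
apply/seteqP; split => -[x y] /=.
  move=> Axy; split; first exact: (Axy ord0).
  by move=> i; have := Axy (lift ord0 i); rewrite tnthS.
move=> [Ax By] i; have [j ->|->] := unliftP ord0 i; last exact: Ax.
by rewrite tnthS; exact: By.
Qed.
End lebesgue_measure_Rn.

Section schroedinger.
Variables (R : realType) (n : nat).
Local Open Scope complex_scope.
Local Notation mu := (lebesgue_measure_Rn R n).
Implicit Types (p r a t : R) (x y xi : Rn R n) (f g : Rn R n -> R[i]).

Definition dotRn x y : R := \sum_(i < n) (tnth x i : R) * (tnth y i : R).

Definition normRn x : R := Num.sqrt (dotRn x x).

Definition expi (u : R) : R[i] := cos u +i* sin u.

(** Meaningful for integrable [f] only ([Rintegral] is total). *)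
Definition cintegral f : R[i] :=
  (\int[mu]_x complex.Re (f x)) +i* (\int[mu]_x complex.Im (f x)).

Definition cLnorm p f : \bar R :=
  Lnorm mu p%:E (fun x => (ComplexField.Normc.normc (f x))%:E).

Definition memLp p f : Prop :=
  [/\ measurable_fun [set: Rn R n] (fun x => complex.Re (f x)),
      measurable_fun [set: Rn R n] (fun x => complex.Im (f x)) &
      (cLnorm p f < +oo)%E].

Definition cvgLp p (g_ : nat -> Rn R n -> R[i]) g : Prop :=
  cLnorm p (fun x => g_ k x - g x) @[k --> \oo] --> 0%E.

(** Extension by continuity to [L^p] of an operator [T] given on a dense subset
    [D] of [L^p] and bounded there for the [L^p] norm: [Lp_ext p D T g] is a
    representative of the limit in [L^p] of [T g_k], where [g_k] in [D]
    converges to [g] in [L^p].  The default value [0] is a dummy, never reached for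
    [g] in [L^p]. *)
Definition Lp_ext p (D : set (Rn R n -> R[i]))
    (T : (Rn R n -> R[i]) -> Rn R n -> R[i]) g : Rn R n -> R[i] :=
  xget (fun=> 0) [set h | memLp p h /\
    exists g_ : nat -> Rn R n -> R[i], [/\ forall k, D (g_ k),
      cvgLp p g_ g & cvgLp p (fun k => T (g_ k)) h]].

Definition fourier f xi : R[i] :=
  cintegral (fun x => expi (- dotRn xi x) * f x).

Definition inv_fourier f x : R[i] :=
  ((2 * pi) ^- n)%:C * cintegral (fun xi => expi (dotRn xi x) * f xi).

(** The Plancherel extensions of the two integrals to [L^2]. *)
Definition fourierL2 := Lp_ext 2 (memLp 1 `&` memLp 2) fourier.

Definition inv_fourierL2 := Lp_ext 2 (memLp 1 `&` memLp 2) inv_fourier.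

Definition bessel_symbol r xi : R := (1 + normRn xi ^+ 2) `^ (- r / 2).

Definition bessel_op p r : (Rn R n -> R[i]) -> Rn R n -> R[i] :=
  Lp_ext p (memLp 2 `&` memLp p)
    (fun g => inv_fourierL2 (fun xi => (bessel_symbol r xi)%:C * fourierL2 g xi)).

(** Closed under a.e. equality; in particular [f] need not be Borel. *)
Definition bessel_space p r : set (Rn R n -> R[i]) :=
  [set f | exists2 g, memLp p g & {ae mu, forall x, f x = bessel_op p r g x}].

Definition schroedinger a t f : Rn R n -> R[i] :=
  inv_fourierL2 (fun xi => expi (t * normRn xi `^ a) * fourierL2 f xi).

End schroedinger.

(* Main.v *)
(** The space [L^p_r] enters only through the Fourier transform [F] of [f].
    Splitting [g] in [L^p] at the height [rho^(n/p)] gives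
    [\int_(|xi| < rho) |ghat|^2 <= C rho^(2n/p - n)]. As [F = k_r ghat], the part
    of [F] in the annulus [2^j <= |xi| < 2^(j+1)] has squared [L^2] norm at
    most [C 2^(-2js)].

    Let [F_j] be that part, [u_j] the solution it generates and [lam = 2^j].
    Expanding the square and integrating in time and space first, against
    the weights [e^(-|t|)] and [phi x = \prod_i e^(-|x_i|)] (TT* and Schur's
    test), gives both the boundedness of the Fourier transform on [L^2] and the
    local smoothing estimate
    [\int phi \int_0^1 |u_j|^2 <= C lam^(1-a) ||F_j||^2].
    On an interval of length [T >= l], [sup |u|^2] is at most
    [(2/l) \int |u|^2 + l \int |u'|^2]; here [u_j'] costs a factor [lam^a], and
    [l = lam^(-a)].
    If [s > 1/2], local smoothing with [T = 1] bounds
    [\int phi sup_[0,1] |u_j|^2] by [C lam^(1-2s)].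
    If [s <= 1/2], Plancherel with [T = lam^(-th)], [th = a - 3s/2], bounds the
    supremum over [t_k <= T] by [C lam^(a-th-2s) = C lam^(-s/2)], and the
    remaining times satisfy [\sum_(t_k > T) 1 <= \sum_k (t_k/T)^gamma], which costs
    [lam^(th gamma - 2s) = lam^(-gamma s/2)].
    In both cases the bounds are summable in [j], so almost everywhere the
    continuous functions [t |-> u_j(t, x)] are dominated by a convergent series
    uniformly in [t = t_k], and Tannery's theorem applies. *)
Require Import Defs.
From HB Require Import structures.
From mathcomp Require Import all_boot all_order all_algebra.
From mathcomp Require Import all_classical all_reals all_analysis.
From mathcomp Require Import measurable_realfun.
From mathcomp Require Import complex ring lra zify.

Set Implicit Arguments.
Unset Strict Implicit.
Unset Printing Implicit Defensive.
Import Order.TTheory GRing.Theory Num.Theory.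
Import numFieldNormedType.Exports.
Local Open Scope classical_set_scope.
Local Open Scope ring_scope.

(** The weights e^(-e|t|) have Poisson kernels as Fourier transforms: nonnegative, of total mass 2
    pi for every e, with arctangents as primitives. So Schur's test needs no cancellation, and
    inversion can be checked by hand on boxes. Estimates are for squared norms, with constants that
    are not sharp; Plancherel's identity does not come out of them, and inversion gets a proof of
    its own. It is indispensable, as [schroedinger] starts from [fourierL2 f] while f is only known
    as the inverse transform of F.

    Up to constants, the gain lam^(1-a) is the inverse of the derivative of |xi|^a along a
    coordinate axis, in the cone where that coordinate dominates. As the Sobolev step costs lam^a, a
    factor lam remains against lam^(-2s): hence the threshold 1/2. For s <= 1/2, short times require
    th > a - 2s and the remaining times th gamma < 2s, that is th < a - s; the choice of th is the
    midpoint.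

    The sums of dyadic pieces are known to converge to the solution in L^2, hence a.e. along
    subsequences that depend on the time. Tannery's theorem is therefore stated for partial sums
    that come close infinitely often. *)

Notation Rep := (@complex.Re _).
Notation Imp := (@complex.Im _).

(** * Series, subsequences and completeness of L^2 *)

Lemma series_lty (R : realType) (u : nat -> R) : (forall k, 0 <= u k) ->
  (\sum_(0 <= k <oo) (u k)%:E < +oo)%E -> cvgn (series u).
Proof.
move=> u0 su; apply: nondecreasing_is_cvgn.
  by apply/nondecreasing_seqP => n; rewrite /series/= big_nat_recr//= lerDl.
have sfin : (\sum_(0 <= k <oo) (u k)%:E)%E \is a fin_num.
  by rewrite ge0_fin_numE// nneseries_ge0// => k _ _; rewrite lee_fin.
exists (fine (\sum_(0 <= k <oo) (u k)%:E)%E) => _ [n _ <-].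
rewrite -lee_fin fineK//= /series/= -sumEFin.
by apply: nneseries_lim_ge => k _ _; rewrite lee_fin.
Qed.

Lemma series_lty_cvg0 (R : realType) (u : nat -> R) : (forall k, 0 <= u k) ->
  (\sum_(0 <= k <oo) (u k)%:E < +oo)%E -> u k @[k --> \oo] --> 0.
Proof. by move=> u0 su; apply: cvg_series_cvg_0; exact: series_lty. Qed.

Lemma geometric_lty (R : realType) (q : R) : 0 <= q -> q < 1 ->
  (\sum_(0 <= k <oo) (q ^+ k)%:E < +oo)%E.
Proof.
move=> q0 q1; apply: (@le_lt_trans _ _ (1 - q)^-1%:E); last exact: ltry.
apply: lime_le; first by apply: is_cvg_nneseries => k _ _; rewrite lee_fin exprn_ge0.
apply: nearW => n; rewrite sumEFin lee_fin.
have q10 : 0 < 1 - q by lra.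
rewrite -(ler_pM2r q10) mulVf ?gt_eqF//.
elim: n => [|n IH]; first by rewrite big_geq// mul0r.
rewrite big_nat_recl//= expr0.
under eq_bigr do rewrite exprS; rewrite -mulr_sumr.
set S := \sum_(_ <= _ < _) _ in IH *.
have : q * (S * (1 - q)) <= q * 1 by rewrite ler_wpM2l.
by lra.
Qed.

(** Convergence to 0 in the extended reals, tested with real bounds only: eventual finiteness is a
    consequence, and linear combinations need no finiteness side conditions. *)
Definition tends0 (R : realType) (u : nat -> \bar R) :=
  forall e : R, 0 < e -> exists N, forall k, (N <= k)%N -> (u k <= e%:E)%E.

Lemma tends0P (R : realType) (u : nat -> \bar R) : (forall k, 0 <= u k)%E ->
  tends0 u <-> u k @[k --> \oo] --> 0%E.
Proof.
move=> u0; split=> [hu|hu e e0].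
  apply/fine_cvgP; split.
    have [N hN] := hu _ ltr01; exists N => // k /= /hN uk.
    by rewrite ge0_fin_numE// (le_lt_trans uk)// ltry.
  apply/cvgrPdist_le => e e0; have [N hN] := hu _ e0.
  exists N => // k /= /hN uk; rewrite sub0r normrN ger0_norm ?fine_ge0//.
  by rewrite -lee_fin fineK// ge0_fin_numE// (le_lt_trans uk)// ltry.
have /fine_cvgP[[N1 _ fu] /cvgrPdist_le/(_ e e0)[N2 _ ue]] := hu.
exists (maxn N1 N2) => k; rewrite geq_max => /andP[k1 k2].
have := ue _ k2; rewrite /= sub0r normrN ger0_norm ?fine_ge0//.
by rewrite -lee_fin fineK//; exact: fu.
Qed.

(** Partial sums of the thresholds, shifted by j, are monotone, at least j, and dominate each
    threshold. Used to extract subsequences that converge at a prescribed rate. *)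
Lemma choose_subseq (P : nat -> nat -> Prop) :
  (forall j, exists N, forall k, (N <= k)%N -> P j k) ->
  exists phi : nat -> nat, [/\ {homo phi : m n / (m <= n)%N},
    forall j, (j <= phi j)%N & forall j k, (phi j <= k)%N -> P j k].
Proof.
move=> /choice[N hN]; exists (fun j => \sum_(i < j.+1) N i + j)%N; split.
- apply: (@homo_leq _ _ leq leqnn leq_trans) => j.
  by rewrite [X in (_ <= X + _)%N]big_ord_recr/= leq_add// leq_addr.
- by move=> j; exact: leq_addl.
- move=> j k jk; apply: hN; apply: leq_trans jk.
  by rewrite big_ord_recr/= -addnA addnCA leq_addr.
Qed.

Section general_measure.
Context d (T : measurableType d) (R : realType) (mu : {measure set T -> \bar R}).
Implicit Types (f g h : T -> R[i]).

(** Fatou's lemma in the form needed for limits that exist only a.e.: the limit agrees a.e. with the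
    lower limit, and an eventual bound on the integrals is enough since each infimum over a tail is
    below some late term. *)
Lemma fatou_le (f_ : nat -> T -> \bar R) (f : T -> \bar R) (c : \bar R) :
  (forall k, measurable_fun [set: T] (f_ k)) -> (forall k x, (0 <= f_ k x)%E) ->
  measurable_fun [set: T] f -> {ae mu, forall x, f_ k x @[k --> \oo] --> f x} ->
  (\forall k \near \oo, (\int[mu]_x f_ k x <= c)%E) ->
  (\int[mu]_x f x <= c)%E.
Proof.
move=> mf_ f_0 mf f_f [N _ f_c].
have -> : (\int[mu]_x f x = \int[mu]_x limn_einf (f_ ^~ x))%E.
  apply: ae_eq_integral => //.
    have -> : (fun x => limn_einf (f_ ^~ x)) =
        (fun x => - limn_esup (fun k => - f_ k x))%E.
      by apply/funext => x; rewrite (limn_esupN (f_ ^~ x)) oppeK.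
    apply: measurableT_comp => //; apply: measurable_fun_limn_esup => n.
    exact: measurableT_comp.
  apply: filterS f_f => x fx _; rewrite is_cvg_limn_einfE.
    by apply/esym/cvg_lim.
  by apply/cvg_ex; exists (f x).
apply: le_trans (fatou _ _ _ _) _ => //.
rewrite limn_einf_lim; apply: lime_le; first exact: is_cvg_einfs.
apply: nearW => n; apply: le_trans (f_c (maxn n N) _); last exact: leq_maxr.
by apply: ereal_inf_lbound; exists (maxn n N) => //=; exact: leq_maxl.
Qed.

(** Sum and integral can be exchanged, so the sum is integrable and therefore finite a.e. *)
Lemma ae_nneseries_lty (v : nat -> T -> \bar R) :
  (forall k, measurable_fun [set: T] (v k)) -> (forall k x, (0 <= v k x)%E) ->
  (\sum_(0 <= k <oo) \int[mu]_x v k x < +oo)%E ->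
  {ae mu, forall x, (\sum_(0 <= k <oo) v k x < +oo)%E}.
Proof.
move=> mv v0; rewrite -integral_nneseries// => iv.
have mV : measurable_fun [set: T] (fun x => (\sum_(0 <= k <oo) v k x)%E).
  have := @ge0_emeasurable_sum _ T R setT v xpredT.
  by apply => // k _; exact: mv.
have /integrable_ae : mu.-integrable setT (fun x => (\sum_(0 <= k <oo) v k x)%E).
  apply/integrableP; split => //.
  by under eq_integral do rewrite gee0_abs ?nneseries_ge0//.
move=> /(_ measurableT); apply: filterS => x /(_ I).
by rewrite ge0_fin_numE ?nneseries_ge0.
Qed.

(** Along [phi] the integrals are at most 2^-k, so the series of the [v (phi k)] is finite a.e. and
    its terms tend to 0. *)
Lemma ae_cvg0_subseq (v : nat -> T -> R) :
  (forall k, measurable_fun [set: T] (v k)) -> (forall k x, 0 <= v k x) ->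
  tends0 (fun k => \int[mu]_x (v k x)%:E)%E ->
  exists phi : nat -> nat, (forall k, (k <= phi k)%N) /\
    {ae mu, forall x, v (phi k) x @[k --> \oo] --> 0}.
Proof.
move=> mv v0 hv.
have [j|phi [_ kphi hphi]] := @choose_subseq (fun j k => \int[mu]_x (v k x)%:E <= ((2^-1) ^+ j)%:E)%E.
  by apply: hv; rewrite exprn_gt0// invr_gt0.
exists phi; split => //.
have : {ae mu, forall x, (\sum_(0 <= k <oo) (v (phi k) x)%:E < +oo)%E}.
  apply: ae_nneseries_lty => [k|k x|]; first exact/measurable_EFinP.
    by rewrite lee_fin.
  apply: le_lt_trans (@geometric_lty R 2^-1 _ _); [|lra|lra].
  apply: lee_nneseries => [k _ _|k _]; last exact: hphi.
  by apply: integral_ge0 => x _; rewrite lee_fin.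
apply: filterS => x; exact: series_lty_cvg0.
Qed.

(** Squared modulus. It is a polynomial in the two components, so measurability and limits need no
    square root; the price is a factor 2 in place of each triangle inequality, here and for [N2],
    the squared L^2 norm. *)
Definition sqn (z : R[i]) : R := complex.Re z ^+ 2 + complex.Im z ^+ 2.

Definition cmeas f := measurable_fun [set: T] (fun x => complex.Re (f x)) /\
  measurable_fun [set: T] (fun x => complex.Im (f x)).

Definition N2 f : \bar R := (\int[mu]_x (sqn (f x))%:E)%E.

Lemma sqn_ge0 z : 0 <= sqn z. Proof. by rewrite addr_ge0// sqr_ge0. Qed.

Lemma sqnD z w : sqn (z + w) <= 2 * sqn z + 2 * sqn w.
Proof.
case: z => a b; case: w => c e; rewrite /sqn/=.
have : 0 <= (a - c) ^+ 2 + (b - e) ^+ 2 by rewrite addr_ge0// sqr_ge0.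
by nra.
Qed.

Lemma sqnN z : sqn (- z) = sqn z.
Proof. by case: z => a b; rewrite /sqn/= !sqrrN. Qed.

Lemma sqnBC z w : sqn (z - w) = sqn (w - z).
Proof. by rewrite -sqnN opprB. Qed.

Lemma sqnM z w : sqn (z * w) = sqn z * sqn w.
Proof. by case: z => a b; case: w => c e; rewrite /sqn/=; ring. Qed.

Lemma sqn0 : sqn 0 = 0. Proof. by rewrite /sqn/= expr0n addr0. Qed.

Lemma sqn_eq0 z : sqn z = 0 -> z = 0.
Proof.
case: z => a b; rewrite /sqn/= => /eqP; rewrite paddr_eq0 ?sqr_ge0//.
by rewrite !sqrf_eq0 => /andP[/eqP -> /eqP ->].
Qed.

Lemma ReD (z w : R[i]) : complex.Re (z + w) = complex.Re z + complex.Re w.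
Proof. by case: z; case: w. Qed.
Lemma ImD (z w : R[i]) : complex.Im (z + w) = complex.Im z + complex.Im w.
Proof. by case: z; case: w. Qed.
Lemma ReN (z : R[i]) : complex.Re (- z) = - complex.Re z.
Proof. by case: z. Qed.
Lemma ImN (z : R[i]) : complex.Im (- z) = - complex.Im z.
Proof. by case: z. Qed.
Lemma ReM (z w : R[i]) : complex.Re (z * w) =
  complex.Re z * complex.Re w - complex.Im z * complex.Im w.
Proof. by case: z; case: w. Qed.
Lemma ImM (z w : R[i]) : complex.Im (z * w) =
  complex.Re z * complex.Im w + complex.Im z * complex.Re w.
Proof. by case: z; case: w. Qed.

Lemma cmeasD f g : cmeas f -> cmeas g -> cmeas (fun x => f x + g x).
Proof.
move=> [f1 f2] [g1 g2]; split.
  by under eq_fun do rewrite ReD; exact: measurable_funD.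
by under eq_fun do rewrite ImD; exact: measurable_funD.
Qed.

Lemma cmeasN f : cmeas f -> cmeas (fun x => - f x).
Proof.
move=> [f1 f2]; split.
  by under eq_fun do rewrite ReN; exact: measurable_funN.
by under eq_fun do rewrite ImN; exact: measurable_funN.
Qed.

Lemma cmeasB f g : cmeas f -> cmeas g -> cmeas (fun x => f x - g x).
Proof. by move=> mf mg; apply: cmeasD => //; exact: cmeasN. Qed.

Lemma cmeasM f g : cmeas f -> cmeas g -> cmeas (fun x => f x * g x).
Proof.
move=> [f1 f2] [g1 g2]; split.
  by under eq_fun do rewrite ReM; apply: measurable_funB; exact: measurable_funM.
by under eq_fun do rewrite ImM; apply: measurable_funD; exact: measurable_funM.
Qed.

Lemma cmeas_cst c : cmeas (fun=> c).
Proof. by split; exact: measurable_cst. Qed.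

Lemma cmeas_real (u : T -> R) : measurable_fun [set: T] u ->
  cmeas (fun x => (u x)%:C%C).
Proof. by move=> mu_; split => //=; exact: measurable_cst. Qed.

Lemma measurable_sqn f : cmeas f -> measurable_fun [set: T] (fun x => sqn (f x)).
Proof. by move=> [f1 f2]; apply: measurable_funD; exact: measurable_funX. Qed.

Lemma emeasurable_sqn f : cmeas f ->
  measurable_fun [set: T] (fun x => (sqn (f x))%:E).
Proof. by move=> mf; exact/measurable_EFinP/measurable_sqn. Qed.

Hint Resolve sqn_ge0 : core.

Lemma N2_ge0 f : (0 <= N2 f)%E.
Proof. by apply: integral_ge0 => x _; rewrite lee_fin. Qed.
Hint Resolve N2_ge0 : core.

Lemma N2_le f g : cmeas f -> cmeas g -> (forall x, sqn (f x) <= sqn (g x)) ->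
  (N2 f <= N2 g)%E.
Proof.
move=> mf mg fg; apply: ge0_le_integral => //.
- by move=> x _; rewrite lee_fin.
- exact: emeasurable_sqn.
- exact: emeasurable_sqn.
- by move=> x _; rewrite lee_fin.
Qed.

Lemma N2Zl (c : R) f : cmeas f -> 0 <= c ->
  (\int[mu]_x (c * sqn (f x))%:E = c%:E * N2 f)%E.
Proof.
move=> mf c0; under eq_integral do rewrite EFinM.
rewrite ge0_integralZl//; first exact: emeasurable_sqn.
by move=> x _; rewrite lee_fin.
Qed.

Lemma N2D f g : cmeas f -> cmeas g ->
  (N2 (fun x => f x + g x)%R <= 2%:E * N2 f + 2%:E * N2 g)%E.
Proof.
move=> mf mg; rewrite -!N2Zl// -ge0_integralD//; first last.
- by apply/measurable_EFinP/measurable_funM => //; exact: measurable_sqn.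
- by move=> x _; rewrite lee_fin mulr_ge0.
- by apply/measurable_EFinP/measurable_funM => //; exact: measurable_sqn.
- by move=> x _; rewrite lee_fin mulr_ge0.
apply: ge0_le_integral => //.
- by move=> x _; rewrite lee_fin.
- by apply: emeasurable_sqn; exact: cmeasD.
- apply: emeasurable_funD; apply/measurable_EFinP/measurable_funM => //; exact: measurable_sqn.
- by move=> x _; rewrite -EFinD lee_fin sqnD.
Qed.

Lemma eq_N2 f g : (forall x, sqn (f x) = sqn (g x)) -> N2 f = N2 g.
Proof. by move=> fg; apply: eq_integral => x _; rewrite fg. Qed.

Lemma N2N f : N2 (fun x => - f x) = N2 f.
Proof. by apply: eq_N2 => x; rewrite sqnN. Qed.

Lemma N2BC f g : N2 (fun x => f x - g x) = N2 (fun x => g x - f x).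
Proof. by apply: eq_N2 => x; rewrite sqnBC. Qed.

Lemma N2B f g : cmeas f -> cmeas g ->
  (N2 (fun x => f x - g x)%R <= 2%:E * N2 f + 2%:E * N2 g)%E.
Proof. by move=> mf mg; rewrite -(N2N g); apply: N2D => //; exact: cmeasN. Qed.

Lemma N2_triangle f g h : cmeas f -> cmeas g -> cmeas h ->
  (N2 (fun x => f x - h x)%R <=
   2%:E * N2 (fun x => f x - g x)%R + 2%:E * N2 (fun x => g x - h x)%R)%E.
Proof.
move=> mf mg mh; rewrite [X in (X <= _)%E](_ : _ =
    N2 (fun x => (f x - g x) + (g x - h x))).
  by apply: N2D; exact: cmeasB.
by apply: eq_N2 => x; rewrite addrA subrK.
Qed.

Lemma N2_eq0 f : cmeas f -> N2 f = 0%E -> {ae mu, forall x, f x = 0}.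
Proof.
move=> mf f0.
have : (\int[mu]_x `|(sqn (f x))%:E| = 0)%E.
  by rewrite -f0; apply: eq_integral => x _; rewrite gee0_abs// lee_fin.
move/ae_eq_integral_abs => /(_ measurableT (emeasurable_sqn mf)).
by apply: filterS => x /(_ I) [/sqn_eq0].
Qed.

Lemma ae_N2 f g : cmeas f -> cmeas g -> {ae mu, forall x, f x = g x} ->
  N2 f = N2 g.
Proof.
move=> mf mg fg; apply: ae_eq_integral => //; [exact: emeasurable_sqn..|].
by apply: filterS fg => x ->.
Qed.

Lemma N2B_eq0 f g : cmeas f -> cmeas g -> (forall e : R, 0 < e -> (N2 (fun x => f x - g x)%R <= e%:E)%E) ->
  {ae mu, forall x, f x = g x}.
Proof.
move=> mf mg fg; have : {ae mu, forall x, f x - g x = 0}.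
  apply: N2_eq0; first exact: cmeasB.
  apply/eqP; rewrite eq_le N2_ge0 andbT.
  by apply/lee_addgt0Pr => e e0; rewrite add0e fg.
by apply: filterS => x /eqP; rewrite subr_eq0 => /eqP.
Qed.

Lemma cvg_sqn (z : nat -> R[i]) (w : R[i]) :
  complex.Re (z k) @[k --> \oo] --> complex.Re w ->
  complex.Im (z k) @[k --> \oo] --> complex.Im w ->
  sqn (z k) @[k --> \oo] --> sqn w.
Proof. by move=> h1 h2; apply: cvgD; apply: cvgM. Qed.

Lemma N2_fatou (f_ : nat -> T -> R[i]) f (c : \bar R) :
  (forall k, cmeas (f_ k)) -> cmeas f ->
  {ae mu, forall x, complex.Re (f_ k x) @[k --> \oo] --> complex.Re (f x) /\
     complex.Im (f_ k x) @[k --> \oo] --> complex.Im (f x)} ->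
  (\forall k \near \oo, N2 (f_ k) <= c)%E -> (N2 f <= c)%E.
Proof.
move=> mf_ mf ff; apply: fatou_le => //.
- by move=> k; exact: emeasurable_sqn.
- by move=> k x; rewrite lee_fin.
- exact: emeasurable_sqn.
apply: filterS ff => x [h1 h2]; apply: cvg_EFin; first exact: nearW.
exact: cvg_sqn.
Qed.

(** Riesz-Fischer: a fast subsequence converges a.e. because its increments are absolutely summable,
    and Fatou's lemma then handles the full sequence. *)
Lemma cauchy_N2_cvg (f_ : nat -> T -> R[i]) : (forall k, cmeas (f_ k)) ->
  (forall e : R, 0 < e -> exists N, forall k m, (N <= k)%N -> (N <= m)%N ->
     (N2 (fun x => f_ k x - f_ m x)%R <= e%:E)%E) ->
  exists2 f, cmeas f & tends0 (fun k => N2 (fun x => f_ k x - f x)).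
Proof.
move=> mf hf.
have [j|phi [phih kphi hphi]] := @choose_subseq (fun j k => forall m, (k <= m)%N ->
     (N2 (fun x => f_ k x - f_ m x)%R <= ((8^-1) ^+ j)%:E)%E).
  have [|N hN] := hf ((8^-1) ^+ j); first by rewrite exprn_gt0// invr_gt0.
  by exists N => k Nk m km; apply: hN => //; exact: leq_trans km.
pose dl j x := f_ (phi j.+1) x - f_ (phi j) x.
have mdl j : cmeas (dl j) by exact: cmeasB.
have Ndl j : (N2 (dl j) <= ((8^-1) ^+ j)%:E)%E.
  by rewrite N2BC; apply: hphi => //; exact: phih.
(* The squared increments are at most 8^-j, so a weight 2^j can be inserted and a series of ratio
   1/4 still remains. *)
have sdl : {ae mu, forall x, (\sum_(0 <= j <oo) (2 ^+ j * sqn (dl j x))%:E < +oo)%E}.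
  apply: ae_nneseries_lty => [j|j x|].
  - by apply/measurable_EFinP/measurable_funM => //; exact: measurable_sqn.
  - by rewrite lee_fin mulr_ge0// exprn_ge0.
  apply: le_lt_trans (@geometric_lty R (4^-1) _ _); [|lra|lra].
  apply: lee_nneseries => [j _ _|j _].
    by apply: integral_ge0 => x _; rewrite lee_fin mulr_ge0// exprn_ge0.
  rewrite N2Zl// ?exprn_ge0//; apply: (@le_trans _ _ ((2 ^+ j)%:E * ((8^-1) ^+ j)%:E)%E).
    by rewrite lee_pmul2l// lte_fin exprn_gt0.
  rewrite -EFinM lee_fin -exprMn.
  by rewrite (_ : 2 * 8^-1 = 4^-1)//; field.
(* From 2|r| <= 2^j r^2 + 2^-j, weighted square summability of the increments gives their absolute
   summability; telescoping then gives convergence. *)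
have cvgpart (u : nat -> R) (w : nat -> R) : (forall j, (u j.+1 - u j) ^+ 2 <= w j) ->
    (\sum_(0 <= j <oo) (2 ^+ j * w j)%:E < +oo)%E -> cvgn u.
  move=> uw sw.
  have w0 j : 0 <= w j by apply: le_trans (uw j); exact: sqr_ge0.
  have : cvgn (series (fun j => u j.+1 - u j)).
    apply: normed_cvg; apply: series_lty => //=.
    apply: (@le_lt_trans _ _ (\sum_(0 <= j <oo) (2 ^+ j * w j)%:E +
      \sum_(0 <= j <oo) ((2^-1) ^+ j)%:E)%E); last first.
      by rewrite lte_add_pinfty// geometric_lty//; lra.
    rewrite -nneseriesD; last 2 first.
      by move=> j _ _; rewrite lee_fin mulr_ge0// exprn_ge0.
      by move=> j _ _; rewrite lee_fin exprn_ge0.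
    apply: lee_nneseries => // j _; rewrite -EFinD lee_fin.
    set r := u j.+1 - u j in uw *.
    have h := uw j; rewrite -/r in h.
    have p0 : (0 : R) < 2 ^+ j by rewrite exprn_gt0.
    rewrite exprVn.
    apply: (@le_trans _ _ (2 ^+ j * `|r| ^+ 2 + (2 ^+ j)^-1)); last first.
      by rewrite lerD2r ler_pM2l// real_normK ?num_real.
    have : 0 <= (2 ^+ j * `|r| - 1) ^+ 2 / 2 ^+ j.
      by rewrite divr_ge0 ?sqr_ge0// ltW.
    have -> : (2 ^+ j * `|r| - 1) ^+ 2 / 2 ^+ j = 2 ^+ j * `|r| ^+ 2 + (2 ^+ j)^-1 - 2 * `|r|.
      by field; rewrite gt_eqF.
    have := normr_ge0 r; lra.
  rewrite -(is_cvg_series_restrict 0).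
  move=> /cvg_ex[l hl]; apply/cvg_ex; exists (l + u 0%N).
  have uE : (fun n => series (fun j => u j.+1 - u j) n + u 0%N) = u.
    by apply/funext => n; rewrite /series/= telescope_sumr// subrK.
  have : (fun n => series (fun j => u j.+1 - u j) n + u 0%N) k @[k --> \oo] --> l + u 0%N.
    exact: (cvgD hl (cvg_cst (u 0%N))).
  by rewrite uE.
(* The upper limit is defined for every sequence and is measurable in x; where the sequence
   converges it is the limit. *)
pose lims (u : nat -> R) : R := fine (limn_esup (EFin \o u)).
have limsE u : cvgn u -> u k @[k --> \oo] --> lims u.
  move=> cu; suff -> : lims u = limn u by exact: cu.
  have h : (EFin \o u) k @[k --> \oo] --> (limn u)%:E by apply: cvg_EFin; [exact: nearW|exact: cu].
  by rewrite /lims; have [_ ->] := cvg_limn_einf_sup h.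
pose f x := (lims (fun j => complex.Re (f_ (phi j) x)) +i*
   lims (fun j => complex.Im (f_ (phi j) x)))%C.
have mlims (g : nat -> T -> R) : (forall k, measurable_fun setT (g k)) ->
    measurable_fun setT (fun x => lims (g ^~ x)).
  move=> mg; apply: measurableT_comp => //.
  by apply: (@measurable_fun_limn_esup _ _ _ _ (fun k x => (g k x)%:E)) => n; exact/measurable_EFinP.
have cf : cmeas f.
  by split; apply: mlims => k; case: (mf (phi k)).
have aef : {ae mu, forall x, complex.Re (f_ (phi k) x) @[k --> \oo] --> complex.Re (f x) /\
     complex.Im (f_ (phi k) x) @[k --> \oo] --> complex.Im (f x)}.
  apply: filterS sdl => x sx; split; apply: limsE.
    apply: cvgpart sx => j; rewrite /sqn -[leLHS]addr0 lerD ?sqr_ge0//.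
    by rewrite /dl ReD ReN.
  apply: cvgpart sx => j; rewrite /sqn -[leLHS]add0r lerD ?sqr_ge0//.
  by rewrite /dl ImD ImN.
(* For fixed k >= N, Fatou's lemma is applied along j to [f_ k - f_ (phi j)]; since phi j >= j, the
   Cauchy bound holds for all j >= N. *)
exists f => // e e0; have [N hN] := hf _ e0; exists N => k Nk.
apply: (@N2_fatou (fun j x => f_ k x - f_ (phi j) x)).
- by move=> j; exact: cmeasB.
- exact: cmeasB.
- apply: filterS aef => x [h1 h2]; split.
    under eq_fun do rewrite ReD ReN; rewrite ReD ReN.
    by apply: cvgB => //; exact: cvg_cst.
  under eq_fun do rewrite ImD ImN; rewrite ImD ImN.
  by apply: cvgB => //; exact: cvg_cst.
- exists N => // j /= Nj; apply: hN => //.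
  exact: leq_trans (kphi j).
Qed.

End general_measure.

(** * Tonelli's theorem on R^n *)

Section Rn_integral.
Variable R : realType.
Local Notation mu1 := (@lebesgue_measure R).
Local Notation mu := (lebesgue_measure_Rn R).

Lemma ge0_integral_consX n (f : Rn R n.+1 -> \bar R) :
  measurable_fun [set: Rn R n.+1] f -> (forall x, (0 <= f x)%E) ->
  (\int[mu n.+1]_x f x = \int[(mu1 \x mu n)%E]_z (f \o @cons_Rn R n) z)%E.
Proof.
move=> mf f0.
have h := @ge0_integral_pushforward _ _ _ _ R _ (@measurable_cons_Rn R n)
    (mu1 \x mu n)%E setT f measurableT mf (fun y _ => f0 y).
apply: (etrans _ h); apply: eq_measure_integral; first exact: (@measurable_cons_Rn R n).
by [].
Qed.

Lemma ge0_integral_cons n (f : Rn R n.+1 -> \bar R) :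
  measurable_fun [set: Rn R n.+1] f -> (forall x, (0 <= f x)%E) ->
  (\int[mu n.+1]_x f x = \int[mu1]_u \int[mu n]_y f (cons_Rn (u, y)))%E.
Proof.
move=> mf f0; rewrite ge0_integral_consX//.
exact: (@fubini_tonelli1 _ _ _ _ R mu1 (mu n) (f \o @cons_Rn R n)
  (measurableT_comp mf (@measurable_cons_Rn R n)) (fun z => f0 _)).
Qed.

Lemma ge0_integral_consC n (f : Rn R n.+1 -> \bar R) :
  measurable_fun [set: Rn R n.+1] f -> (forall x, (0 <= f x)%E) ->
  (\int[mu n.+1]_x f x = \int[mu n]_y \int[mu1]_u f (cons_Rn (u, y)))%E.
Proof.
move=> mf f0; rewrite ge0_integral_consX//.
exact: (@fubini_tonelli2 _ _ _ _ R mu1 (mu n) (f \o @cons_Rn R n)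
  (measurableT_comp mf (@measurable_cons_Rn R n)) (fun z => f0 _)).
Qed.

Lemma integral_cons n (f : Rn R n.+1 -> \bar R) :
  (mu n.+1).-integrable [set: Rn R n.+1] f ->
  (\int[mu n.+1]_x f x = \int[mu1]_u \int[mu n]_y f (cons_Rn (u, y)))%E.
Proof.
move=> fi; have /integrableP[mf foo] := fi.
have mfc := measurableT_comp mf (@measurable_cons_Rn R n).
have fci : (mu1 \x mu n)%E.-integrable setT (f \o @cons_Rn R n).
  apply/integrableP; split => //.
  rewrite -(ge0_integral_consX (f := fun x => `|f x|)%E)//.
  exact: measurableT_comp.
transitivity (\int[(mu1 \x mu n)%E]_z (f \o @cons_Rn R n) z)%E; last first.
  exact: (esym (@integral12_prod_meas1 _ _ _ _ R mu1 (mu n) (f \o @cons_Rn R n) fci)).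
have hp : (\int[mu n.+1]_x f^\+ x = \int[(mu1 \x mu n)%E]_z (f \o @cons_Rn R n)^\+ z)%E.
  rewrite (@ge0_integral_consX n (f^\+)%E (measurable_funepos mf) (fun x => funepos_ge0 f x)).
  by apply: eq_integral => z _; exact: (esym (congr1 (@^~ z) (funepos_comp f (@cons_Rn R n)))).
have hn : (\int[mu n.+1]_x f^\- x = \int[(mu1 \x mu n)%E]_z (f \o @cons_Rn R n)^\- z)%E.
  rewrite (@ge0_integral_consX n (f^\-)%E (measurable_funeneg mf) (fun x => funeneg_ge0 f x)).
  by apply: eq_integral => z _; exact: (esym (congr1 (@^~ z) (funeneg_comp f (@cons_Rn R n)))).
by rewrite integralE [RHS]integralE hp hn.
Qed.

(** Puts one coordinate at an arbitrary position j, so that integration can start with the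
    coordinate that dominates in a given cone. *)
Definition insert_Rn n (j : 'I_n.+1) (u : R) (y : Rn R n) : Rn R n.+1 :=
  [tuple if unlift j i is Some k then tnth y k else u | i < n.+1].

Lemma tnth_insert n (j : 'I_n.+1) u y : tnth (insert_Rn j u y) j = u.
Proof. by rewrite tnth_mktuple unlift_none. Qed.

Lemma tnth_insert_lift n (j : 'I_n.+1) u y i :
  tnth (insert_Rn j u y) (lift j i) = tnth y i.
Proof. by rewrite tnth_mktuple liftK. Qed.

Lemma insert_ord0 n u (y : Rn R n) : insert_Rn ord0 u y = cons_Rn (u, y).
Proof.
apply: eq_from_tnth => i; rewrite tnth_mktuple.
by case: unliftP => [k ->|->]; rewrite ?tnthS.
Qed.

Lemma insert_lift n (j : 'I_n.+1) u v (y : Rn R n) :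
  insert_Rn (lift ord0 j) u (cons_Rn (v, y)) = cons_Rn (v, insert_Rn j u y).
Proof.
apply: eq_from_tnth => i; rewrite tnth_mktuple.
have [k ->|->] := unliftP ord0 i; last first.
  by rewrite (_ : ord0 = lift (lift ord0 j) ord0) ?liftK//; exact/val_inj.
rewrite tnthS tnth_mktuple; have [m ->|->] := unliftP j k.
  rewrite (_ : lift ord0 (lift j m) = lift (lift ord0 j) (lift ord0 m)) ?liftK ?tnthS//.
  by apply/val_inj; rewrite /= /bump; lia.
by rewrite unlift_none.
Qed.

Lemma measurable_insert n (j : 'I_n.+1) :
  measurable_fun [set: measurableTypeR R * Rn R n]
    (fun z => insert_Rn j z.1 z.2).
Proof.
apply/measurable_fun_tnthP => i.
have [k ->|->] := unliftP j i.
  rewrite (_ : _ \o _ = (fun z => tnth z.2 k)); last first.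
    by apply/funext => z /=; rewrite tnth_insert_lift.
  exact: (measurableT_comp (measurable_tnth k)).
rewrite (_ : _ \o _ = fst)//.
by apply/funext => z /=; rewrite tnth_insert.
Qed.

(** At position 0 this is Tonelli. Otherwise the head coordinate is split off on both sides and
    frozen, and the induction hypothesis is applied to the rest: insertion behind the head commutes
    with [cons_Rn]. *)
Lemma ge0_integral_insert n (j : 'I_n.+1) (f : Rn R n.+1 -> \bar R) :
  measurable_fun [set: Rn R n.+1] f -> (forall x, (0 <= f x)%E) ->
  (\int[mu n.+1]_x f x = \int[mu n]_y \int[mu1]_u f (insert_Rn j u y))%E.
Proof.
elim: n j f => [|n IH] j f mf f0.
  rewrite (ge0_integral_consC mf f0) (ord1 j).
  by apply: eq_integral => y _; apply: eq_integral => u _; rewrite insert_ord0.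
have [k ->|->] := unliftP ord0 j; last first.
  rewrite (ge0_integral_consC mf f0).
  by apply: eq_integral => y _; apply: eq_integral => u _; rewrite insert_ord0.
pose g (x : Rn R n.+1) := (\int[mu1]_u f (insert_Rn (lift ord0 k) u x))%E.
have mg : measurable_fun [set: Rn R n.+1] g.
  apply: (@measurable_fun_fubini_tonelli_F _ _ _ _ R mu1
    (fun z : Rn R n.+1 * measurableTypeR R => f (insert_Rn (lift ord0 k) z.2 z.1))).
    apply: (measurableT_comp mf).
    exact: (measurableT_comp (measurable_insert (lift ord0 k)) (@measurable_swap _ _ _ _)).
  by move=> z; exact: f0.
have g0 x : (0 <= g x)%E by apply: integral_ge0 => u _; exact: f0.
rewrite (ge0_integral_cons mf f0) -/(g _) (ge0_integral_cons mg g0).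
apply: eq_integral => v _.
rewrite (IH k (fun y => f (cons_Rn (v, y)))); last 2 first.
- exact: (measurableT_comp mf (measurableT_comp (@measurable_cons_Rn R _) (measurable_pair1 v))).
- by move=> y; exact: f0.
by apply: eq_integral => y _; apply: eq_integral => u _; rewrite insert_lift.
Qed.

Lemma measurable_prod_Rn m (g : 'I_m -> R -> R) :
  (forall i, measurable_fun [set: R] (g i)) ->
  measurable_fun [set: Rn R m] (fun x => \prod_(i < m) g i (tnth x i)).
Proof.
move=> mg; apply: measurable_prod => i _.
exact: (measurableT_comp (mg i) (measurable_tnth i)).
Qed.

Lemma ge0_integral_prod n (h : 'I_n -> R -> R) :
  (forall i, measurable_fun [set: R] (h i)) -> (forall i x, 0 <= h i x) ->
  (\int[mu n]_x (\prod_(i < n) h i (tnth x i))%:E =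
   \prod_(i < n) \int[mu1]_u (h i u)%:E)%E.
Proof.
elim: n h => [|n IH] h mh h0.
  rewrite [RHS]big_ord0 integral_dirac//=; last first.
    by apply/measurable_EFinP; exact: measurable_prod_Rn.
  by rewrite big_ord0 diracE mem_set// mul1e.
rewrite ge0_integral_cons; last 2 first.
- by apply/measurable_EFinP; exact: measurable_prod_Rn.
- by move=> x; rewrite lee_fin prodr_ge0.
rewrite big_ord_recl/=.
transitivity (\int[mu1]_u ((h ord0 u)%:E * \prod_(i < n) \int[mu1]_v (h (lift ord0 i) v)%:E))%E.
  apply: eq_integral => u _.
  rewrite -IH// -ge0_integralZl//; first last.
  - by rewrite lee_fin.
  - by move=> y _; rewrite lee_fin prodr_ge0.
  - apply/measurable_EFinP.
    by apply: (@measurable_prod_Rn n (fun i => h (lift ord0 i))) => i.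
  apply: eq_integral => y _; rewrite -EFinM big_ord_recl; congr (_ * _)%:E.
  by apply: eq_bigr => i _; rewrite tnthS.
rewrite ge0_integralZr//.
- by apply/measurable_EFinP; exact: (mh ord0).
- by move=> u _; rewrite lee_fin.
- by apply: prode_ge0 => i _; apply: integral_ge0 => u _; rewrite lee_fin.
Qed.

End Rn_integral.

(** * Poisson kernels *)

Section line_integrals.
Variable R : realType.
Local Notation mu1 := (@lebesgue_measure R).
Implicit Types (e u t : R).

Lemma ge0_integral_line (G : R -> R) : measurable_fun [set: R] G -> (forall t, 0 <= G t) ->
  (\int[mu1]_t (G t)%:E = \int[mu1]_(t in `[0%R, +oo[) (G t)%:E +
    \int[mu1]_(t in `[0%R, +oo[) (G (- t)%R)%:E)%E.
Proof.
move=> mG G0.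
have mG' : measurable_fun [set: R] (fun t => (G t)%:E) by exact/measurable_EFinP.
have mGN : measurable_fun [set: R] (fun t => (G (- t))%:E).
  by apply/measurable_EFinP; apply: (measurableT_comp mG); exact: oppr_measurable.
rewrite [X in (_ + X)%E](@ge0_integration_by_substitution0 _ (fun t => (G (- t))%:E))//; last first.
  by move=> r; rewrite lee_fin.
under [X in (_ + X)%E]eq_integral do rewrite opprK.
rewrite -[X in (_ + X)%E]integral_itv_bndo_bndc; last exact: measurable_funTS.
rewrite addeC -ge0_integral_setU//=; first last.
- by apply/disj_setPS => x/= []; rewrite !in_itv/= andbT => /lt_geF ->.
- by move=> x _; rewrite lee_fin.
- exact: measurable_funTS.
congr (integral _ _ _); apply/esym; rewrite -subTset => x _/=; rewrite !in_itv/= andbT.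
by case: (ltP x 0); [left|right].
Qed.

Lemma cvg_expRZ e : 0 < e -> expR (- (e * t)) @[t --> +oo] --> 0.
Proof.
move=> e0; apply: (cvg_comp (fun t => e * t) (fun t => expR (- t))) (@cvgr_expR R).
apply/cvgryPge => A; exists (A / e); split; first exact: num_real.
by move=> t /ltW; rewrite ler_pdivrMr// mulrC.
Qed.

(** The summand 2 outweighs the two oscillating terms, so the integrand is nonnegative, as the
    fundamental theorem of calculus on a half line demands. It is subtracted again later. *)
Lemma integral_half e u al be : 0 < e -> `|al| <= 1 -> `|be| <= 1 ->
  (\int[mu1]_(t in `[0%R, +oo[)
     (expR (- (e * t)) * (2 + al * cos (u * t) + be * sin (u * t)))%:E =
   (2 / e + (al * e + be * u) / (e ^+ 2 + u ^+ 2))%:E)%E.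
Proof.
move=> e0 al1 be1; pose D := e ^+ 2 + u ^+ 2.
have D0 : 0 < D by rewrite ltr_wpDr ?sqr_ge0// exprn_gt0.
pose f t := expR (- (e * t)) * (2 + al * cos (u * t) + be * sin (u * t)).
(* [expR (- (e * t)) * Q t] is the sum of the elementary primitives of the exponential times 2,
   cosine and sine; it vanishes at infinity because [Q] is bounded. *)
pose Q t := - 2 / e + (al * u - be * e) / D * sin (u * t) - (al * e + be * u) / D * cos (u * t).
pose F t := expR (- (e * t)) * Q t.
have de t : is_derive t 1 (fun t => expR (- (e * t))) (- e * expR (- (e * t))).
  have := @is_derive1_comp _ expR (fun t => - (e * t)) t _ (- e) (is_derive_expR _) _.
  rewrite mulrC; apply.
  by apply: is_derive_eq; rewrite scaler1 ?scaler0 ?addr0.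
have du t : is_derive t 1 (fun t => u * t) u.
  by apply: is_derive_eq; rewrite scaler1 ?scaler0 ?addr0.
have ds t : is_derive t 1 (fun t => sin (u * t)) (cos (u * t) * u).
  exact: (@is_derive1_comp _ sin (fun t => u * t) t).
have dc t : is_derive t 1 (fun t => cos (u * t)) (- sin (u * t) * u).
  exact: (@is_derive1_comp _ cos (fun t => u * t) t).
have dF t : is_derive t 1 F (f t).
  apply: is_derive_eq; rewrite /f /Q /GRing.scale/=.
  by rewrite /D; field; rewrite gt_eqF//= -/D gt_eqF.
have cF t : {for t, continuous F}.
  by apply: differentiable_continuous; apply/derivable1_diffP; case: (dF t).
have drc (G : R -> R) t (l : R) : is_derive t 1 G l -> {for t, continuous G}.
  by move=> [dG _]; apply: differentiable_continuous; exact/derivable1_diffP.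
have cf : continuous f.
  move=> t; apply: cvgM; first exact: (drc _ _ _ (de t)).
  apply: cvgD; [apply: cvgD; first exact: cvg_cst|]; (apply: cvgM; first exact: cvg_cst).
    exact: (drc _ _ _ (dc t)).
  exact: (drc _ _ _ (ds t)).
have absb (b w : R) : `|b| <= 1 -> -1 <= w <= 1 -> -1 <= b * w.
  move=> b1 w1; have : `|b * w| <= 1 * 1 by rewrite normrM ler_pM// ler_norml.
  by rewrite mul1r ler_norml => /andP[].
rewrite (@ge0_continuous_FTC2y _ f F 0 0).
- rewrite -EFinB; congr EFin; rewrite /F /Q !mulr0 oppr0 expR0 sin0 cos0 /D.
  by field; rewrite gt_eqF//= -/D gt_eqF.
- move=> t _; rewrite mulr_ge0 ?expR_ge0//.
  have c1 := absb al (cos (u * t)) al1; have s1 := absb be (sin (u * t)) be1.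
  have := c1 _; rewrite cos_geN1 cos_le1 => /(_ isT).
  by have := s1 _; rewrite sin_geN1 sin_le1 => /(_ isT); lra.
- exact: continuous_subspaceT.
- pose C := `|- 2 / e| + `|(al * u - be * e) / D| + `|(al * e + be * u) / D|.
  apply/norm_cvg0P.
  apply: (@squeeze_cvgr _ _ _ _ (cst 0) (fun t => C * expR (- (e * t)))).
  + apply: nearW => t; rewrite /= normr_ge0/= /F normrM (ger0_norm (expR_ge0 _)) mulrC.
    rewrite ler_wpM2r ?expR_ge0// /Q (le_trans (ler_normB _ _))// lerD//.
      rewrite (le_trans (ler_normD _ _))// lerD// normrM ler_piMr//.
      by rewrite ler_norml sin_geN1 sin_le1.
    by rewrite normrM ler_piMr// ler_norml cos_geN1 cos_le1.
  + exact: cvg_cst.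
  + rewrite -[X in _ --> X](mulr0 C); apply: cvgM; first exact: cvg_cst.
    exact: cvg_expRZ.
- by move=> t _; case: (dF t).
- by apply: cvg_at_right_filter; exact: cF.
- by move=> t _; rewrite derive1E; case: (dF t).
Qed.

Definition expw e t := expR (- (e * `|t|)).

Lemma expw_gt0 e t : 0 < expw e t. Proof. exact: expR_gt0. Qed.
Lemma expw_ge0 e t : 0 <= expw e t. Proof. exact: expR_ge0. Qed.
Lemma expw_le1 e t : 0 <= e -> expw e t <= 1.
Proof. by move=> e0; rewrite -[leRHS]expR0 ler_expR oppr_le0 mulr_ge0. Qed.

Lemma measurable_expw e : measurable_fun [set: R] (expw e).
Proof.
apply: (measurableT_comp (@measurable_expR R)); apply: measurable_funN.
apply: measurable_funM; first exact: measurable_cst.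
exact: normr_measurable.
Qed.

(** The reflected half line gives the same integral with [- be] for [be], so the sine contributions
    cancel and [be] disappears from the value. *)
Lemma integral_expw_trig e u al be : 0 < e -> `|al| <= 1 -> `|be| <= 1 ->
  (\int[mu1]_t (expw e t * (2 + al * cos (t * u) + be * sin (t * u)))%:E =
   (4 / e + 2 * al * e / (e ^+ 2 + u ^+ 2))%:E)%E.
Proof.
move=> e0 al1 be1; rewrite ge0_integral_line; last 2 first.
- apply: measurable_funM; first exact: measurable_expw.
  apply: measurable_funD; [apply: measurable_funD; first exact: measurable_cst|];
    (apply: measurable_funM; first exact: measurable_cst);
    (apply: (measurableT_comp (f := _)); [|exact: mulrr_measurable]).
    by apply: continuous_measurable_fun; exact: continuous_cos.
  by apply: continuous_measurable_fun; exact: continuous_sin.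
- move=> t; rewrite mulr_ge0 ?expw_ge0//.
  have absb (b w : R) : `|b| <= 1 -> -1 <= w <= 1 -> -1 <= b * w.
    move=> b1 w1; have : `|b * w| <= 1 * 1 by rewrite normrM ler_pM// ler_norml.
    by rewrite mul1r ler_norml => /andP[].
  have := absb al (cos (t * u)) al1; rewrite cos_geN1 cos_le1 => /(_ isT).
  by have := absb be (sin (t * u)) be1; rewrite sin_geN1 sin_le1 => /(_ isT); lra.
have beN : `|- be| <= 1 by rewrite normrN.
have -> : (\int[mu1]_(t in `[0%R, +oo[) (expw e t * (2 + al * cos (t * u) + be * sin (t * u)))%:E =
   (2 / e + (al * e + be * u) / (e ^+ 2 + u ^+ 2))%:E)%E.
  rewrite -integral_half//; apply: eq_integral => t.
  by rewrite inE/= in_itv/= andbT => t0; rewrite /expw ger0_norm// (mulrC t).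
have -> : (\int[mu1]_(t in `[0%R, +oo[) (expw e (- t) * (2 + al * cos (- t * u) + be * sin (- t * u)))%:E =
   (2 / e + (al * e + (- be) * u) / (e ^+ 2 + u ^+ 2))%:E)%E.
  rewrite -integral_half//; apply: eq_integral => t.
  rewrite inE/= in_itv/= andbT => t0; rewrite /expw normrN ger0_norm// mulNr cosN sinN (mulrC t).
  by rewrite mulrN mulNr.
rewrite -EFinD; congr EFin; field.
by rewrite (gt_eqF e0) andbT gt_eqF// ltr_wpDr ?sqr_ge0// exprn_gt0.
Qed.

Lemma integral_expw e : 0 < e -> (\int[mu1]_t (expw e t)%:E = (2 / e)%:E)%E.
Proof.
move=> e0; have := @integral_expw_trig e 0 0 0 e0; rewrite normr0 => /(_ ler01 ler01).
under eq_integral do rewrite !mul0r !addr0 mulrC EFinM.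
rewrite ge0_integralZl//; last 2 first.
- by apply/measurable_EFinP; exact: measurable_expw.
- by move=> t _; rewrite lee_fin expw_ge0.
move=> /(congr1 (fun x => (2^-1)%:E * x)%E); rewrite muleA -!EFinM mulVf// mul1e => ->.
by congr EFin; field; rewrite gt_eqF//= gt_eqF// expr0n addr0 exprn_gt0.
Qed.

Lemma integrable_expw e : 0 < e -> mu1.-integrable [set: R] (EFin \o expw e).
Proof.
move=> e0; apply/integrableP; split; first by apply/measurable_EFinP; exact: measurable_expw.
under eq_integral do rewrite gee0_abs ?lee_fin ?expw_ge0//.
by rewrite integral_expw// ltry.
Qed.

Lemma integrable_expwM e (b : R -> R) : 0 < e -> measurable_fun [set: R] b ->
  (forall t, `|b t| <= 1) -> mu1.-integrable [set: R] (EFin \o (fun t => expw e t * b t)).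
Proof.
move=> e0 mb b1; apply: le_integrable (integrable_expw e0) => //.
  by apply/measurable_EFinP/measurable_funM => //; exact: measurable_expw.
move=> t _; rewrite lee_fin normrM (ger0_norm (expw_ge0 _ _)).
by rewrite ler_piMr// expw_ge0.
Qed.

Lemma measurable_cos_mul u : measurable_fun [set: R] (fun t => cos (t * u)).
Proof.
apply: (measurableT_comp (f := @cos R)); last exact: mulrr_measurable.
by apply: continuous_measurable_fun; exact: continuous_cos.
Qed.

Lemma measurable_sin_mul u : measurable_fun [set: R] (fun t => sin (t * u)).
Proof.
apply: (measurableT_comp (f := @sin R)); last exact: mulrr_measurable.
by apply: continuous_measurable_fun; exact: continuous_sin.
Qed.

Lemma cos_abs1 t : `|cos t| <= 1. Proof. by rewrite ler_norml cos_geN1 cos_le1. Qed.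
Lemma sin_abs1 t : `|sin t| <= 1. Proof. by rewrite ler_norml sin_geN1 sin_le1. Qed.

(** The auxiliary summand 2 is removed by subtracting twice the integral of [expw e], which is
    legitimate since all terms are integrable separately. *)
Lemma Rintegral_expw_trig e u al be : 0 < e -> `|al| <= 1 -> `|be| <= 1 ->
  \int[mu1]_t (expw e t * (al * cos (t * u) + be * sin (t * u))) =
   2 * al * e / (e ^+ 2 + u ^+ 2).
Proof.
move=> e0 al1 be1; have := integral_expw_trig u e0 al1 be1.
have b1 (b w : R) : `|b| <= 1 -> `|w| <= 1 -> `|b * w| <= 1.
  by move=> ? ?; rewrite normrM mulr_ile1.
have ic : mu1.-integrable [set: R] (EFin \o (fun t => expw e t * (al * cos (t * u)))).
  apply: integrable_expwM => //; last by move=> t; rewrite b1// cos_abs1.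
  by apply: measurable_funM; [exact: measurable_cst|exact: measurable_cos_mul].
have is_ : mu1.-integrable [set: R] (EFin \o (fun t => expw e t * (be * sin (t * u)))).
  apply: integrable_expwM => //; last by move=> t; rewrite b1// sin_abs1.
  by apply: measurable_funM; [exact: measurable_cst|exact: measurable_sin_mul].
have iw := integrable_expw e0.
have iw2 : mu1.-integrable [set: R] (EFin \o (fun t => expw e t + expw e t)).
  by have := integrableD measurableT iw iw.
have ics : mu1.-integrable [set: R] (EFin \o (fun t => expw e t * (al * cos (t * u) + be * sin (t * u)))).
  have := integrableD measurableT ic is_; apply: eq_integrable => // t _.
  by rewrite /= -EFinD -mulrDr.
move=> /(congr1 fine); rewrite /= -[LHS]/(Rintegral _ _ _).
have -> : \int[mu1]_t (expw e t * (2 + al * cos (t * u) + be * sin (t * u))) =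
    \int[mu1]_t ((expw e t + expw e t) + expw e t * (al * cos (t * u) + be * sin (t * u))).
  by apply: eq_Rintegral => t _; ring.
rewrite RintegralD// RintegralD// {1 2}/Rintegral integral_expw//=; lra.
Qed.

Lemma Rintegral_expw_cos e u : 0 < e ->
  \int[mu1]_t (expw e t * cos (t * u)) = 2 * e / (e ^+ 2 + u ^+ 2).
Proof.
move=> e0; have := @Rintegral_expw_trig e u 1 0 e0.
rewrite normr0 normr1 mulr1 => <- //.
by apply: eq_Rintegral => t _; rewrite mul1r mul0r addr0.
Qed.

Lemma Rintegral_expw_sin e u : 0 < e -> \int[mu1]_t (expw e t * sin (t * u)) = 0.
Proof.
move=> e0; have := @Rintegral_expw_trig e u 0 1 e0.
rewrite normr0 normr1 mulr0 !mul0r => <- //.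
by apply: eq_Rintegral => t _; rewrite mul1r mul0r add0r.
Qed.

(** The Fourier transform of [expw e], which is 2 pi times the Cauchy density of width e; its
    integral does not depend on e. *)
Definition poisson e u := 2 * e / (e ^+ 2 + u ^+ 2).

Lemma poisson_ge0 e u : 0 <= e -> 0 <= poisson e u.
Proof. by move=> e0; rewrite divr_ge0 ?mulr_ge0// addr_ge0// ?sqr_ge0 ?exprn_ge0. Qed.

Lemma continuous_poisson e : 0 < e -> continuous (poisson e).
Proof.
move=> e0 u; apply: cvgM; first exact: cvg_cst.
apply: cvgV; first by rewrite gt_eqF// ltr_wpDr ?sqr_ge0// exprn_gt0.
by apply: cvgD; [exact: cvg_cst|exact: exprn_continuous].
Qed.

Lemma measurable_poisson e : 0 < e -> measurable_fun [set: R] (poisson e).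
Proof. by move=> e0; apply: continuous_measurable_fun; exact: continuous_poisson. Qed.

Lemma integral_poisson_itv e v a b : 0 < e -> a < b ->
  (\int[mu1]_(u in `[a, b]) (poisson e (u - v))%:E =
   (2 * (atan ((b - v) / e) - atan ((a - v) / e)))%:E)%E.
Proof.
move=> e0 ab; pose F u := 2 * atan ((u - v) / e).
have dF u : is_derive u 1 F (poisson e (u - v)).
  have d1 : is_derive u 1 (fun u => (u - v) / e) e^-1.
    rewrite (_ : (fun u => (u - v) / e) = (fun u => e^-1 * (u - v))); last first.
      by apply/funext => x; rewrite mulrC.
    by apply: is_derive_eq; rewrite /GRing.scale/=; ring.
  have d2 := @is_derive1_comp _ atan (fun u => (u - v) / e) u _ _ (is_derive1_atan _) d1.
  have d3 : is_derive u 1 F (2 *: ((1 + ((u - v) / e) ^+ 2)^-1 * e^-1)).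
    exact: (@is_deriveZ _ _ _ (atan \o (fun u => (u - v) / e)) 2).
  apply: (is_derive_eq d3); rewrite /poisson /GRing.scale/=.
  have D0 : e ^+ 2 + (u - v) ^+ 2 != 0 by rewrite gt_eqF// ltr_wpDr ?sqr_ge0// exprn_gt0.
  by field; rewrite (gt_eqF e0)/= D0 /=.
rewrite (@continuous_FTC2 _ _ F)//.
- by rewrite -EFinB /F; congr EFin; rewrite mulrBr.
- apply: continuous_subspaceT => u.
  apply: (@continuous_comp R R R (fun u => u - v) (poisson e)); last exact: continuous_poisson.
  by apply: cvgB; [exact: cvg_id|exact: cvg_cst].
- have cF u : {for u, continuous F}.
    by apply: differentiable_continuous; apply/derivable1_diffP; case: (dF u).
  split; first by move=> u _; case: (dF u).
    by apply: cvg_at_right_filter; exact: cF.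
  by apply: cvg_at_left_filter; exact: cF.
- by move=> u _; rewrite derive1E; case: (dF u).
Qed.

Lemma measurable_poissonB e v : 0 < e -> measurable_fun [set: R] (fun u => poisson e (u - v)).
Proof.
move=> e0; apply: (measurableT_comp (measurable_poisson e0)).
by apply: measurable_funB; [exact: measurable_id|exact: measurable_cst].
Qed.

(** On [-k, k] the primitive is 2 atan, whose increment is at most 2 pi; Fatou's lemma lets k go to
    infinity. *)
Lemma integral_poisson_le e v : 0 < e ->
  (\int[mu1]_u (poisson e (u - v))%:E <= (2 * pi)%:E)%E.
Proof.
move=> e0.
pose f_ k u := ((poisson e (u - v))%:E * (\1_(`[- k%:R, k%:R]%classic : set R) u)%:E)%E.
have mp := measurable_poissonB v e0.
apply: (@fatou_le _ (measurableTypeR R) R mu1 f_).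
- move=> k; apply: emeasurable_funM; first exact/measurable_EFinP.
  by apply/measurable_EFinP; apply: measurable_indic; exact: measurable_itv.
- by move=> k u; rewrite /f_ -EFinM lee_fin mulr_ge0// poisson_ge0// ltW.
- exact/measurable_EFinP.
- apply: aeW => u; apply: cvg_near_cst.
  near=> k; rewrite /f_ indicE mem_set ?mule1//=.
  rewrite in_itv/= -ler_norml.
  by near: k; exact: nbhs_infty_ger.
near=> k; rewrite /f_.
rewrite (_ : (\int[mu1]_x _)%E = (\int[mu1]_(u in `[(- k%:R)%R, (k%:R)%R]) (poisson e (u - v))%:E)%E).
  rewrite integral_poisson_itv//; last first.
    by rewrite ltrNl (@lt_le_trans _ _ 0)// ?oppr_lt0 ?oppr_le0// ltr0n; near: k; exists 1%N.
  rewrite lee_fin ler_wpM2l//.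
  have := atan_ltpi2 ((k%:R - v) / e); have := atan_gtNpi2 ((- k%:R - v) / e); lra.
rewrite [RHS]integral_mkcond; apply: eq_integral => u _.
by rewrite patchE indicE; case: ifPn; rewrite ?mule1 ?mule0.
Unshelve. all: by end_near. Qed.

End line_integrals.

(** * Fubini's theorem for real-valued integrals *)

Section Rintegral_products.
Context d1 d2 (T1 : measurableType d1) (T2 : measurableType d2) (R : realType).
Variables (m1 : {sigma_finite_measure set T1 -> \bar R})
          (m2 : {sigma_finite_measure set T2 -> \bar R}).

Lemma EFin_Rintegral d (T : measurableType d) (m : {measure set T -> \bar R}) (f : T -> R) :
  m.-integrable [set: T] (EFin \o f) ->
  (\int[m]_x f x)%:E = (\int[m]_x (f x)%:E)%E.
Proof. by move=> fi; rewrite fineK// integrable_fin_num. Qed.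

Lemma Rintegral_prod1 (f : T1 * T2 -> R) :
  (m1 \x m2)%E.-integrable setT (EFin \o f) ->
  (forall x, m2.-integrable [set: T2] (EFin \o (fun y => f (x, y)))) ->
  \int[m1]_x \int[m2]_y f (x, y) = \int[(m1 \x m2)%E]_z f z.
Proof.
move=> fi f2; rewrite {3}/Rintegral -(integral12_prod_meas1 fi); congr fine.
by apply: eq_integral => x _; rewrite EFin_Rintegral.
Qed.

Lemma Rintegral_prod2 (f : T1 * T2 -> R) :
  (m1 \x m2)%E.-integrable setT (EFin \o f) ->
  (forall y, m1.-integrable [set: T1] (EFin \o (fun x => f (x, y)))) ->
  \int[m2]_y \int[m1]_x f (x, y) = \int[(m1 \x m2)%E]_z f z.
Proof.
move=> fi f2; rewrite {3}/Rintegral -(integral21_prod_meas1 fi); congr fine.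
by apply: eq_integral => y _; rewrite EFin_Rintegral.
Qed.

Lemma integrable_prodM (a : T1 -> R) (b : T2 -> R) :
  m1.-integrable [set: T1] (EFin \o a) -> m2.-integrable [set: T2] (EFin \o b) ->
  (m1 \x m2)%E.-integrable setT (EFin \o (fun z => a z.1 * b z.2)).
Proof.
move=> ai bi; have /integrableP[ma aoo] := ai; have /integrableP[mb boo] := bi.
have mab : measurable_fun [set: T1 * T2] (fun z => a z.1 * b z.2).
  apply: measurable_funM.
    exact: (measurableT_comp (f := a) ((measurable_EFinP _ _).1 ma)).
  exact: (measurableT_comp (f := b) ((measurable_EFinP _ _).1 mb)).
apply/integrable12ltyP; first exact/measurable_EFinP.
rewrite (eq_integral (fun x => `|(a x)%:E| * \int[m2]_y `|(b y)%:E|)%E); last first.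
  move=> x _; rewrite -ge0_integralZl//; last exact: measurableT_comp.
  by apply: eq_integral => y _; rewrite /= normrM EFinM.
rewrite ge0_integralZr//; last 2 first.
- exact: measurableT_comp.
- exact: integral_ge0.
by rewrite lte_mul_pinfty//; [exact: integral_ge0|rewrite ge0_fin_numE//; exact: integral_ge0].
Qed.
End Rintegral_products.

(** * Exponential weights on R^n and their Fourier transforms *)

Section oscillatory.
Variable R : realType.
Local Notation mu1 := (@lebesgue_measure R).
Local Notation mu := (lebesgue_measure_Rn R).
Implicit Type e : R.

(** The exponent is the l^1 norm, so that the weight factors over the coordinates and its Fourier
    transform is a product of one-dimensional Poisson kernels. *)
Definition expwRn e n (x : Rn R n) : R := \prod_(i < n) expw e (tnth x i).
Definition poissonRn e n (x : Rn R n) : R := \prod_(i < n) poisson e (tnth x i).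
Definition subRn n (x y : Rn R n) : Rn R n := [tuple (tnth x i : R) - tnth y i | i < n].

Lemma dotRn_subr n (x v w : Rn R n) : dotRn x (subRn v w) = dotRn x v - dotRn x w.
Proof.
rewrite /dotRn -sumrB; apply: eq_bigr => i _.
by rewrite tnth_mktuple mulrBr.
Qed.

Lemma dotRnC n (x v : Rn R n) : dotRn x v = dotRn v x.
Proof. by apply: eq_bigr => i _; rewrite mulrC. Qed.

Lemma dotRn_cons n u (y : Rn R n) v w :
  dotRn (cons_Rn (u, y)) (cons_Rn (v, w)) = u * v + dotRn y w.
Proof.
rewrite /dotRn big_ord_recl; congr (_ + _).
by apply: eq_bigr => i _; rewrite !tnthS.
Qed.

Lemma uncons_RnK n : cancel (@uncons_Rn R n) (@cons_Rn R n).
Proof. by move=> x; rewrite [RHS]tuple_eta; apply/val_inj. Qed.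

Lemma measurable_tnth_comp d (T : measurableType d) n (f : T -> Rn R n) i :
  measurable_fun [set: T] f -> measurable_fun [set: T] (fun z => tnth (f z) i : R).
Proof. by move=> mf; exact: (measurableT_comp (measurable_tnth i)). Qed.

Lemma measurable_dotRn d (T : measurableType d) n (f g : T -> Rn R n) :
  measurable_fun [set: T] f -> measurable_fun [set: T] g ->
  measurable_fun [set: T] (fun z => dotRn (f z) (g z)).
Proof.
move=> mf mg; apply: measurable_sum => i.
by apply: measurable_funM; exact: measurable_tnth_comp.
Qed.

Lemma measurable_subRn d (T : measurableType d) n (f g : T -> Rn R n) :
  measurable_fun [set: T] f -> measurable_fun [set: T] g ->
  measurable_fun [set: T] (fun z => subRn (f z) (g z)).
Proof.
move=> mf mg; apply/measurable_fun_tnthP => i.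
rewrite (_ : _ \o _ = (fun z => (tnth (f z) i : R) - tnth (g z) i)).
  by apply: measurable_funB; exact: measurable_tnth_comp.
by apply/funext => z /=; rewrite tnth_mktuple.
Qed.

Lemma measurable_cos_comp d (T : measurableType d) (f : T -> R) :
  measurable_fun [set: T] f -> measurable_fun [set: T] (fun z => cos (f z)).
Proof.
move=> mf; apply: (measurableT_comp (f := @cos R)) mf.
by apply: continuous_measurable_fun; exact: continuous_cos.
Qed.

Lemma measurable_sin_comp d (T : measurableType d) (f : T -> R) :
  measurable_fun [set: T] f -> measurable_fun [set: T] (fun z => sin (f z)).
Proof.
move=> mf; apply: (measurableT_comp (f := @sin R)) mf.
by apply: continuous_measurable_fun; exact: continuous_sin.
Qed.

Lemma expwRn_ge0 e n (x : Rn R n) : 0 <= expwRn e x.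
Proof. by apply: prodr_ge0 => i _; exact: expw_ge0. Qed.

Lemma expwRn_gt0 e n (x : Rn R n) : 0 < expwRn e x.
Proof. by apply: prodr_gt0 => i _; exact: expw_gt0. Qed.

Lemma expwRn_le1 e n (x : Rn R n) : 0 <= e -> expwRn e x <= 1.
Proof. by move=> e0; apply: prodr_ile1 => i _; rewrite expw_ge0 expw_le1. Qed.

Lemma expwRn_cons e n u (y : Rn R n) : expwRn e (cons_Rn (u, y)) = expw e u * expwRn e y.
Proof.
rewrite /expwRn big_ord_recl; congr (_ * _).
by apply: eq_bigr => i _; rewrite tnthS.
Qed.

Lemma measurable_expwRn e n : measurable_fun [set: Rn R n] (@expwRn e n).
Proof. by apply: (@measurable_prod_Rn R n (fun=> expw e)) => i; exact: measurable_expw. Qed.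

Lemma poissonRn_ge0 e n (x : Rn R n) : 0 <= e -> 0 <= poissonRn e x.
Proof. by move=> e0; apply: prodr_ge0 => i _; exact: poisson_ge0. Qed.

Lemma measurable_poissonRn e n : 0 < e -> measurable_fun [set: Rn R n] (@poissonRn e n).
Proof. by move=> e0; apply: (@measurable_prod_Rn R n (fun=> poisson e)) => i; exact: measurable_poisson. Qed.

Lemma poissonRn_subC e n (v w : Rn R n) : poissonRn e (subRn v w) = poissonRn e (subRn w v).
Proof.
apply: eq_bigr => i _; rewrite !tnth_mktuple /poisson.
by rewrite -[X in _ = _ / (_ + X)]sqrrN opprB.
Qed.

Lemma integral_expwRn e n : 0 < e -> (\int[mu n]_x (expwRn e x)%:E = ((2 / e) ^+ n)%:E)%E.
Proof.
move=> e0; rewrite (@ge0_integral_prod R n (fun=> expw e))//; last 2 first.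
- by move=> i; exact: measurable_expw.
- by move=> i t; exact: expw_ge0.
under eq_bigr do rewrite integral_expw//.
by rewrite prodEFin prodr_const card_ord.
Qed.

Lemma integrable_expwRn e n : 0 < e -> (mu n).-integrable [set: Rn R n] (EFin \o @expwRn e n).
Proof.
move=> e0; apply/integrableP; split; first by apply/measurable_EFinP; exact: measurable_expwRn.
under eq_integral do rewrite gee0_abs ?lee_fin ?expwRn_ge0//.
by rewrite integral_expwRn// ltry.
Qed.

Lemma integrable_bound d (T : measurableType d) (m : {measure set T -> \bar R}) (w b : T -> R) :
  m.-integrable [set: T] (EFin \o w) -> measurable_fun [set: T] b ->
  (forall x, `|b x| <= `|w x|) -> m.-integrable [set: T] (EFin \o b).
Proof.
move=> wi mb bw; apply: le_integrable wi => //; first exact/measurable_EFinP.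
by move=> x _; rewrite lee_fin.
Qed.

Lemma integrable_mul1 d (T : measurableType d) (m : {measure set T -> \bar R}) (w b : T -> R) :
  m.-integrable [set: T] (EFin \o w) -> measurable_fun [set: T] b ->
  (forall x, `|b x| <= 1) -> m.-integrable [set: T] (EFin \o (fun x => w x * b x)).
Proof.
move=> wi mb bw; apply: (integrable_bound wi).
  by apply: measurable_funM => //; apply/measurable_EFinP; have /integrableP[] := wi.
by move=> x; rewrite normrM ler_piMr.
Qed.

(** Induction on the dimension, through the addition formulas for the phase. These mix cosine and
    sine, so both claims are proved together. *)
Lemma Rintegral_expwRn_trig e n (v : Rn R n) : 0 < e ->
  \int[mu n]_x (expwRn e x * cos (dotRn x v)) = poissonRn e v /\
  \int[mu n]_x (expwRn e x * sin (dotRn x v)) = 0.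
Proof.
move=> e0; have mdot m (w : Rn R m) : measurable_fun [set: Rn R m] (fun x => dotRn x w).
  by apply: measurable_dotRn; [exact: measurable_id|exact: measurable_cst].
have icos m (w : Rn R m) : (mu m).-integrable [set: Rn R m] (EFin \o (fun x => expwRn e x * cos (dotRn x w))).
  apply: integrable_mul1; [exact: integrable_expwRn| |by move=> x; exact: cos_abs1].
  by apply: measurable_cos_comp; exact: mdot.
have isin m (w : Rn R m) : (mu m).-integrable [set: Rn R m] (EFin \o (fun x => expwRn e x * sin (dotRn x w))).
  apply: integrable_mul1; [exact: integrable_expwRn| |by move=> x; exact: sin_abs1].
  by apply: measurable_sin_comp; exact: mdot.
elim: n v => [|n IH] v.
  have E (h : Rn R 0 -> R) : measurable_fun setT h -> \int[mu 0]_x h x = h [tuple].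
    move=> mh; rewrite /Rintegral integral_dirac//=; last exact/measurable_EFinP.
    by rewrite indicE mem_set// mul1r.
  rewrite !E; last 2 first.
  - by apply: measurable_funM; [exact: measurable_expwRn|by apply: measurable_sin_comp; exact: mdot].
  - by apply: measurable_funM; [exact: measurable_expwRn|by apply: measurable_cos_comp; exact: mdot].
  by rewrite /dotRn /expwRn /poissonRn !big_ord0 cos0 sin0 mulr1 mulr0.
rewrite -(uncons_RnK v) /=; set v0 := (uncons_Rn v).1; set w := (uncons_Rn v).2.
rewrite -[uncons_Rn v]/(v0, w).
have [IHc IHs] := IH w.
(* With u frozen, the addition formulas leave a combination of cosine and sine of the remaining
   phase; the sine part integrates to 0 by the induction hypothesis. *)
have step (a b : R) u : \int[mu n]_y (expw e u * expwRn e y * (a * cos (dotRn y w) + b * sin (dotRn y w))) =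
    expw e u * a * poissonRn e w.
  transitivity (\int[mu n]_y (expw e u * a * (expwRn e y * cos (dotRn y w)) +
      expw e u * b * (expwRn e y * sin (dotRn y w)))).
    by apply: eq_Rintegral => y _; ring.
  rewrite RintegralD//; last 2 first.
  - by have := integrableZl measurableT (expw e u * a) (icos _ w); under eq_fun do rewrite -EFinM.
  - by have := integrableZl measurableT (expw e u * b) (isin _ w); under eq_fun do rewrite -EFinM.
  by rewrite !RintegralZl// IHc IHs mulr0 addr0.
have stepE (a b : R) u : (\int[mu n]_y (expw e u * expwRn e y * (a * cos (dotRn y w) + b * sin (dotRn y w)))%:E =
    (expw e u * a * poissonRn e w)%:E)%E.
  rewrite -(step a b u) EFin_Rintegral//.
  have h1 := integrableZl measurableT (expw e u * a) (icos _ w).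
  have h2 := integrableZl measurableT (expw e u * b) (isin _ w).
  have := integrableD measurableT h1 h2; apply: eq_integrable => // y _ /=.
  by rewrite -!EFinM -EFinD; congr EFin; ring.
split.
  rewrite {1}/Rintegral integral_cons; last exact: icos.
  have -> : (\int[mu1]_u \int[mu n]_y (expwRn e (cons_Rn (u, y)) * cos (dotRn (cons_Rn (u, y)) (cons_Rn (v0, w))))%:E =
    \int[mu1]_u (expw e u * cos (u * v0) * poissonRn e w)%:E)%E.
    apply: eq_integral => u _; rewrite -(stepE (cos (u * v0)) (- sin (u * v0)) u).
    apply: eq_integral => y _; rewrite expwRn_cons dotRn_cons cosD; congr EFin.
    by rewrite mulNr.
  rewrite -[LHS]/(Rintegral _ _ _) RintegralZr//; last first.
    apply: integrable_expwM => //; first exact: measurable_cos_mul.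
    by move=> t; exact: cos_abs1.
  rewrite Rintegral_expw_cos// /poissonRn big_ord_recl; congr (_ * _).
  by apply: eq_bigr => i _; rewrite tnthS.
rewrite {1}/Rintegral integral_cons; last exact: isin.
have -> : (\int[mu1]_u \int[mu n]_y (expwRn e (cons_Rn (u, y)) * sin (dotRn (cons_Rn (u, y)) (cons_Rn (v0, w))))%:E =
    \int[mu1]_u (expw e u * sin (u * v0) * poissonRn e w)%:E)%E.
  apply: eq_integral => u _; rewrite -(stepE (sin (u * v0)) (cos (u * v0)) u).
  by apply: eq_integral => y _; rewrite expwRn_cons dotRn_cons sinD.
rewrite -[LHS]/(Rintegral _ _ _) RintegralZr//; last first.
  apply: integrable_expwM => //; first exact: measurable_sin_mul.
  by move=> t; exact: sin_abs1.
by rewrite Rintegral_expw_sin// mul0r.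
Qed.

End oscillatory.

(** * TT* and Schur's test *)

Section product_sigma_finite.
Context d1 d2 (T1 : measurableType d1) (T2 : measurableType d2) (R : realType).
Variables (m1 : {sigma_finite_measure set T1 -> \bar R})
          (m2 : {sigma_finite_measure set T2 -> \bar R}).

Lemma product_sigma_finite : sigma_finite setT (m1 \x m2)%E.
Proof.
have /sigma_finiteP[F [TF ndF Foo]] := sigma_finiteT m1.
have /sigma_finiteP[G [TG ndG Goo]] := sigma_finiteT m2.
exists (fun n => F n `*` G n).
  apply/esym; rewrite -subTset => -[x y] _.
  have [i _ Fix] : (\bigcup_k F k) x by rewrite -TF.
  have [j _ Gjy] : (\bigcup_k G k) y by rewrite -TG.
  exists (maxn i j) => //; split => /=.
    by move: Fix; exact/subsetPset/ndF/leq_maxl.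
  by move: Gjy; exact/subsetPset/ndG/leq_maxr.
move=> k; have [? ?] := Foo k; have [? ?] := Goo k.
split; first exact: measurableX.
by rewrite product_measure1E// lte_mul_pinfty// ge0_fin_numE.
Qed.

(** Packaged as a sigma-finite measure so that [m1 \x m2] can itself be a factor of a further
    product, as in the triple integral of TT* below. *)
Definition sigma_finite_prod : {sigma_finite_measure set (T1 * T2)%type -> \bar R} :=
  HB.pack (m1 \x m2)%E (Measure_isSigmaFinite.Build _ _ _ (m1 \x m2)%E product_sigma_finite).

End product_sigma_finite.

Section TTstar.
Context dX dT (X : measurableType dX) (T : measurableType dT) (R : realType).
Variables (mX : {sigma_finite_measure set X -> \bar R})
          (m : {sigma_finite_measure set T -> \bar R}).

(** The left side is the squared modulus of the integral of A e^(i al). Each square is a double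
    integral, and the two recombine by the formula for the cosine of a difference. *)
Lemma sqr_Rintegral_trig (A al : T -> R) :
  m.-integrable [set: T] (EFin \o A) -> measurable_fun [set: T] al ->
  (\int[m]_y (A y * cos (al y))) ^+ 2 + (\int[m]_y (A y * sin (al y))) ^+ 2 =
  \int[(m \x m)%E]_z (A z.1 * A z.2 * cos (al z.1 - al z.2)).
Proof.
move=> Ai mal.
pose a y := A y * cos (al y); pose b y := A y * sin (al y).
have ai : m.-integrable [set: T] (EFin \o a).
  by apply: integrable_mul1 => //; [exact: measurable_cos_comp|move=> x; exact: cos_abs1].
have bi : m.-integrable [set: T] (EFin \o b).
  by apply: integrable_mul1 => //; [exact: measurable_sin_comp|move=> x; exact: sin_abs1].
have sq (h : T -> R) : m.-integrable [set: T] (EFin \o h) ->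
    (\int[m]_y h y) ^+ 2 = \int[(m \x m)%E]_z (h z.1 * h z.2).
  move=> hi; rewrite -(@Rintegral_prod1 _ _ _ _ _ m m (fun z => h z.1 * h z.2)); last 2 first.
  - exact: integrable_prodM.
  - by move=> x /=; have := integrableZl measurableT (h x) hi; under eq_fun do rewrite -EFinM.
  rewrite -[RHS]/(\int[m]_x \int[m]_y (h x * h y)).
  under [RHS]eq_Rintegral do rewrite RintegralZl//.
  by rewrite RintegralZr.
rewrite (sq _ ai) (sq _ bi) -RintegralD//; [|exact: integrable_prodM..].
by apply: eq_Rintegral => z _; rewrite /a /b cosB; ring.
Qed.

(** The operator sends A to x |-> int A e^(i th(x, y)) dy. Composed with its adjoint in the weighted
    space [W], its kernel has real part [k]; for real A only this part matters. *)
Variables (W : X -> R) (th : X -> T -> R) (k : T * T -> R).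
Hypothesis Wi : mX.-integrable [set: X] (EFin \o W).
Hypothesis W0 : forall x, 0 <= W x.
Hypothesis mth : measurable_fun [set: X * T] (fun z => th z.1 z.2).
Hypothesis mk : measurable_fun [set: T * T] k.
Hypothesis k0 : forall z, 0 <= k z.
Hypothesis kC : forall x y, k (x, y) = k (y, x).
Hypothesis kE : forall z, \int[mX]_x (W x * cos (th x z.1 - th x z.2)) = k z.

Let mW : measurable_fun [set: X] W.
Proof. by apply/measurable_EFinP; have /integrableP[] := Wi. Qed.

Let mth1 x : measurable_fun [set: T] (th x).
Proof. exact: (measurableT_comp mth (measurable_pair1 x)). Qed.

Let J (A : T -> R) x := (\int[m]_y (A y * cos (th x y))) ^+ 2 + (\int[m]_y (A y * sin (th x y))) ^+ 2.

Let J0 A x : 0 <= J A x. Proof. by rewrite addr_ge0// sqr_ge0. Qed.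

(* Expand the square and integrate in [x] first. *)
Lemma TTstar_eq (A : T -> R) : m.-integrable [set: T] (EFin \o A) ->
  mX.-integrable [set: X] (EFin \o (fun x => W x * J A x)) /\
  \int[mX]_x (W x * J A x) = \int[(m \x m)%E]_z (A z.1 * A z.2 * k z).
Proof.
move=> Ai; have mA : measurable_fun [set: T] A by apply/measurable_EFinP; have /integrableP[] := Ai.
pose c (z : X * (T * T)) := cos (th z.1 z.2.1 - th z.1 z.2.2).
have pr1 : measurable_fun setT (fun z : X * (T * T) => (z.1, z.2.1)).
  apply/measurable_fun_pairP; split; first exact: measurable_fst.
  exact: (measurableT_comp measurable_fst measurable_snd).
have pr2 : measurable_fun setT (fun z : X * (T * T) => (z.1, z.2.2)).
  apply/measurable_fun_pairP; split; first exact: measurable_fst.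
  exact: (measurableT_comp measurable_snd measurable_snd).
have mc : measurable_fun setT c.
  apply: measurable_cos_comp; apply: measurable_funB.
    exact: (measurableT_comp mth pr1).
  exact: (measurableT_comp mth pr2).
pose g (z : X * (T * T)) := W z.1 * (A z.2.1 * A z.2.2) * c z.
have AAi := integrable_prodM Ai Ai.
have WAAi := integrable_prodM (m2 := sigma_finite_prod m m) Wi AAi.
have gi := integrable_mul1 WAAi mc (fun z => cos_abs1 _).
rewrite -/g in gi.
have g1 x : (m \x m)%E.-integrable setT (EFin \o (fun z => g (x, z))).
  rewrite /g /=.
  apply: (integrable_mul1 (w := fun z => W x * (A z.1 * A z.2)) (b := fun z => c (x, z))).
  - by have := integrableZl measurableT (W x) AAi; under eq_fun do rewrite -EFinM.
  - exact: (measurableT_comp mc (measurable_pair1 x)).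
  - by move=> z; exact: cos_abs1.
have g2 z : mX.-integrable setT (EFin \o (fun x => g (x, z))).
  rewrite /g /=.
  apply: (integrable_mul1 (w := fun x => W x * (A z.1 * A z.2)) (b := fun x => c (x, z))).
  - by have := integrableZr measurableT (A z.1 * A z.2) Wi; under eq_fun do rewrite -EFinM.
  - exact: (measurableT_comp mc (measurable_pair2 z)).
  - by move=> x; exact: cos_abs1.
have gJ x : \int[(m \x m)%E]_z g (x, z) = W x * J A x.
  rewrite /J sqr_Rintegral_trig// -RintegralZl//; last first.
    apply: integrable_mul1 => //; last by move=> z; exact: cos_abs1.
    exact: (measurableT_comp mc (measurable_pair1 x)).
  by apply: eq_Rintegral => z _; rewrite /g /c/= !mulrA.
split.
  have := integrable_fubini_F gi; apply: eq_integrable => // x _.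
  by rewrite /= -gJ EFin_Rintegral.
under eq_Rintegral do rewrite -gJ.
rewrite (Rintegral_prod1 gi g1) -(Rintegral_prod2 gi g2).
apply: eq_Rintegral => z _; rewrite -kE -RintegralZl//; last first.
  apply: integrable_mul1 => //; last by move=> x; exact: cos_abs1.
  exact: (measurableT_comp mc (measurable_pair2 z)).
by apply: eq_Rintegral => x _; rewrite /g /c/=; ring.
Qed.

(** As the cosine is at most 1. This bound makes A(x) A(y) k(x, y) integrable on the product. *)
Let kle z : k z <= \int[mX]_x W x.
Proof.
rewrite -kE; apply: le_Rintegral => //.
  apply: integrable_mul1 => //; last by move=> x; exact: cos_abs1.
  apply: measurable_cos_comp; apply: measurable_funB.
    exact: (measurableT_comp mth (measurable_pair2 z.1)).
  exact: (measurableT_comp mth (measurable_pair2 z.2)).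
by move=> x _; rewrite ler_piMr// cos_le1.
Qed.

(** By 2|A(x) A(y)| <= A(x)^2 + A(y)^2 and the symmetry of [k], two equal halves remain, each
    controlled by a row integral of [k]. Since A vanishes off E, rows and columns can be restricted
    to E. *)
Lemma schur (A : T -> R) (E : set T) (C : R) : measurable E -> 0 <= C ->
  m.-integrable [set: T] (EFin \o A) -> (forall y, ~ E y -> A y = 0) ->
  (forall x, E x -> (\int[m]_y (\1_E y * k (x, y))%:E <= C%:E)%E) ->
  (\int[mX]_x (W x * J A x)%:E <= C%:E * \int[m]_y (A y ^+ 2)%:E)%E.
Proof.
move=> mE C0 Ai AE hC.
have mA : measurable_fun [set: T] A by apply/measurable_EFinP; have /integrableP[] := Ai.
have [WJi WJE] := TTstar_eq Ai.
rewrite -EFin_Rintegral// WJE.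
have Aki : (m \x m)%E.-integrable setT (EFin \o (fun z => A z.1 * A z.2 * k z)).
  apply: (integrable_bound (w := fun z => (\int[mX]_x W x) * (A z.1 * A z.2))).
  - have := integrableZl measurableT (\int[mX]_x W x) (integrable_prodM Ai Ai).
    by under eq_fun do rewrite -EFinM.
  - apply: measurable_funM => //; apply: measurable_funM; exact: measurableT_comp.
  - move=> z; rewrite mulrC !(normrM _ (A z.1 * A z.2)) ler_wpM2r//.
    by rewrite !ger0_norm// ?kle// Rintegral_ge0.
rewrite EFin_Rintegral//.
have m1E : measurable_fun [set: T] (\1_E : T -> R) by exact: measurable_indic.
(* [q] and [q'] are the two halves of the arithmetic-geometric bound; the indicator keeps track of
   the variable in which A has been dropped. *)
pose q (z : T * T) : R := A z.1 ^+ 2 / 2 * (\1_E z.2 * k z).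
pose q' (z : T * T) : R := A z.2 ^+ 2 / 2 * (\1_E z.1 * k z).
have m1E1 : measurable_fun [set: T * T] (fun z => \1_E z.1 : R) by exact: (measurableT_comp m1E).
have m1E2 : measurable_fun [set: T * T] (fun z => \1_E z.2 : R) by exact: (measurableT_comp m1E).
have mA1 : measurable_fun [set: T * T] (fun z => A z.1) by exact: (measurableT_comp mA).
have mA2 : measurable_fun [set: T * T] (fun z => A z.2) by exact: (measurableT_comp mA).
have mq : measurable_fun setT q.
  apply: measurable_funM; apply: measurable_funM => //.
  exact: measurable_funX.
have mq' : measurable_fun setT q'.
  apply: measurable_funM; apply: measurable_funM => //.
  exact: measurable_funX.
have q0 z : 0 <= q z by rewrite mulr_ge0// ?divr_ge0 ?sqr_ge0 ?mulr_ge0.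
have q'0 z : 0 <= q' z by rewrite mulr_ge0// ?divr_ge0 ?sqr_ge0 ?mulr_ge0.
apply: (@le_trans _ _ (\int[(m \x m)%E]_z ((q z)%:E + (q' z)%:E))%E).
  apply: le_trans (lee_abs _) _.
  apply: le_trans (le_abse_integral _ _ _) _ => //; first by have /integrableP[] := Aki.
  apply: ge0_le_integral => //.
  - by apply: measurableT_comp => //; have /integrableP[] := Aki.
  - by apply: emeasurable_funD; exact/measurable_EFinP.
  move=> z _; rewrite -EFinD lee_fin /q /q' /=.
  have [E1|nE1] := pselect (E z.1); last first.
    by rewrite (AE _ nE1) !mul0r normr0 addr_ge0// ?q'0// mulr_ge0 ?mulr_ge0 ?expr0n ?mul0r.
  have [E2|nE2] := pselect (E z.2); last first.
    by rewrite (AE _ nE2) mulr0 !mul0r normr0 addr_ge0// ?q0// mulr_ge0 ?mulr_ge0 ?expr0n ?mul0r.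
  rewrite !indicE !mem_set// !mul1r normrM (ger0_norm (k0 _)) -mulrDl ler_wpM2r//.
  rewrite normrM -(real_normK (num_real (A z.1))) -(real_normK (num_real (A z.2))).
  have : 0 <= (`|A z.1| - `|A z.2|) ^+ 2 by exact: sqr_ge0.
  by nra.
have half : (\int[(m \x m)%E]_z (q z)%:E <= (C / 2)%:E * \int[m]_y (A y ^+ 2)%:E)%E.
  rewrite (@fubini_tonelli1 _ _ _ _ R m m (EFin \o q))//; [|exact/measurable_EFinP].
  rewrite -ge0_integralZl//; [|by apply/measurable_EFinP; exact: measurable_funX|by move=> y _; rewrite lee_fin sqr_ge0|by rewrite lee_fin divr_ge0].
  apply: ge0_le_integral => //.
  - by move=> x _; apply: integral_ge0 => y _; rewrite lee_fin.
  - by apply: (@measurable_fun_fubini_tonelli_F _ _ _ _ R m (EFin \o q)) => //; exact/measurable_EFinP.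
  - by apply: emeasurable_funM => //; apply/measurable_EFinP; exact: measurable_funX.
  move=> x _; rewrite /fubini_F /q/=.
  under eq_integral do rewrite EFinM.
  rewrite ge0_integralZl//; first last.
  - by rewrite lee_fin divr_ge0 ?sqr_ge0.
  - by move=> y _; rewrite lee_fin mulr_ge0.
  - apply/measurable_EFinP; apply: measurable_funM => //.
    exact: (measurableT_comp mk (measurable_pair1 x)).
  have [Ex|nEx] := pselect (E x); last by rewrite (AE _ nEx) expr0n !mul0r mul0e mule0.
  rewrite muleC -EFinM (_ : C / 2 * _ = C * (A x ^+ 2 / 2)); last by ring.
  by rewrite [X in (_ <= X)%E]EFinM lee_wpmul2r ?hC// lee_fin divr_ge0 ?sqr_ge0.
have half' : (\int[(m \x m)%E]_z (q' z)%:E = \int[(m \x m)%E]_z (q z)%:E)%E.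
  apply: etrans (@fubini_tonelli2 _ _ _ _ R m m (EFin \o q') _ _) _.
  - exact/measurable_EFinP.
  - by move=> z; rewrite lee_fin.
  apply: etrans (esym (@fubini_tonelli1 _ _ _ _ R m m (EFin \o q) _ _)).
  - by apply: eq_integral => x _; apply: eq_integral => y _; rewrite /q/q'/= kC.
  - exact/measurable_EFinP.
  - by move=> z; rewrite lee_fin.
rewrite ge0_integralD//; [|by move=> z _; rewrite lee_fin|exact/measurable_EFinP|by move=> z _; rewrite lee_fin|exact/measurable_EFinP].
rewrite half'; apply: le_trans (leeD half half) _.
rewrite -ge0_muleDl ?lee_fin ?divr_ge0// -EFinD.
by rewrite (_ : C / 2 + C / 2 = C)//; field.
Qed.

End TTstar.

(** * Oscillatory integrals of complex-valued functions *)

Section complex_phase.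
Context (R : realType) (n : nat).
Local Notation mu := (lebesgue_measure_Rn R n).
Local Open Scope complex_scope.
Implicit Types (f g : Rn R n -> R[i]).

Definition cintegrable f :=
  mu.-integrable [set: Rn R n] (EFin \o (fun x => complex.Re (f x))) /\
  mu.-integrable [set: Rn R n] (EFin \o (fun x => complex.Im (f x))).

Lemma cintegrable_cmeas f : cintegrable f -> cmeas f.
Proof.
by move=> [f1 f2]; split; apply/measurable_EFinP; [have /integrableP[] := f1|have /integrableP[] := f2].
Qed.

Lemma ReE_expiM u (z : R[i]) : complex.Re (expi u * z) = complex.Re z * cos u - complex.Im z * sin u.
Proof. by rewrite ReM /=; ring. Qed.
Lemma ImE_expiM u (z : R[i]) : complex.Im (expi u * z) = complex.Re z * sin u + complex.Im z * cos u.
Proof. by rewrite ImM /=; ring. Qed.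

Lemma sqn_expi (u : R) : sqn (expi u) = 1.
Proof. by rewrite /sqn/= cos2Dsin2. Qed.

Lemma sqn_expiM u (z : R[i]) : sqn (expi u * z) = sqn z.
Proof. by rewrite sqnM sqn_expi mul1r. Qed.

Lemma expiD (u v : R) : expi (u + v) = expi u * expi v.
Proof.
apply/eqP; rewrite eq_complex; apply/andP; split; apply/eqP.
  by rewrite ReM /= cosD.
by rewrite ImM /= sinD; ring.
Qed.

Lemma expi0 : expi (0 : R) = 1.
Proof. by rewrite /expi cos0 sin0. Qed.

Lemma cmeas_expi d (T : measurableType d) (ph : T -> R) :
  measurable_fun [set: T] ph -> cmeas (fun x => expi (ph x)).
Proof. by move=> mph; split => /=; [exact: measurable_cos_comp|exact: measurable_sin_comp]. Qed.

Variables (ph : Rn R n -> R).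
Hypothesis mph : measurable_fun [set: Rn R n] ph.

Let trig_integrable (A : Rn R n -> R) : mu.-integrable [set: Rn R n] (EFin \o A) ->
  mu.-integrable [set: Rn R n] (EFin \o (fun y => A y * cos (ph y))) /\
  mu.-integrable [set: Rn R n] (EFin \o (fun y => A y * sin (ph y))).
Proof.
move=> Ai; split.
  by apply: integrable_mul1 => //; [exact: measurable_cos_comp|move=> x; exact: cos_abs1].
by apply: integrable_mul1 => //; [exact: measurable_sin_comp|move=> x; exact: sin_abs1].
Qed.

Lemma cintegrable_phase f : cintegrable f -> cintegrable (fun y => expi (ph y) * f y).
Proof.
move=> [/trig_integrable[Ac As] /trig_integrable[Bc Bs]]; split.
  have := integrableB measurableT Ac Bs; apply: eq_integrable => // y _.
  by rewrite /= ReE_expiM.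
have := integrableD measurableT As Bc; apply: eq_integrable => // y _.
by rewrite /= ImE_expiM.
Qed.

Lemma cintegral_phase f : cintegrable f ->
  cintegral (fun y => expi (ph y) * f y) =
  (\int[mu]_y (complex.Re (f y) * cos (ph y)) - \int[mu]_y (complex.Im (f y) * sin (ph y))) +i*
  (\int[mu]_y (complex.Re (f y) * sin (ph y)) + \int[mu]_y (complex.Im (f y) * cos (ph y))).
Proof.
move=> [/trig_integrable[Ac As] /trig_integrable[Bc Bs]].
rewrite /cintegral -RintegralB// -RintegralD//.
congr (_ +i* _); apply: eq_Rintegral => y _; first by rewrite ReE_expiM.
by rewrite ImE_expiM.
Qed.

(** Reduction to real amplitudes: real and imaginary parts of f contribute separately, at the price
    of the factor 2 from (u + v)^2 <= 2 u^2 + 2 v^2. *)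
Lemma sqn_cintegral_phase f : cintegrable f ->
  sqn (cintegral (fun y => expi (ph y) * f y)) <=
  2 * ((\int[mu]_y (complex.Re (f y) * cos (ph y))) ^+ 2 + (\int[mu]_y (complex.Re (f y) * sin (ph y))) ^+ 2) +
  2 * ((\int[mu]_y (complex.Im (f y) * cos (ph y))) ^+ 2 + (\int[mu]_y (complex.Im (f y) * sin (ph y))) ^+ 2).
Proof.
move=> fi; rewrite cintegral_phase// /sqn/=.
set a := Rintegral _ _ _; set b := Rintegral _ _ _; set c := Rintegral _ _ _; set e := Rintegral _ _ _.
have := sqr_ge0 (a + b); have := sqr_ge0 (c - e); nra.
Qed.

End complex_phase.

Section complex_TTstar.
Context (R : realType) (n : nat) dX (X : measurableType dX).
Variable mX : {sigma_finite_measure set X -> \bar R}.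
Local Notation mu := (lebesgue_measure_Rn R n).
Local Notation T := (Rn R n).
Variables (W : X -> R) (th : X -> T -> R) (k : T * T -> R).
Hypothesis Wi : mX.-integrable [set: X] (EFin \o W).
Hypothesis W0 : forall x, 0 <= W x.
Hypothesis mth : measurable_fun [set: X * T] (fun z => th z.1 z.2).
Hypothesis mk : measurable_fun [set: T * T] k.
Hypothesis k0 : forall z, 0 <= k z.
Hypothesis kC : forall x y : T, k (x, y) = k (y, x).
Hypothesis kE : forall z : T * T, \int[mX]_x (W x * cos (th x z.1 - th x z.2)) = k z.

(** An integral depending on a parameter is measurable because its positive and negative parts are,
    by Tonelli; the four real integrals of [cintegral_phase] are treated one by one. *)
Lemma measurable_cintegral_phase (f : T -> R[i]) : cintegrable f ->
  cmeas (fun x => cintegral (fun y => (expi (th x y) * f y)%R)).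
Proof.
move=> fi; have [f1 f2] := fi.
have mth1 x : measurable_fun [set: T] (th x) by exact: (measurableT_comp mth (measurable_pair1 x)).
have mF (A : T -> R) (tr : R -> R) : measurable_fun [set: T] A -> measurable_fun [set: R] tr ->
    measurable_fun [set: X] (fun x => \int[mu]_y (A y * tr (th x y))).
  move=> mA mtr; apply: measurableT_comp => //.
  have mg : measurable_fun [set: X * T] (fun z : X * T => (A z.2 * tr (th z.1 z.2))%:E).
    apply/measurable_EFinP; apply: measurable_funM; first exact: (measurableT_comp mA).
    exact: (measurableT_comp mtr).
  rewrite (_ : (fun x => \int[mu]_x0 (A x0 * tr (th x x0))%:E)%E = (fun x =>
     (\int[mu]_y ((fun z : X * T => (A z.2 * tr (th z.1 z.2))%:E)^\+ (x, y)) -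
      \int[mu]_y ((fun z : X * T => (A z.2 * tr (th z.1 z.2))%:E)^\- (x, y))))%E); last first.
    apply/funext => x; rewrite integralE; congr (_ - _)%E; apply: eq_integral => y _.
      by rewrite [RHS](congr1 (@^~ y) (esym (funepos_comp _ (fun y => (x, y))))).
    by rewrite [RHS](congr1 (@^~ y) (esym (funeneg_comp _ (fun y => (x, y))))).
  apply: emeasurable_funB.
    by apply: measurable_fun_fubini_tonelli_F => //; exact: measurable_funepos.
  by apply: measurable_fun_fubini_tonelli_F => //; exact: measurable_funeneg.
have [m1 m2] := cintegrable_cmeas fi.
have mc : measurable_fun [set: R] (@cos R) by exact: continuous_measurable_fun (@continuous_cos R).
have ms : measurable_fun [set: R] (@sin R) by exact: continuous_measurable_fun (@continuous_sin R).
split; under eq_fun do rewrite cintegral_phase//=.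
  by apply: measurable_funB; exact: mF.
by apply: measurable_funD; exact: mF.
Qed.

Lemma TTstar_complex (f : T -> R[i]) (E : set T) (C : R) :
  cintegrable f -> measurable E -> 0 <= C -> (forall y, ~ E y -> f y = 0) ->
  (forall x, E x -> (\int[mu]_y (\1_E y * k (x, y))%:E <= C%:E)%E) ->
  (\int[mX]_x (W x * sqn (cintegral (fun y => (expi (th x y) * f y)%R)))%:E <=
    (2 * C)%:E * N2 mu f)%E.
Proof.
move=> fi mE C0 fE hC; have [f1 f2] := fi.
have mf := cintegrable_cmeas fi.
have mth1 x : measurable_fun [set: T] (th x) by exact: (measurableT_comp mth (measurable_pair1 x)).
have mW : measurable_fun [set: X] W by apply/measurable_EFinP; have /integrableP[] := Wi.
have h1 := schur Wi W0 mth mk k0 kC kE mE C0 f1 (fun y nE => congr1 (@complex.Re _) (fE y nE)) hC.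
have h2 := schur Wi W0 mth mk k0 kC kE mE C0 f2 (fun y nE => congr1 (@complex.Im _) (fE y nE)) hC.
pose J (A : T -> R) x := (\int[mu]_y (A y * cos (th x y))) ^+ 2 + (\int[mu]_y (A y * sin (th x y))) ^+ 2.
pose A y := complex.Re (f y); pose B y := complex.Im (f y).
have J0 h x : 0 <= J h x by rewrite addr_ge0// sqr_ge0.
have [/integrableP[/measurable_EFinP mJA _] _] := TTstar_eq Wi mth kE f1.
have [/integrableP[/measurable_EFinP mJB _] _] := TTstar_eq Wi mth kE f2.
apply: (@le_trans _ _ (\int[mX]_x (2%:E * (W x * J A x)%:E + 2%:E * (W x * J B x)%:E))%E).
  apply: ge0_le_integral => //.
  - by move=> x _; rewrite lee_fin mulr_ge0// addr_ge0// sqr_ge0.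
  - apply/measurable_EFinP; apply: measurable_funM => //.
    by apply: measurable_sqn; exact: measurable_cintegral_phase.
  - apply: emeasurable_funD; apply: emeasurable_funM => //; exact/measurable_EFinP.
  move=> x _; rewrite -!EFinM -EFinD lee_fin mulrCA [in leRHS](mulrCA 2) -mulrDr.
  by rewrite ler_wpM2l//; exact: sqn_cintegral_phase.
rewrite ge0_integralD//; first last.
- by apply: emeasurable_funM => //; exact/measurable_EFinP.
- by move=> x _; rewrite -EFinM lee_fin mulr_ge0// mulr_ge0.
- by apply: emeasurable_funM => //; exact/measurable_EFinP.
- by move=> x _; rewrite -EFinM lee_fin mulr_ge0// mulr_ge0.
rewrite !ge0_integralZl//; first last.
- by move=> x _; rewrite lee_fin mulr_ge0.
- exact/measurable_EFinP.
- by move=> x _; rewrite lee_fin mulr_ge0.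
- exact/measurable_EFinP.
have [m1 m2] := mf.
apply: (@le_trans _ _ (2%:E * (C%:E * \int[mu]_y (A y ^+ 2)%:E) + 2%:E * (C%:E * \int[mu]_y (B y ^+ 2)%:E))%E).
  by apply: leeD; rewrite lee_wpmul2l// lee_fin.
rewrite !muleA -ge0_muleDr; last 2 first.
- by apply: integral_ge0 => y _; rewrite lee_fin sqr_ge0.
- by apply: integral_ge0 => y _; rewrite lee_fin sqr_ge0.
rewrite -ge0_integralD//; first last.
- by apply/measurable_EFinP; exact: measurable_funX.
- by move=> x _; rewrite lee_fin sqr_ge0.
- by apply/measurable_EFinP; exact: measurable_funX.
- by move=> x _; rewrite lee_fin sqr_ge0.
Qed.

End complex_TTstar.

(** * Boundedness of the Fourier integral for the L^2 norm *)

Section bessel_inequality.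
Context (R : realType) (n : nat).
Local Notation mu := (lebesgue_measure_Rn R n).
Local Notation mu1 := (@lebesgue_measure R).

Lemma lee_prod (I : finType) (u v : I -> \bar R) : (forall i, (0 <= u i)%E) ->
  (forall i, (u i <= v i)%E) -> (\prod_i u i <= \prod_i v i)%E.
Proof.
move=> u0 uv; suff : ((0 <= \prod_i u i) /\ (\prod_i u i <= \prod_i v i))%E by case.
elim/big_ind2 : _ => [|x1 y1 x2 y2 [h1 h2] [h3 h4]|i _]; first by rewrite lexx lee_fin.
  by split; [exact: mule_ge0|exact: lee_pmul].
by [].
Qed.

Lemma integral_poissonRn_le (e : R) (x : Rn R n) : 0 < e ->
  (\int[mu]_y (poissonRn e (subRn x y))%:E <= ((2 * pi) ^+ n)%:E)%E.
Proof.
move=> e0.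
have -> : (\int[mu]_y (poissonRn e (subRn x y))%:E =
    \int[mu]_y (\prod_(i < n) (fun i u => poisson e (u - (tnth x i : R))) i (tnth y i))%:E)%E.
  apply: eq_integral => y _; rewrite poissonRn_subC; congr EFin.
  by apply: eq_bigr => i _; rewrite tnth_mktuple.
rewrite (@ge0_integral_prod R n (fun i u => poisson e (u - (tnth x i : R)))); last 2 first.
- by move=> i; exact: measurable_poissonB.
- by move=> i u; rewrite poisson_ge0// ltW.
have -> : ((2 * pi) ^+ n)%:E = (\prod_(i < n) ((2 * pi)%:E : \bar R))%E.
  by rewrite prodEFin prodr_const card_ord.
apply: lee_prod => i; last exact: integral_poisson_le.
by apply: integral_ge0 => u _; rewrite lee_fin poisson_ge0// ltW.
Qed.

Lemma poissonRn_signM (e sg : R) (v : Rn R n) : sg ^+ 2 = 1 ->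
  poissonRn e [tuple sg * (tnth v i : R) | i < n] = poissonRn e v.
Proof.
by move=> sg1; apply: eq_bigr => i _; rewrite tnth_mktuple /poisson exprMn sg1 mul1r.
Qed.

Lemma dotRn_sign (sg : R) (x v : Rn R n) :
  dotRn x [tuple sg * (tnth v i : R) | i < n] = sg * dotRn x v.
Proof.
rewrite /dotRn mulr_sumr; apply: eq_bigr => i _.
by rewrite tnth_mktuple mulrCA.
Qed.

(** TT* with the weight e^(-e|xi|_1): the kernel is a product of Poisson kernels, whose row
    integrals are at most (2 pi)^n uniformly in e. Fatou's lemma then removes the weight along e =
    1/(m+1). Both signs [sg] are covered because the Poisson kernel is even. The constant is twice
    the one in Plancherel's identity. *)
Lemma bessel_ineq (sg : R) (f : Rn R n -> R[i]) : sg ^+ 2 = 1 -> cintegrable f ->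
  cmeas (fun xi => cintegral (fun x => (expi (sg * dotRn xi x) * f x)%R)) /\
  (N2 mu (fun xi => cintegral (fun x => (expi (sg * dotRn xi x) * f x)%R)) <=
    (2 * (2 * pi) ^+ n)%:E * N2 mu f)%E.
Proof.
move=> sg1 fi; have mf := cintegrable_cmeas fi.
pose th (xi x : Rn R n) := sg * dotRn xi x.
have mth : measurable_fun setT (fun z : Rn R n * Rn R n => th z.1 z.2).
  apply: measurable_funM; first exact: measurable_cst.
  by apply: measurable_dotRn; [exact: measurable_fst|exact: measurable_snd].
have mU := measurable_cintegral_phase mth fi.
split=> //.
pose U xi := cintegral (fun x => expi (th xi x) * f x).
pose f_ m xi := (expwRn (m.+1%:R^-1) xi * sqn (U xi))%:E.
have e0 m : 0 < m.+1%:R^-1 :> R by rewrite invr_gt0.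
apply: (@fatou_le _ _ _ mu f_).
- move=> m; apply/measurable_EFinP; apply: measurable_funM; first exact: measurable_expwRn.
  exact: measurable_sqn.
- by move=> m xi; rewrite lee_fin mulr_ge0 ?expwRn_ge0// sqn_ge0.
- exact: emeasurable_sqn.
- apply: aeW => xi; apply: cvg_EFin; first exact: nearW.
  rewrite -[X in _ --> X]mul1r; apply: cvgM; last exact: cvg_cst.
  rewrite /expwRn -[X in _ --> X](_ : \prod_(i < n) (1 : R) = _); last by rewrite prodr_const expr1n.
  apply: cvg_big => [|i _]; first exact: mul_continuous.
  rewrite -[X in _ --> X](@expR0 R); apply: continuous_cvg; first exact: continuous_expR.
  rewrite -[X in _ --> X]oppr0; apply: cvgN.
  rewrite -[X in _ --> X](mul0r `|tnth xi i|); apply: cvgM; last exact: cvg_cst.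
  exact: cvg_harmonic.
apply: nearW => m; rewrite /f_.
pose k (z : Rn R n * Rn R n) := poissonRn (m.+1%:R^-1) (subRn z.1 z.2).
have mk : measurable_fun setT k.
  have ms : measurable_fun setT (fun z : Rn R n * Rn R n => subRn z.1 z.2).
    by apply: measurable_subRn; [exact: measurable_fst|exact: measurable_snd].
  have mp : measurable_fun [set: Rn R n] (@poissonRn R (m.+1%:R^-1) n) by exact: measurable_poissonRn.
  exact: (measurableT_comp mp ms).
have C0 : (0 : R) <= (2 * pi) ^+ n by rewrite exprn_ge0// mulr_ge0// pi_ge0.
have hT := @TTstar_complex R n _ _ mu (@expwRn R (m.+1%:R^-1) n) th k.
refine (hT _ _ mth mk _ _ _ f setT _ fi measurableT C0 _ _) => //.
- exact: integrable_expwRn.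
- by move=> x; exact: expwRn_ge0.
- by move=> z; apply: poissonRn_ge0; exact: ltW.
- by move=> x y; rewrite /k/= poissonRn_subC.
- move=> z; rewrite /k -(poissonRn_signM _ _ sg1).
  have [<- _] := Rintegral_expwRn_trig [tuple sg * (tnth (subRn z.1 z.2) i : R) | i < n] (e0 m).
  by apply: eq_Rintegral => x _; rewrite /th dotRn_sign dotRn_subr mulrBr.
- by move=> y /(_ I).
- move=> x _; rewrite /k /=; under eq_integral do rewrite indicT mul1r.
  exact: integral_poissonRn_le.
Qed.

End bessel_inequality.

(** * Extension by continuity to L^2 *)

Section Lp_bridge.
Context (R : realType) (n : nat).
Local Notation mu := (lebesgue_measure_Rn R n).
Local Notation normc := (@ComplexField.Normc.normc _).
Implicit Types (f g h : Rn R n -> R[i]) (p : R).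

(** The p-th power of [cLnorm p], additive in the integrand and free of roots; it is [N2] when p =
    2. *)
Definition Np p f : \bar R := (\int[mu]_x (normc (f x) `^ p)%:E)%E.

Lemma normcE (z : R[i]) : normc z = Num.sqrt (sqn z). Proof. by case: z. Qed.

Lemma normc_ge0 (z : R[i]) : 0 <= normc z. Proof. by rewrite normcE sqrtr_ge0. Qed.

Lemma sqr_normc (z : R[i]) : normc z ^+ 2 = sqn z.
Proof. by rewrite normcE sqr_sqrtr// sqn_ge0. Qed.

Lemma Np_ge0 p f : (0 <= Np p f)%E.
Proof. by apply: integral_ge0 => x _; rewrite lee_fin powR_ge0. Qed.

Lemma cLnorm_powR p f : 0 < p -> (cLnorm p f `^ p = Np p f)%E.
Proof.
move=> p0; have h := @powR_Lnorm _ _ R mu (fun x => (normc (f x))%:E) p (lt0r_neq0 p0).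
apply: (etrans h); apply: eq_integral => x _.
by rewrite abse_EFin ger0_norm ?normc_ge0// poweR_EFin.
Qed.

Lemma cLnorm_ge0 p f : (0 <= cLnorm p f)%E. Proof. exact: Lnorm_ge0. Qed.

Lemma cLnorm_lty p f : 0 < p -> (cLnorm p f < +oo)%E <-> (Np p f < +oo)%E.
Proof.
move=> p0; rewrite -cLnorm_powR//; have := cLnorm_ge0 p f.
by case: (cLnorm p f) => [r| |]// r0; [rewrite poweR_EFin !ltry|rewrite poweRyr ?gt_eqF// ltxx].
Qed.

Lemma cLnorm_le p f (e : R) : 0 < p -> 0 <= e ->
  (cLnorm p f <= e%:E)%E <-> (Np p f <= (e `^ p)%:E)%E.
Proof.
move=> p0 e0; rewrite -cLnorm_powR//; have := cLnorm_ge0 p f.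
case: (cLnorm p f) => [r| |]//; last by rewrite poweRyr ?gt_eqF// !leye_eq.
rewrite poweR_EFin !lee_fin => r0; split => [re|]; first by rewrite ge0_ler_powR// ?nnegrE// ltW.
move=> h; rewrite leNgt; apply/negP => er.
by move: h; apply/negP; rewrite -ltNge gt0_ltr_powR// nnegrE.
Qed.

Lemma cvgLpP p (g_ : nat -> Rn R n -> R[i]) g : 0 < p ->
  cvgLp p g_ g <-> tends0 (fun k => Np p (fun x => g_ k x - g x)).
Proof.
move=> p0; rewrite /cvgLp -tends0P; last by move=> k; exact: cLnorm_ge0.
split=> h e e0.
  have [N hN] := h (e `^ p^-1) (powR_gt0 _ e0); exists N => k /hN.
  move=> /(cLnorm_le _ p0 (powR_ge0 _ _)).
  by rewrite -powRrM mulVf ?gt_eqF// powRr1 ?(ltW e0).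
have [N hN] := h (e `^ p) (powR_gt0 _ e0); exists N => k /hN.
by move=> /(cLnorm_le _ p0 (ltW e0)).
Qed.

Lemma Np2 f : Np 2 f = N2 mu f.
Proof. by apply: eq_integral => x _; rewrite powR_mulrn ?normc_ge0// sqr_normc. Qed.

Lemma measurable_normc f : cmeas f -> measurable_fun [set: Rn R n] (fun x => normc (f x)).
Proof.
move=> mf; under eq_fun do rewrite normcE.
apply: (measurableT_comp (f := @Num.sqrt R)); last exact: measurable_sqn.
by apply: continuous_measurable_fun; exact: sqrt_continuous.
Qed.

Lemma measurable_normc_powR p f : cmeas f ->
  measurable_fun [set: Rn R n] (fun x => normc (f x) `^ p).
Proof.
move=> mf; have mp : measurable_fun [set: R] (fun r : R => r `^ p) by exact: measurable_powR.
exact: (measurableT_comp mp (measurable_normc mf)).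
Qed.

Definition L2 f := cmeas f /\ (N2 mu f < +oo)%E.

Lemma memLpP p f : 0 < p -> memLp p f <-> cmeas f /\ (Np p f < +oo)%E.
Proof.
move=> p0; split=> [[m1 m2 /(cLnorm_lty _ p0)]|[[m1 m2] /(cLnorm_lty _ p0)]] => //.
Qed.

Lemma memLp2P f : memLp 2 f <-> L2 f.
Proof. by rewrite memLpP// Np2. Qed.

Lemma normc_ReIm (z : R[i]) : [/\ `|complex.Re z| <= normc z, `|complex.Im z| <= normc z &
  normc z <= `|complex.Re z| + `|complex.Im z|].
Proof.
case: z => a b /=; split.
- by rewrite -sqrtr_sqr ler_wsqrtr// lerDl sqr_ge0.
- by rewrite -[leLHS]sqrtr_sqr ler_wsqrtr// lerDr sqr_ge0.
- have h : 0 <= `|a| + `|b| by rewrite addr_ge0.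
  rewrite -[leRHS](ger0_norm h) -[leRHS]sqrtr_sqr ler_wsqrtr//.
  rewrite sqrrD !real_normK ?num_real// lerD2r lerDl mulrn_wge0// mulr_ge0//.
Qed.

Lemma cintegrableP f : cintegrable f <-> cmeas f /\ (Np 1 f < +oo)%E.
Proof.
split=> [fi|[mf fi]].
  have mf := cintegrable_cmeas fi; split => //; have [f1 f2] := fi.
  have := integrableD measurableT (integrable_norm f1) (integrable_norm f2).
  move=> /integrableP[_]; apply: le_lt_trans; apply: ge0_le_integral => //.
  - by move=> x _; rewrite lee_fin powR_ge0.
  - by apply/measurable_EFinP; exact: measurable_normc_powR.
  - have [m1 m2] := mf; apply: measurableT_comp => //.
    by apply: emeasurable_funD; apply/measurable_EFinP; exact: measurableT_comp.
  - move=> x _; rewrite -[X in (_ <= X)%E]/((`| `|complex.Re (f x)| + `|complex.Im (f x)| |)%:E) lee_fin powRr1 ?normc_ge0//.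
    by apply: le_trans (ler_norm _); have [] := normc_ReIm (f x).
have ni : mu.-integrable [set: Rn R n] (EFin \o (fun x => normc (f x))).
  apply/integrableP; split; first by apply/measurable_EFinP; exact: measurable_normc.
  apply: le_lt_trans fi; apply: ge0_le_integral => //.
  - by apply: measurableT_comp => //; apply/measurable_EFinP; exact: measurable_normc.
  - by apply/measurable_EFinP; exact: measurable_normc_powR.
  - by move=> x _; rewrite /= lee_fin powRr1 ?normc_ge0// ger0_norm ?normc_ge0.
have [m1 m2] := mf.
by split; apply: (integrable_bound ni) => // x; rewrite [leRHS]ger0_norm ?normc_ge0//;
  have [] := normc_ReIm (f x).
Qed.

Lemma memLp1P f : memLp 1 f <-> cintegrable f.
Proof. by rewrite memLpP// cintegrableP. Qed.

Lemma cintegrable_lin (c : R[i]) f g : cintegrable f -> cintegrable g ->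
  cintegrable (fun x => c * f x + g x).
Proof.
case: c => a b [f1 f2] [g1 g2].
have Z r (u : Rn R n -> R) : mu.-integrable setT (EFin \o u) -> mu.-integrable setT (EFin \o (fun x => r * u x)).
  by move=> ui; have := integrableZl measurableT r ui; apply: eq_integrable => // x _; rewrite /= EFinM.
have A (u v : Rn R n -> R) : mu.-integrable setT (EFin \o u) -> mu.-integrable setT (EFin \o v) ->
    mu.-integrable setT (EFin \o (fun x => u x + v x)).
  by move=> ui vi; have := integrableD measurableT ui vi; apply: eq_integrable => // x _; rewrite /= EFinD.
split.
  have := A _ _ (A _ _ (Z a _ f1) (Z (- b) _ f2)) g1; apply: eq_integrable => // x _.
  by rewrite /= ReD ReM /= mulNr.
have := A _ _ (A _ _ (Z a _ f2) (Z b _ f1)) g2; apply: eq_integrable => // x _.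
by rewrite /= ImD ImM /=.
Qed.

Lemma cintegral_lin (c : R[i]) f g : cintegrable f -> cintegrable g ->
  cintegral (fun x => c * f x + g x) = c * cintegral f + cintegral g.
Proof.
case: c => a b [f1 f2] [g1 g2].
have Z r (u : Rn R n -> R) : mu.-integrable setT (EFin \o u) -> mu.-integrable setT (EFin \o (fun x => r * u x)).
  by move=> ui; have := integrableZl measurableT r ui; apply: eq_integrable => // x _; rewrite /= EFinM.
have A (u v : Rn R n -> R) : mu.-integrable setT (EFin \o u) -> mu.-integrable setT (EFin \o v) ->
    mu.-integrable setT (EFin \o (fun x => u x + v x)).
  by move=> ui vi; have := integrableD measurableT ui vi; apply: eq_integrable => // x _; rewrite /= EFinD.
apply/eqP; rewrite eq_complex; apply/andP; split; apply/eqP.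
  rewrite ReD ReM /=.
  transitivity (\int[mu]_x ((a * complex.Re (f x) + (- b) * complex.Im (f x)) + complex.Re (g x))).
    by apply: eq_Rintegral => x _; rewrite ReD ReM /= mulNr.
  rewrite RintegralD//; last by apply: A; apply: Z.
  by rewrite RintegralD//; [rewrite !RintegralZl// mulNr|apply: Z..].
rewrite ImD ImM /=.
transitivity (\int[mu]_x ((a * complex.Im (f x) + b * complex.Re (f x)) + complex.Im (g x))).
  by apply: eq_Rintegral => x _; rewrite ImD ImM /=.
rewrite RintegralD//; last by apply: A; apply: Z.
by rewrite RintegralD//; [rewrite !RintegralZl//|apply: Z..].
Qed.

Lemma N2_Zc (c : R[i]) f : cmeas f -> (N2 mu (fun x => (c * f x)%R) = (sqn c)%:E * N2 mu f)%E.
Proof.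
by move=> mf; rewrite -N2Zl ?sqn_ge0//; apply: eq_integral => x _; rewrite sqnM.
Qed.

Lemma L2_lin (c : R[i]) f g : L2 f -> L2 g -> L2 (fun x => c * f x + g x).
Proof.
move=> [mf f2] [mg g2]; have mcf : cmeas (fun x => c * f x) by apply: cmeasM => //; exact: cmeas_cst.
split; first exact: cmeasD.
apply: le_lt_trans (N2D _ mcf mg) _; rewrite lte_add_pinfty//.
  rewrite N2_Zc// muleA -EFinM lte_mul_pinfty// ?N2_ge0// ?lee_fin ?mulr_ge0 ?sqn_ge0//.
by rewrite lte_mul_pinfty.
Qed.

Lemma L2B f g : L2 f -> L2 g -> L2 (fun x => f x - g x).
Proof.
move=> h1 h2; have := L2_lin (-1) h2 h1.
by under eq_fun do rewrite mulN1r addrC.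
Qed.

Definition D12 f := cintegrable f /\ (N2 mu f < +oo)%E.

Lemma D12_L2 f : D12 f -> L2 f.
Proof. by move=> [/cintegrable_cmeas]. Qed.

Lemma D12P f : (memLp 1 `&` memLp 2) f <-> D12 f.
Proof.
split=> [[/memLp1P fi /memLp2P[]]|[fi f2]] //; split; first exact/memLp1P.
by apply/memLp2P; split => //; exact: cintegrable_cmeas.
Qed.

Lemma D12_lin (c : R[i]) f g : D12 f -> D12 g -> D12 (fun x => c * f x + g x).
Proof.
move=> h1 h2; split; first by apply: cintegrable_lin; [case: h1|case: h2].
by case: (L2_lin c (D12_L2 h1) (D12_L2 h2)).
Qed.

Lemma D12B f g : D12 f -> D12 g -> D12 (fun x => f x - g x).
Proof.
move=> h1 h2; have := D12_lin (-1) h2 h1.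
by under eq_fun do rewrite mulN1r addrC.
Qed.

Lemma cmeas_indic (B : set (Rn R n)) f : measurable B -> cmeas f ->
  cmeas (fun x => f x * ((\1_B x : R)%:C)%C).
Proof.
by move=> mB mf; apply: cmeasM => //; apply: cmeas_real; exact: measurable_indic.
Qed.

Lemma sqn_real (r : R) : sqn (r%:C)%C = r ^+ 2.
Proof. by rewrite /sqn/= expr0n addr0. Qed.

Lemma sqn_indic (B : set (Rn R n)) f x :
  sqn (f x * ((\1_B x : R)%:C)%C) = sqn (f x) * \1_B x.
Proof. by rewrite sqnM sqn_real indicE; case: (_ \in _); rewrite ?expr1n ?expr0n. Qed.

Lemma N2_indic_le (B : set (Rn R n)) f : measurable B -> cmeas f ->
  (N2 mu (fun x => (f x * ((\1_B x : R)%:C)%C)%R) <= N2 mu f)%E.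
Proof.
move=> mB mf; apply: N2_le => // [|x]; first exact: cmeas_indic.
by rewrite sqn_indic ler_piMr ?sqn_ge0// indicE; case: (_ \in _).
Qed.

(** On B the inequality r <= r^2 + 1 bounds the L^1 norm by the squared L^2 norm plus the measure of
    B. *)
Lemma L2_indic_D12 (B : set (Rn R n)) f : measurable B -> (mu B < +oo)%E -> L2 f ->
  D12 (fun x => f x * ((\1_B x : R)%:C)%C).
Proof.
move=> mB Boo [mf f2]; split; last exact: le_lt_trans (N2_indic_le _ _) f2.
apply/cintegrableP; split; first exact: cmeas_indic.
apply: (@le_lt_trans _ _ (N2 mu f + \int[mu]_x (\1_B x)%:E)%E); last first.
  by rewrite lte_add_pinfty// integral_indic// setIT.
rewrite -ge0_integralD//; first last.
- by apply/measurable_EFinP; exact: measurable_indic.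
- exact: emeasurable_sqn.
- by move=> x _; rewrite lee_fin sqn_ge0.
apply: ge0_le_integral => //.
- by move=> x _; rewrite lee_fin powR_ge0.
- by apply/measurable_EFinP; apply: measurable_normc_powR; exact: cmeas_indic.
- apply: emeasurable_funD; first exact: emeasurable_sqn.
  by apply/measurable_EFinP; exact: measurable_indic.
move=> x _; rewrite -EFinD lee_fin powRr1 ?normc_ge0// indicE.
case: (x \in B); last by rewrite mulr0 ComplexField.Normc.normc0 addr0 sqn_ge0.
rewrite mulr1 -sqr_normc (_ : true%:R = 1)//; have := normc_ge0 (f x).
by have := sqr_ge0 (normc (f x) - 1); nra.
Qed.

Lemma L2_trunc f (B : nat -> set (Rn R n)) : L2 f -> (forall k, measurable (B k)) ->
  (forall x, exists N, forall k, (N <= k)%N -> B k x) ->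
  tends0 (fun k => N2 mu (fun x => f x * ((\1_(B k) x : R)%:C)%C - f x)).
Proof.
move=> [mf f2] mB Bx; apply/tends0P; first by move=> k; exact: N2_ge0.
have fi : mu.-integrable [set: Rn R n] (fun x => (sqn (f x))%:E).
  apply/integrableP; split; first exact: emeasurable_sqn.
  by under eq_integral do rewrite gee0_abs ?lee_fin ?sqn_ge0//.
rewrite -[X in _ --> X](integral0 mu setT).
have [] // := @dominated_convergence _ _ R mu setT measurableT
   (fun k x => (sqn (f x * ((\1_(B k) x : R)%:C)%C - f x))%:E) (cst 0%E) (fun x => (sqn (f x))%:E).
- by move=> k; apply: emeasurable_sqn; apply: cmeasB => //; exact: cmeas_indic.
- apply: aeW => x _; apply: cvg_near_cst; have [N hN] := Bx x; exists N => // k /= /hN Bkx.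
  by rewrite indicE mem_set// mulr1 subrr sqn0.
- apply: aeW => x k _; rewrite gee0_abs ?lee_fin ?sqn_ge0// indicE.
  by case: (_ \in _); rewrite ?mulr1 ?subrr ?sqn0 ?sqn_ge0// mulr0 sub0r sqnN.
Qed.

Lemma D12_dense f : L2 f -> exists g_ : nat -> Rn R n -> R[i],
  (forall k, D12 (g_ k)) /\ tends0 (fun k => N2 mu (fun x => g_ k x - f x)).
Proof.
move=> f2; have /sigma_finiteP[B [BT ndB Boo]] := sigma_finiteT mu.
exists (fun k x => f x * ((\1_(B k) x : R)%:C)%C); split.
  by move=> k; have [? ?] := Boo k; exact: L2_indic_D12.
apply: L2_trunc => //; first by move=> k; case: (Boo k).
move=> x; have [N _ BN] : (\bigcup_k B k) x by rewrite -BT.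
by exists N => k Nk; move: BN; apply/subsetPset; exact: ndB.
Qed.

End Lp_bridge.

Section L2_extension.
Context (R : realType) (n : nat).
Local Notation mu := (lebesgue_measure_Rn R n).
Local Notation D := (@memLp R n 1 `&` @memLp R n 2).
Implicit Types (f g h : Rn R n -> R[i]).

Import HBNNSimple.

(* [integral] is defined for arbitrary functions as a supremum over simple
   functions, so it does not see null sets even without measurability. *)
Lemma ae_le_integral_nonmeas (u v : Rn R n -> \bar R) :
  (forall x, (0 <= u x)%E) -> (forall x, (0 <= v x)%E) ->
  {ae mu, forall x, u x = v x} -> (\int[mu]_x u x <= \int[mu]_x v x)%E.
Proof.
move=> u0 v0 [N [mN N0 uvN]].
rewrite ge0_integralTE// ge0_integralTE//; apply: ge_ereal_sup => _ [w /= wu <-].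
have mNC : measurable (~` N) by exact: measurableC.
pose w' : {nnsfun Rn R n >-> R} := mul_nnsfun w (indic_nnsfun R mNC).
have w'E x : w' x = w x * \1_(~` N) x by [].
have -> : sintegral mu w = sintegral mu w'.
  rewrite -!integralT_nnsfun; apply: ae_eq_integral => //.
  - by apply/measurable_EFinP.
  - by apply/measurable_EFinP.
  exists N; split => // x /= h; apply: contrapT => Nx; apply: h => _.
  by rewrite -[RHS]/((w x * \1_(~` N) x)%:E) indicE mem_set// mulr1.
apply: ereal_sup_ubound; exists w' => // x; rewrite w'E indicE.
have [xN|xN] := boolP (x \in ~` N); last by rewrite mulr0.
rewrite mulr1 (le_trans (wu x))//; rewrite inE /= in xN.
by rewrite (_ : u x = v x)//; apply: contrapT => h; apply: xN; exact: uvN.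
Qed.

Lemma ae_eq_integral_nonmeas (u v : Rn R n -> \bar R) :
  (forall x, (0 <= u x)%E) -> (forall x, (0 <= v x)%E) ->
  {ae mu, forall x, u x = v x} -> (\int[mu]_x u x = \int[mu]_x v x)%E.
Proof.
move=> u0 v0 uv; apply/eqP; rewrite eq_le !ae_le_integral_nonmeas//.
by apply: filterS uv => x ->.
Qed.

(** Arguments that agree a.e. have the same approximating sequences, so [xget] selects from the same
    set: the results are equal as functions, everywhere. No measurability is assumed, because
    members of [bessel_space] need not be Borel. *)
Lemma Lp_ext_ae p (D' : set (Rn R n -> R[i])) T0 f g : 0 < p ->
  {ae mu, forall x, f x = g x} -> Lp_ext p D' T0 f = Lp_ext p D' T0 g.
Proof.
move=> p0 fg; rewrite /Lp_ext; congr (xget _ _).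
have key (g_ : nat -> Rn R n -> R[i]) : cvgLp p g_ f <-> cvgLp p g_ g.
  apply: (iff_trans (cvgLpP g_ f p0)); apply: iff_sym; apply: (iff_trans (cvgLpP g_ g p0)).
  have E : (fun k => Np p (fun x => g_ k x - f x)) = (fun k => Np p (fun x => g_ k x - g x)); last first.
    rewrite E; exact: iff_refl.
  apply/funext => k; apply: ae_eq_integral_nonmeas => [x|x|]; rewrite ?lee_fin ?powR_ge0//.
  by apply: filterS fg => x ->.
apply/seteqP; split => h [mh [g_ [Dg cg cT]]]; split => //; exists g_; split => //; exact/key.
Qed.

Variables (T0 : (Rn R n -> R[i]) -> Rn R n -> R[i]) (C : R).
Hypothesis C0 : 0 <= C.
Hypothesis T0_lin : forall c f g, D12 f -> D12 g -> forall x,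
  T0 (fun y => c * f y + g y) x = c * T0 f x + T0 g x.
Hypothesis T0_bnd : forall f, D12 f -> cmeas (T0 f) /\ (N2 mu (T0 f) <= C%:E * N2 mu f)%E.

Let T := Lp_ext 2 D T0.

Let T0_L2 f : D12 f -> L2 (T0 f).
Proof.
move=> Df; have [mT le] := T0_bnd Df; split => //; apply: le_lt_trans le _.
by case: Df => _ f2; rewrite lte_mul_pinfty.
Qed.

Let T0B f g x : D12 f -> D12 g -> T0 (fun y => f y - g y) x = T0 f x - T0 g x.
Proof.
move=> Df Dg; rewrite -[RHS]addrC -mulN1r -T0_lin//; congr (T0 _ x).
by apply/funext => y; rewrite mulN1r addrC.
Qed.

Let N2_T0B f g : D12 f -> D12 g ->
  (N2 mu (fun x => T0 f x - T0 g x)%R <= C%:E * N2 mu (fun x => f x - g x)%R)%E.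
Proof.
move=> Df Dg; have [_] := T0_bnd (D12B Df Dg); congr (_ <= _)%E.
by apply: eq_N2 => x; rewrite T0B.
Qed.

Let N2_tri3 f g h : L2 f -> L2 g -> L2 h ->
  (N2 mu (fun x => f x - h x)%R <=
   2%:E * N2 mu (fun x => f x - g x)%R + 2%:E * N2 mu (fun x => h x - g x)%R)%E.
Proof.
move=> [mf _] [mg _] [mh _]; rewrite [X in (_ <= _ + _ * X)%E]N2BC.
exact: N2_triangle.
Qed.

Lemma tends0_lin (u v w : nat -> \bar R) (a b : R) : 0 <= a -> 0 <= b ->
  (forall k, (w k <= a%:E * u k + b%:E * v k)%E) -> tends0 u -> tends0 v -> tends0 w.
Proof.
move=> a0 b0 wuv hu hv e e0.
have e'0 : 0 < e / (a + b + 1) by rewrite divr_gt0// ltr_wpDl// addr_ge0.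
have [N1 h1] := hu _ e'0; have [N2' h2] := hv _ e'0.
exists (maxn N1 N2') => k; rewrite geq_max => /andP[k1 k2].
apply: le_trans (wuv k) _.
apply: (@le_trans _ _ ((a * (e / (a + b + 1)))%:E + (b * (e / (a + b + 1)))%:E)%E).
  by apply: leeD; rewrite EFinM lee_wpmul2l ?lee_fin//; [exact: h1|exact: h2].
rewrite -EFinD lee_fin -mulrDl mulrCA ler_piMr ?(ltW e0)//.
by rewrite ler_pdivrMr ?mul1r ?lerDl// ltr_wpDl// addr_ge0.
Qed.

(** The images of an approximating sequence are Cauchy by the bound on [T0]; their limit shows that
    the set behind [xget] is inhabited, so the dummy value 0 does not occur on L^2. *)
Lemma L2_ext_spec f : L2 f -> L2 (T f) /\ exists g_ : nat -> Rn R n -> R[i],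
  [/\ forall k, D12 (g_ k), tends0 (fun k => N2 mu (fun x => g_ k x - f x)) &
      tends0 (fun k => N2 mu (fun x => T0 (g_ k) x - T f x))].
Proof.
move=> f2; pose P h := memLp 2 h /\
    exists g_ : nat -> Rn R n -> R[i], [/\ forall k, D (g_ k),
      cvgLp 2 g_ f & cvgLp 2 (fun k => T0 (g_ k)) h].
have [g_ [Dg gf]] := D12_dense f2.
(* Any witness will do: [xget] may pick another function, but that one comes with its own
   approximating sequence. *)
suff [h Ph] : exists h, P h.
  have : P (T f) by exact: (@xgetPex _ (fun=> 0) P (ex_intro _ h Ph)).
  move=> [/memLp2P T2 [k_ [Dk kf kT]]]; split => //; exists k_; split.
  - by move=> k; apply/D12P; exact: Dk.
  - by move/(cvgLpP _ _ (ltr0Sn R 1)) : kf; under eq_fun do rewrite Np2.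
  - by move/(cvgLpP _ _ (ltr0Sn R 1)) : kT; under eq_fun do rewrite Np2.
have [||h mh hT] := @cauchy_N2_cvg _ _ R mu (fun k => T0 (g_ k)).
- by move=> k; case: (T0_L2 (Dg k)).
(* The difference of two images is at most C (2 e' + 2 e') = 4 C e', and the added 1 keeps the
   denominator positive when C = 0. *)
- move=> e e0; have e'0 : 0 < e / (4 * C + 1) by rewrite divr_gt0// ltr_wpDl// mulr_ge0.
  have [N hN] := gf _ e'0; exists N => k m Nk Nm.
  apply: le_trans (N2_T0B (Dg k) (Dg m)) _.
  apply: (@le_trans _ _ (C * (4 * (e / (4 * C + 1))))%:E); last first.
    have hX : e / (4 * C + 1) * (4 * C + 1) = e by rewrite divfK// gt_eqF// ltr_wpDl// mulr_ge0.
    rewrite lee_fin; nra.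
  rewrite EFinM lee_wpmul2l//.
  apply: le_trans (N2_tri3 (D12_L2 (Dg k)) f2 (D12_L2 (Dg m))) _.
  apply: (@le_trans _ _ ((2 * (e / (4 * C + 1)))%:E + (2 * (e / (4 * C + 1)))%:E)%E).
    by apply: leeD; rewrite EFinM lee_wpmul2l ?lee_fin// hN.
  by rewrite -EFinD lee_fin; lra.
exists h; split.
  apply/memLp2P; split => //; have [N hN] := hT _ ltr01.
  have [mT T2] := T0_L2 (Dg N).
  have -> : N2 mu h = N2 mu (fun x => T0 (g_ N) x - (T0 (g_ N) x - h x)).
    by apply: eq_N2 => x; rewrite subKr.
  apply: le_lt_trans (N2B _ mT (cmeasB mT mh)) _.
  rewrite lte_add_pinfty// lte_mul_pinfty//.
  by apply: le_lt_trans (hN N (leqnn N)) _; rewrite ltry.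
exists g_; split.
- by move=> k; apply/D12P.
- by apply/(cvgLpP _ _ (ltr0Sn R 1)); under eq_fun do rewrite Np2.
- by apply/(cvgLpP _ _ (ltr0Sn R 1)); under eq_fun do rewrite Np2.
Qed.

Lemma L2_ext_L2 f : L2 f -> L2 (T f). Proof. by move=> /L2_ext_spec[]. Qed.

(** Independence of the approximating sequence: [g_] is compared with the sequence provided by
    [L2_ext_spec], and both have the same limit f. *)
Lemma L2_ext_cvg f (g_ : nat -> Rn R n -> R[i]) : L2 f -> (forall k, D12 (g_ k)) ->
  tends0 (fun k => N2 mu (fun x => g_ k x - f x)) ->
  tends0 (fun k => N2 mu (fun x => T0 (g_ k) x - T f x)).
Proof.
move=> f2 Dg gf; have [Tf2 [k_ [Dk kf kT]]] := L2_ext_spec f2.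
have gk : tends0 (fun k => N2 mu (fun x => g_ k x - k_ k x)).
  apply: (tends0_lin (a := 2) (b := 2) _ _ _ gf kf) => // k.
  exact: N2_tri3 (D12_L2 (Dg k)) f2 (D12_L2 (Dk k)).
apply: (tends0_lin (a := 2 * C) (b := 2) _ _ _ gk kT) => //; first by rewrite mulr_ge0.
move=> k; have [m1 _] := T0_L2 (Dg k); have [m2 _] := T0_L2 (Dk k); have [m3 _] := Tf2.
apply: le_trans (N2_triangle _ m1 m2 m3) _; rewrite leeD2r//.
by rewrite EFinM -muleA lee_wpmul2l ?lee_fin// N2_T0B.
Qed.

Lemma L2_ae_uniq (u : nat -> Rn R n -> R[i]) f g : (forall k, cmeas (u k)) -> cmeas f -> cmeas g ->
  tends0 (fun k => N2 mu (fun x => u k x - f x)) ->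
  tends0 (fun k => N2 mu (fun x => u k x - g x)) ->
  {ae mu, forall x, f x = g x}.
Proof.
move=> mu_ mf mg uf ug; apply: (N2B_eq0 (mu := mu)) => // e e0.
have : tends0 (fun k : nat => N2 mu (fun x => f x - g x)).
  apply: (tends0_lin (a := 2) (b := 2) _ _ _ uf ug) => // k.
  by rewrite [X in (_ <= _ * X + _)%E]N2BC; exact: N2_triangle.
by move=> /(_ _ e0)[N /(_ N (leqnn N))].
Qed.

Lemma L2_ext_D12 f : D12 f -> {ae mu, forall x, T f x = T0 f x}.
Proof.
move=> Df; have f2 := D12_L2 Df.
have h0 h : cmeas h -> tends0 (fun k : nat => N2 mu (fun x => h x - h x)).
  move=> mh e e0; exists 0%N => k _.
  rewrite (_ : N2 _ _ = 0%E) ?lee_fin ?ltW//.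
  by rewrite -(integral0 mu setT); apply: eq_integral => x _; rewrite subrr sqn0.
have h1 := L2_ext_cvg f2 (fun=> Df) (h0 _ (proj1 f2)).
have mT0 := proj1 (T0_bnd Df).
exact: (L2_ae_uniq (fun=> mT0) (proj1 (L2_ext_L2 f2)) mT0 h1 (h0 _ mT0)).
Qed.

Lemma L2_ext_lin c f g : L2 f -> L2 g ->
  {ae mu, forall x, T (fun y => c * f y + g y) x = c * T f x + T g x}.
Proof.
move=> f2 g2; have [Tf2 [f_ [Df ff fT]]] := L2_ext_spec f2.
have [Tg2 [g_ [Dg gg gT]]] := L2_ext_spec g2.
have cL h : cmeas h -> cmeas (fun x => c * h x) by move=> mh; apply: cmeasM => //; exact: cmeas_cst.
have key (u v : nat -> Rn R n -> R[i]) a b : (forall k, L2 (u k)) -> (forall k, L2 (v k)) -> L2 a -> L2 b ->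
    tends0 (fun k => N2 mu (fun x => u k x - a x)) -> tends0 (fun k => N2 mu (fun x => v k x - b x)) ->
    tends0 (fun k => N2 mu (fun x => (c * u k x + v k x) - (c * a x + b x))).
  move=> u2 v2 a2 b2 ua vb.
  apply: (tends0_lin (a := 2 * sqn c) (b := 2) _ _ _ ua vb); rewrite ?mulr_ge0 ?sqn_ge0//.
  move=> k; have [mu_ _] := u2 k; have [mv_ _] := v2 k; have [ma _] := a2; have [mb _] := b2.
  have -> : N2 mu (fun x => (c * u k x + v k x) - (c * a x + b x)) =
      N2 mu (fun x => c * (u k x - a x) + (v k x - b x)).
    by apply: eq_N2 => x; congr sqn; ring.
  apply: le_trans (N2D _ (cL _ (cmeasB mu_ ma)) (cmeasB mv_ mb)) _.
  by rewrite N2_Zc ?muleA ?EFinM//; exact: cmeasB.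
have h1 := key _ _ _ _ (fun k => D12_L2 (Df k)) (fun k => D12_L2 (Dg k)) f2 g2 ff gg.
have h2 := L2_ext_cvg (L2_lin c f2 g2) (fun k => D12_lin c (Df k) (Dg k)) h1.
have h3 := key _ _ _ _ (fun k => T0_L2 (Df k)) (fun k => T0_L2 (Dg k)) Tf2 Tg2 fT gT.
have h3' : tends0 (fun k => N2 mu (fun x => T0 (fun y => c * f_ k y + g_ k y) x - (c * T f x + T g x))).
  move=> e e0; have [N hN] := h3 _ e0; exists N => k /hN.
  by congr (_ <= _)%E; apply: eq_N2 => x; rewrite T0_lin.
apply: (L2_ae_uniq _ _ _ h2 h3').
- by move=> k; case: (T0_L2 (D12_lin c (Df k) (Dg k))).
- by case: (L2_ext_L2 (L2_lin c f2 g2)).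
- by case: (L2_lin c Tf2 Tg2).
Qed.

Lemma L2_ext_sub f g : L2 f -> L2 g ->
  {ae mu, forall x, T (fun y => f y - g y) x = T f x - T g x}.
Proof.
move=> f2 g2; have := L2_ext_lin (-1) g2 f2; apply: filterS => x.
rewrite mulN1r addrC => <-; congr (T _ x).
by apply/funext => y; rewrite mulN1r addrC.
Qed.

(** The limit is approached through two inequalities of the form |u + v|^2 <= 2|u|^2 + 2|v|^2, one
    for the image and one for the argument; hence 4 C. The errors add up to (4 C + 2) e', which is
    e. *)
Lemma L2_ext_bnd f : L2 f -> (N2 mu (T f) <= (4 * C)%:E * N2 mu f)%E.
Proof.
move=> f2; have [Tf2 [g_ [Dg gf gT]]] := L2_ext_spec f2.
have [mf _] := f2; have [mT _] := Tf2.
apply/lee_addgt0Pr => e e0.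
have e'0 : 0 < e / (4 * C + 2) by rewrite divr_gt0// ltr_wpDl// mulr_ge0.
have [N1 h1] := gf _ e'0; have [N2' h2] := gT _ e'0.
pose k := maxn N1 N2'; have {}h1 := h1 k (leq_maxl _ _); have {}h2 := h2 k (leq_maxr _ _).
have [mT0 le0] := T0_bnd (Dg k); have mg := cintegrable_cmeas (proj1 (Dg k)).
have -> : N2 mu (T f) = N2 mu (fun x => T0 (g_ k) x - (T0 (g_ k) x - T f x)).
  by apply: eq_N2 => x; rewrite subKr.
apply: le_trans (N2B _ mT0 (cmeasB mT0 mT)) _.
have hg : (N2 mu (g_ k) <= 2%:E * (e / (4 * C + 2))%:E + 2%:E * N2 mu f)%E.
  have -> : N2 mu (g_ k) = N2 mu (fun x => (g_ k x - f x) + f x).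
    by apply: eq_N2 => x; rewrite subrK.
  apply: le_trans (N2D _ (cmeasB mg mf) mf) _.
  by rewrite leeD2r// lee_wpmul2l.
apply: (@le_trans _ _ (2%:E * (C%:E * (2%:E * (e / (4 * C + 2))%:E + 2%:E * N2 mu f)) + 2%:E * (e / (4 * C + 2))%:E)%E).
  apply: leeD; last by rewrite lee_wpmul2l.
  rewrite lee_wpmul2l//; apply: le_trans le0 _; rewrite lee_wpmul2l// lee_fin.
rewrite ge0_muleDr ?mule_ge0 ?lee_fin ?(ltW e'0)//; last exact: N2_ge0.
rewrite ge0_muleDr; last 2 first.
- by rewrite !mule_ge0// lee_fin// ltW.
- by rewrite !mule_ge0// ?lee_fin// N2_ge0.
rewrite addeC addeA [leRHS]addeC; apply: leeD.
  rewrite -!EFinM -EFinD lee_fin.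
  rewrite le_eqVlt; apply/orP; left; apply/eqP; field.
  by rewrite gt_eqF// ltr_wpDl// mulr_ge0.
by rewrite !muleA -!EFinM (_ : 2 * C * 2 = 4 * C)//; ring.
Qed.

Lemma L2_ext_continuous f (g_ : nat -> Rn R n -> R[i]) : L2 f -> (forall k, L2 (g_ k)) ->
  tends0 (fun k => N2 mu (fun x => g_ k x - f x)) ->
  tends0 (fun k => N2 mu (fun x => T (g_ k) x - T f x)).
Proof.
move=> f2 g2 gf; apply: (tends0_lin (a := 4 * C) (b := 0) _ _ _ gf gf) => //.
  by rewrite mulr_ge0.
move=> k; rewrite mul0e adde0.
rewrite -(ae_N2 (mu := mu) _ _ (L2_ext_sub (g2 k) f2)).
- by apply: L2_ext_bnd; exact: L2B.
- by case: (L2_ext_L2 (L2B (g2 k) f2)).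
- by case: (L2B (L2_ext_L2 (g2 k)) (L2_ext_L2 f2)).
Qed.

End L2_extension.

Section Fubini_swap.
Context dX dY (X : measurableType dX) (Y : measurableType dY) (R : realType).
Variables (mX : {sigma_finite_measure set X -> \bar R})
          (mY : {sigma_finite_measure set Y -> \bar R}).

Lemma Rintegral_swap (w : X -> R) (A : Y -> R) (b : X * Y -> R) :
  mX.-integrable [set: X] (EFin \o w) -> mY.-integrable [set: Y] (EFin \o A) ->
  measurable_fun [set: X * Y] b -> (forall z, `|b z| <= 1) ->
  mX.-integrable [set: X] (EFin \o (fun x => w x * \int[mY]_y (A y * b (x, y)))) /\
  \int[mX]_x (w x * \int[mY]_y (A y * b (x, y))) =
  \int[mY]_y (A y * \int[mX]_x (w x * b (x, y))).
Proof.
move=> wi Ai mb b1.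
have wAi := integrable_prodM wi Ai.
have gi := integrable_mul1 wAi mb b1.
have mb1 x : measurable_fun [set: Y] (fun y => b (x, y)) by exact: (measurableT_comp mb (measurable_pair1 x)).
have mb2 y : measurable_fun [set: X] (fun x => b (x, y)) by exact: (measurableT_comp mb (measurable_pair2 y)).
have A1 x : mY.-integrable [set: Y] (EFin \o (fun y => A y * b (x, y))) by exact: integrable_mul1.
have w1 y : mX.-integrable [set: X] (EFin \o (fun x => w x * b (x, y))) by exact: integrable_mul1.
have g1 x : mY.-integrable [set: Y] (EFin \o (fun y => w (x, y).1 * A (x, y).2 * b (x, y))).
  have := integrableZl measurableT (w x) (A1 x); apply: eq_integrable => // y _.
  by rewrite /= EFinM EFinM muleA.
have g2 y : mX.-integrable [set: X] (EFin \o (fun x => w (x, y).1 * A (x, y).2 * b (x, y))).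
  have := integrableZl measurableT (A y) (w1 y); apply: eq_integrable => // x _.
  by rewrite /= -!EFinM; congr EFin; ring.
have E1 x : \int[mY]_y (w x * A y * b (x, y)) = w x * \int[mY]_y (A y * b (x, y)).
  by rewrite -RintegralZl//; apply: eq_Rintegral => y _; rewrite mulrA.
have E2 y : \int[mX]_x (w x * A y * b (x, y)) = A y * \int[mX]_x (w x * b (x, y)).
  by rewrite -RintegralZl//; apply: eq_Rintegral => x _; ring.
split.
  have := integrable_fubini_F gi; apply: eq_integrable => // x _.
  by rewrite /= -E1 EFin_Rintegral//; exact: (g1 x).
have := Rintegral_prod2 gi g2; rewrite -(Rintegral_prod1 gi g1) => h.
transitivity (\int[mX]_x \int[mY]_y (w x * A y * b (x, y))).
  by apply: eq_Rintegral => x _; rewrite E1.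
rewrite -[LHS]h.
by apply: eq_Rintegral => y _; rewrite E2.
Qed.
End Fubini_swap.

Lemma Rintegral_comb d (T : measurableType d) (R : realType) (m : {measure set T -> \bar R})
    (u v : T -> R) (a b : R) :
  m.-integrable setT (EFin \o u) -> m.-integrable setT (EFin \o v) ->
  m.-integrable setT (EFin \o (fun x => u x * a + v x * b)) /\
  \int[m]_x (u x * a + v x * b) = (\int[m]_x u x) * a + (\int[m]_x v x) * b.
Proof.
move=> ui vi.
have ua : m.-integrable setT (EFin \o (fun x => u x * a)).
  by have := integrableZr measurableT a ui; apply: eq_integrable => // x _; rewrite /= EFinM.
have vb : m.-integrable setT (EFin \o (fun x => v x * b)).
  by have := integrableZr measurableT b vi; apply: eq_integrable => // x _; rewrite /= EFinM.
split; last by rewrite RintegralD// !RintegralZr.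
by have := integrableD measurableT ua vb; apply: eq_integrable.
Qed.

(** * The Fourier transform on L^2 and its inversion *)

Section gen_fourier.
Context (R : realType) (n : nat).
Local Notation mu := (lebesgue_measure_Rn R n).
Local Notation mu1 := (@lebesgue_measure R).
Local Notation D := (@memLp R n 1 `&` @memLp R n 2).
Local Open Scope complex_scope.
Implicit Types (f g h : Rn R n -> R[i]) (sg c : R).

(* [fourier] is the case [sg = -1, c = 1] and [inv_fourier] the case [sg = 1, c = (2 pi)^-n]. *)
Definition gft sg c f xi : R[i] :=
  c%:C * cintegral (fun x => expi (sg * dotRn xi x) * f x).

Definition gftL2 sg c := Lp_ext 2 D (gft sg c).

Lemma measurable_phase sg (xi : Rn R n) : measurable_fun [set: Rn R n] (fun x => sg * dotRn xi x).
Proof.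
apply: measurable_funM; first exact: measurable_cst.
by apply: measurable_dotRn; [exact: measurable_cst|exact: measurable_id].
Qed.

Lemma gft_lin sg c (a : R[i]) f g xi : cintegrable f -> cintegrable g ->
  gft sg c (fun y => a * f y + g y) xi = a * gft sg c f xi + gft sg c g xi.
Proof.
move=> fi gi; rewrite /gft.
have -> : cintegral (fun x => expi (sg * dotRn xi x) * (a * f x + g x)) =
    cintegral (fun x => a * (expi (sg * dotRn xi x) * f x) + expi (sg * dotRn xi x) * g x).
  by congr cintegral; apply/funext => x; ring.
rewrite cintegral_lin; first by ring.
- by apply: cintegrable_phase => //; exact: measurable_phase.
- by apply: cintegrable_phase => //; exact: measurable_phase.
Qed.

Definition gftC c : R := c ^+ 2 * (2 * (2 * pi) ^+ n).

Lemma gftC_ge0 c : 0 <= gftC c.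
Proof. by rewrite mulr_ge0 ?sqr_ge0// mulr_ge0// exprn_ge0// mulr_ge0// pi_ge0. Qed.

Lemma gft_bnd sg c f : sg ^+ 2 = 1 -> cintegrable f ->
  cmeas (gft sg c f) /\ (N2 mu (gft sg c f) <= (gftC c)%:E * N2 mu f)%E.
Proof.
move=> sg1 fi; have [mU leU] := bessel_ineq sg1 fi.
split; first by apply: cmeasM => //; exact: cmeas_cst.
rewrite /gft N2_Zc// sqn_real.
apply: (@le_trans _ _ ((c ^+ 2)%:E * ((2 * (2 * pi) ^+ n)%:E * N2 mu f))%E).
  by rewrite lee_wpmul2l// lee_fin sqr_ge0.
by rewrite muleA -EFinM.
Qed.

Section ext.
Variables (sg c : R).
Hypothesis sg1 : sg ^+ 2 = 1.

Let gl (a : R[i]) f g : D12 f -> D12 g -> forall x, gft sg c (fun y => a * f y + g y) x = a * gft sg c f x + gft sg c g x.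
Proof. by move=> [fi _] [gi _] x; exact: gft_lin. Qed.

Let gb f : D12 f -> cmeas (gft sg c f) /\ (N2 mu (gft sg c f) <= (gftC c)%:E * N2 mu f)%E.
Proof. by move=> [fi _]; exact: gft_bnd. Qed.

Lemma gftL2_L2 f : L2 f -> L2 (gftL2 sg c f).
Proof. exact: (L2_ext_L2 (gftC_ge0 c) gl gb). Qed.

Lemma gftL2_D12 f : D12 f -> {ae mu, forall x, gftL2 sg c f x = gft sg c f x}.
Proof. exact: (L2_ext_D12 (gftC_ge0 c) gl gb). Qed.

Lemma gftL2_lin (a : R[i]) f g : L2 f -> L2 g ->
  {ae mu, forall x, gftL2 sg c (fun y => a * f y + g y) x = a * gftL2 sg c f x + gftL2 sg c g x}.
Proof. exact: (L2_ext_lin (gftC_ge0 c) gl gb). Qed.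

Lemma gftL2_sub f g : L2 f -> L2 g ->
  {ae mu, forall x, gftL2 sg c (fun y => f y - g y) x = gftL2 sg c f x - gftL2 sg c g x}.
Proof. exact: (L2_ext_sub (gftC_ge0 c) gl gb). Qed.

Lemma gftL2_bnd f : L2 f -> (N2 mu (gftL2 sg c f) <= (4 * gftC c)%:E * N2 mu f)%E.
Proof. exact: (L2_ext_bnd (gftC_ge0 c) gl gb). Qed.

Lemma gftL2_continuous f (g_ : nat -> Rn R n -> R[i]) : L2 f -> (forall k, L2 (g_ k)) ->
  tends0 (fun k => N2 mu (fun x => g_ k x - f x)) ->
  tends0 (fun k => N2 mu (fun x => gftL2 sg c (g_ k) x - gftL2 sg c f x)).
Proof. exact: (L2_ext_continuous (gftC_ge0 c) gl gb). Qed.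

Lemma gft_L2 f : D12 f -> L2 (gft sg c f).
Proof.
move=> Df; have [mg le] := gb Df; split => //; apply: le_lt_trans le _.
by case: Df => _ f2; rewrite lte_mul_pinfty ?lee_fin ?gftC_ge0.
Qed.

End ext.

(** With w the weight and r = |f|, integrability follows from w r <= r^2 + w, as 0 <= w <= 1. *)
Lemma L2_expwRn_D12 (e : R) f : 0 < e -> L2 f ->
  D12 (fun x => (expwRn e x)%:C * f x).
Proof.
move=> e0 [mf f2]; have mw : cmeas (fun x : Rn R n => (expwRn e x)%:C).
  by apply: cmeas_real; exact: measurable_expwRn.
have mwf : cmeas (fun x => (expwRn e x)%:C * f x) by exact: cmeasM.
have le1 x : sqn ((expwRn e x)%:C * f x) <= sqn (f x).
  rewrite sqnM sqn_real ler_piMl ?sqn_ge0// expr_le1// ?expwRn_ge0//.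
  by rewrite expwRn_le1// ltW.
split; last by apply: le_lt_trans f2; exact: N2_le.
apply/cintegrableP; split => //.
apply: (@le_lt_trans _ _ (N2 mu f + \int[mu]_x (expwRn e x)%:E)%E); last first.
  by rewrite lte_add_pinfty// integral_expwRn// ltry.
rewrite -ge0_integralD//; first last.
- by apply/measurable_EFinP; exact: measurable_expwRn.
- by move=> x _; rewrite lee_fin expwRn_ge0.
- exact: emeasurable_sqn.
- by move=> x _; rewrite lee_fin sqn_ge0.
apply: ge0_le_integral => //.
- by move=> x _; rewrite lee_fin powR_ge0.
- by apply/measurable_EFinP; exact: measurable_normc_powR.
- apply: emeasurable_funD; first exact: emeasurable_sqn.
  by apply/measurable_EFinP; exact: measurable_expwRn.
move=> x _; rewrite -EFinD lee_fin powRr1 ?normc_ge0//.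
rewrite ComplexField.Normc.normcM (normcE (expwRn e x)%:C) sqn_real sqrtr_sqr ger0_norm ?expwRn_ge0//.
rewrite -sqr_normc; have := normc_ge0 (f x); have := expwRn_ge0 e x.
have := expwRn_le1 x (ltW e0); set w := expwRn e x; set r := ComplexField.Normc.normc _.
by move=> w1 w0 r0; have := sqr_ge0 (r - w); nra.
Qed.

Lemma cvg_expwRn (x : Rn R n) : expwRn (m.+1%:R^-1) x @[m --> \oo] --> (1 : R).
Proof.
rewrite /expwRn -[X in _ --> X](_ : \prod_(i < n) (1 : R) = _); last by rewrite prodr_const expr1n.
apply: cvg_big => [|i _]; first exact: mul_continuous.
rewrite -[X in _ --> X](@expR0 R); apply: continuous_cvg; first exact: continuous_expR.
rewrite -[X in _ --> X]oppr0; apply: cvgN.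
rewrite -[X in _ --> X](mul0r `|tnth x i|); apply: cvgM; last exact: cvg_cst.
exact: cvg_harmonic.
Qed.

Lemma expwRn_tends f : L2 f ->
  tends0 (fun m => N2 mu (fun x => (expwRn (m.+1%:R^-1) x)%:C * f x - f x)).
Proof.
move=> [mf f2]; apply/tends0P; first by move=> k; exact: N2_ge0.
have mw (e : R) : cmeas (fun x : Rn R n => (expwRn e x)%:C).
  by apply: cmeas_real; exact: measurable_expwRn.
have fi : mu.-integrable [set: Rn R n] (fun x => (sqn (f x))%:E).
  apply/integrableP; split; first exact: emeasurable_sqn.
  by under eq_integral do rewrite gee0_abs ?lee_fin ?sqn_ge0//.
rewrite -[X in _ --> X](integral0 mu setT).
have E e x : sqn ((expwRn e x)%:C * f x - f x) = (expwRn e x - 1) ^+ 2 * sqn (f x).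
  rewrite -[X in _ - X]mul1r -mulrBl sqnM; congr (_ * _).
  by rewrite -[1%R]/((1 : R)%:C) -sqn_real rmorphB.
have [] // := @dominated_convergence _ _ R mu setT measurableT
   (fun k x => (sqn ((expwRn (k.+1%:R^-1) x)%:C * f x - f x))%:E) (cst 0%E) (fun x => (sqn (f x))%:E).
- by move=> k; apply: emeasurable_sqn; apply: cmeasB => //; exact: cmeasM.
- apply: aeW => x _; apply: cvg_EFin; first exact: nearW.
  rewrite -[X in _ --> X](_ : (1 - 1) ^+ 2 * sqn (f x) = _); last by rewrite subrr expr0n mul0r.
  under eq_fun do rewrite /= E.
  apply: cvgM; last exact: cvg_cst.
  by apply: cvgM; (apply: cvgB; [exact: cvg_expwRn|exact: cvg_cst]).
- apply: aeW => x k _; rewrite gee0_abs ?lee_fin ?sqn_ge0// E ler_piMl ?sqn_ge0//.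
  have e0 : (0 : R) <= k.+1%:R^-1 by rewrite invr_ge0.
  have := expwRn_ge0 (k.+1%:R^-1) x; have := expwRn_le1 x e0; nra.
Qed.

(** With the weight inserted between the two transforms, Fubini applies; the outer integral turns
    the weight into the Poisson kernel centred at xi, and the sine part vanishes. The double
    transform is thus a Poisson convolution. *)
Lemma gft_regularized sg c c' (e : R) (A : Rn R n -> R) xi : sg ^+ 2 = 1 -> 0 < e ->
  mu.-integrable [set: Rn R n] (EFin \o A) ->
  gft (- sg) c' (fun x => (expwRn e x)%:C * gft sg c (fun y => (A y)%:C) x) xi =
  (c' * c * \int[mu]_y (A y * poissonRn e (subRn xi y)))%:C.
Proof.
move=> sg1 e0 Ai.
have wi := integrable_expwRn n e0.
have Aic : cintegrable (fun y => (A y)%:C).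
  by split => //=; apply: eq_integrable (integrable0 _ _) => //.
pose U x := \int[mu]_y (A y * cos (sg * dotRn x y)).
pose V x := \int[mu]_y (A y * sin (sg * dotRn x y)).
have gE x : gft sg c (fun y => (A y)%:C) x = (c * U x) +i* (c * V x).
  rewrite /gft cintegral_phase//; last exact: measurable_phase.
  rewrite /= (_ : \int[mu]_y (0 * _) = 0); last first.
    by under eq_Rintegral do rewrite mul0r; rewrite /Rintegral integral0.
  rewrite (_ : \int[mu]_y (0 * _) = 0); last first.
    by under eq_Rintegral do rewrite mul0r; rewrite /Rintegral integral0.
  by rewrite subr0 addr0; simpc.
have mph : measurable_fun [set: Rn R n * Rn R n] (fun z => sg * dotRn z.1 z.2).
  apply: measurable_funM; first exact: measurable_cst.
  by apply: measurable_dotRn; [exact: measurable_fst|exact: measurable_snd].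
have mph' : measurable_fun [set: Rn R n * Rn R n] (fun z => sg * dotRn z.1 z.2 - sg * dotRn z.1 xi).
  apply: measurable_funB => //; apply: measurable_funM; first exact: measurable_cst.
  by apply: measurable_dotRn; [exact: measurable_fst|exact: measurable_cst].
(* The weight supplies integrability in x and A supplies it in y; without the weight the double
   integral would not converge absolutely. *)
have [i1 E1] := @Rintegral_swap _ _ _ _ R mu mu (@expwRn R e n) A
  (fun z => cos (sg * dotRn z.1 z.2 - sg * dotRn z.1 xi)) wi Ai (measurable_cos_comp mph') (fun z => cos_abs1 _).
have [i2 E2] := @Rintegral_swap _ _ _ _ R mu mu (@expwRn R e n) A
  (fun z => sin (sg * dotRn z.1 z.2 - sg * dotRn z.1 xi)) wi Ai (measurable_sin_comp mph') (fun z => sin_abs1 _).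
rewrite /= in i1 E1 i2 E2.
have trig x : [/\ mu.-integrable setT (EFin \o (fun y => A y * cos (sg * dotRn x y))) &
    mu.-integrable setT (EFin \o (fun y => A y * sin (sg * dotRn x y)))].
  split.
    exact: (integrable_mul1 Ai (measurable_cos_comp (measurable_phase _ _)) (fun y => cos_abs1 _)).
  exact: (integrable_mul1 Ai (measurable_sin_comp (measurable_phase _ _)) (fun y => sin_abs1 _)).
have cE x : \int[mu]_y (A y * cos (sg * dotRn x y - sg * dotRn x xi)) =
    U x * cos (sg * dotRn x xi) + V x * sin (sg * dotRn x xi).
  have [t1 t2] := trig x.
  rewrite -[RHS](Rintegral_comb (cos (sg * dotRn x xi)) (sin (sg * dotRn x xi)) t1 t2).2.
  by apply: eq_Rintegral => y _; rewrite cosB mulrDr !mulrA.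
have sE x : \int[mu]_y (A y * sin (sg * dotRn x y - sg * dotRn x xi)) =
    V x * cos (sg * dotRn x xi) - U x * sin (sg * dotRn x xi).
  have [t1 t2] := trig x.
  rewrite -[RHS]/(V x * _ + - (U x * _)) -(mulrN (U x)) -[RHS](Rintegral_comb (cos (sg * dotRn x xi)) (- sin (sg * dotRn x xi)) t2 t1).2.
  by apply: eq_Rintegral => y _; rewrite sinB mulrBr mulrN !mulrA.
have kc y : \int[mu]_x (expwRn e x * cos (sg * dotRn x y - sg * dotRn x xi)) = poissonRn e (subRn xi y).
  have [h _] := Rintegral_expwRn_trig [tuple sg * (tnth (subRn y xi) i : R) | i < n] e0.
  rewrite (poissonRn_signM e (subRn y xi) sg1) poissonRn_subC in h; rewrite -[RHS]h.
  by apply: eq_Rintegral => x _; rewrite dotRn_sign dotRn_subr mulrBr.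
have ks y : \int[mu]_x (expwRn e x * sin (sg * dotRn x y - sg * dotRn x xi)) = 0.
  have [_ h] := Rintegral_expwRn_trig [tuple sg * (tnth (subRn y xi) i : R) | i < n] e0.
  rewrite -[RHS]h.
  by apply: eq_Rintegral => x _; rewrite dotRn_sign dotRn_subr mulrBr.
have EC : \int[mu]_x (expwRn e x * \int[mu]_y (A y * cos (sg * dotRn x y - sg * dotRn x xi))) =
    \int[mu]_y (A y * poissonRn e (subRn xi y)).
  by rewrite E1; apply: eq_Rintegral => y _; rewrite kc.
have ES : \int[mu]_x (expwRn e x * \int[mu]_y (A y * sin (sg * dotRn x y - sg * dotRn x xi))) = 0.
  rewrite E2; transitivity (\int[mu]_y (0 : R)); last by rewrite /Rintegral integral0.
  by apply: eq_Rintegral => y _; rewrite ks mulr0.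
rewrite {1}/gft.
have -> : cintegral (fun x => expi (- sg * dotRn xi x) * ((expwRn e x)%:C * gft sg c (fun y => (A y)%:C) x)) =
   (c * \int[mu]_x (expwRn e x * \int[mu]_y (A y * cos (sg * dotRn x y - sg * dotRn x xi)))) +i*
   (c * \int[mu]_x (expwRn e x * \int[mu]_y (A y * sin (sg * dotRn x y - sg * dotRn x xi)))).
  rewrite /cintegral -(RintegralZl c measurableT i1).
  rewrite -(RintegralZl c measurableT i2).
  congr (_ +i* _); apply: eq_Rintegral => x _.
    rewrite cE gE mulNr ReE_expiM ReM ImM /= cosN sinN (dotRnC xi x); ring.
  rewrite sE gE mulNr ImE_expiM ReM ImM /= cosN sinN (dotRnC xi x); ring.
by rewrite EC ES mulr0; simpc; rewrite mulrA.
Qed.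

End gen_fourier.

(** * Poisson regularisation of box indicators *)

Section indicator_kernel.
Context (R : realType).
Local Notation mu1 := (@lebesgue_measure R).

Definition boxRn n (a b : 'I_n -> R) : set (Rn R n) :=
  [set x | forall i, `]a i, b i]%classic (tnth x i : R)].

Lemma measurable_forall_tnth n (A : 'I_n -> set (measurableTypeR R)) :
  (forall i, measurable (A i)) -> measurable [set x : Rn R n | forall i, A i (tnth x i)].
Proof.
move=> mA; rewrite (_ : [set _ | _] = \bigcap_(i in [set: 'I_n]) ((fun x => tnth x i) @^-1` A i)).
  apply: fin_bigcap_measurable => // i _.
  by rewrite -[X in measurable X]setTI; exact: measurable_tnth.
by apply/seteqP; split => x Bx i; [move=> _; exact: Bx|exact: (Bx i I)].
Qed.

Lemma measurable_itvR (a b : R) : measurable (`]a, b]%classic : set (measurableTypeR R)).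
Proof. exact: (@measurable_itv R (Interval (BRight a) (BRight b))). Qed.

Lemma measurable_boxRn n (a b : 'I_n -> R) : measurable (boxRn a b).
Proof. by apply: (@measurable_forall_tnth n (fun i => `]a i, b i]%classic)) => i; exact: measurable_itvR. Qed.

Lemma boxRn_lty n (a b : 'I_n -> R) : (lebesgue_measure_Rn R n (boxRn a b) < +oo)%E.
Proof.
rewrite (@lebesgue_measure_Rn_box R n (fun i => `]a i, b i]%classic)); last by move=> i; exact: measurable_itvR.
suff : (\prod_(i < n) mu1 (`]a i, b i]%classic : set (measurableTypeR R)) \is a fin_num)%E by rewrite fin_numE ltey => /andP[].
apply: (big_ind (fun x => x \is a fin_num)) => // [x y|i _]; first exact: fin_numM.
rewrite (@lebesgue_measure_itv R `]a i, b i]); by case: ifP.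
Qed.

Lemma indic_boxRn n (a b : 'I_n -> R) (x : Rn R n) :
  \1_(boxRn a b) x = \prod_(i < n) (\1_(`]a i, b i]%classic : set R) (tnth x i) : R).
Proof.
rewrite indicE; have [h|h] := pselect (boxRn a b x).
  by rewrite mem_set// big1// => i _; rewrite indicE mem_set//; exact: h.
rewrite memNset//; apply/esym/eqP/prodf_eq0.
have /existsNP[i hi] := h; exists i => //.
by rewrite indicE memNset.
Qed.

(** The hyperplane is a box with one side reduced to a point, so the product formula gives measure
    0. *)
Lemma ae_tnth_neq n (i : 'I_n) (c : R) : {ae lebesgue_measure_Rn R n, forall x, tnth x i != c}.
Proof.
pose A (j : 'I_n) : set (measurableTypeR R) := if j == i then [set c] else setT.
have mA j : measurable (A j) by rewrite /A; case: eqP => // _; exact: measurable_set1.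
exists [set x | forall j, A j (tnth x j)]; split; first exact: measurable_forall_tnth.
  rewrite lebesgue_measure_Rn_box// (bigD1 i)//= {1}/A eqxx lebesgue_measure_set1 mul0e//.
move=> x /= /negP; rewrite negbK => /eqP xc j; rewrite /A; case: eqP => // ->; exact: xc.
Qed.

Lemma cvg_atan_div (c : R) : c != 0 ->
  atan (c / m.+1%:R^-1) @[m --> \oo] --> Num.sg c * (pi / 2).
Proof.
have pos (d : R) : 0 < d -> atan (d / m.+1%:R^-1) @[m --> \oo] --> pi / 2.
  move=> d0; apply: (cvg_comp _ _ _ (@cvgy_atan R)).
  apply/cvgryPge => A; near=> m; rewrite invrK -ler_pdivrMl//.
  have : (Num.truncn (`|d^-1 * A|)%R <= m)%N by near: m; exact: nbhs_infty_ge.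
  move=> h; apply: le_trans (ler_norm _) _; apply: ltW.
  by apply: lt_le_trans (truncnS_gt _) _; rewrite ler_nat.
move=> c0; case: (ltgtP c 0) c0 => // c0 _; last by rewrite gtr0_sg// mul1r; exact: pos.
rewrite ltr0_sg// mulN1r.
have -> : (fun m => atan (c / m.+1%:R^-1)) = (fun m => - atan ((- c) / m.+1%:R^-1)).
  by apply/funext => m; rewrite mulNr atanN opprK.
by apply: cvgN; apply: pos; rewrite oppr_gt0.
Unshelve. all: by end_near. Qed.

(** The convolution of [poissonRn e] with the indicator of a box, in closed form. Boxes are the
    starting point of the inversion formula because this product of arctangents makes the limit e ->
    0 explicit. *)
Definition boxker e n (a b : 'I_n -> R) (x : Rn R n) : R :=
  \prod_(i < n) (2 * (atan ((b i - tnth x i) / e) - atan ((a i - tnth x i) / e))).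

Lemma Rintegral_boxker e n (a b : 'I_n -> R) (x : Rn R n) : 0 < e -> (forall i, a i < b i) ->
  \int[lebesgue_measure_Rn R n]_y (\1_(boxRn a b) y * poissonRn e (subRn x y)) = boxker e a b x.
Proof.
move=> e0 ab; rewrite /Rintegral.
pose h (i : 'I_n) (u : R) := \1_(`]a i, b i]%classic : set R) u * poisson e (u - tnth x i).
have -> : (\int[lebesgue_measure_Rn R n]_y (\1_(boxRn a b) y * poissonRn e (subRn x y))%:E =
  \int[lebesgue_measure_Rn R n]_y (\prod_(i < n) h i (tnth y i))%:E)%E.
  apply: eq_integral => y _; congr EFin; rewrite indic_boxRn -big_split/=.
  apply: eq_bigr => i _; rewrite /h; congr (_ * _); rewrite tnth_mktuple /poisson.
  by rewrite -[X in _ / (_ + X) = _]sqrrN opprB.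
have mh i : measurable_fun [set: R] (h i).
  by apply: measurable_funM; [exact: measurable_indic|exact: measurable_poissonB].
have h0 i u : 0 <= h i u by rewrite mulr_ge0// poisson_ge0// ltW.
rewrite (@ge0_integral_prod R n h mh h0).
rewrite (_ : (\prod_(i < n) _)%E = (boxker e a b x)%:E)// /boxker -prodEFin.
apply: eq_bigr => i _.
rewrite -(integral_poisson_itv (tnth x i) e0 (ab i)) -integral_itv_obnd_cbnd; last first.
  by apply: measurable_funTS; apply/measurable_EFinP; exact: measurable_poissonB.
rewrite [RHS]integral_mkcond; apply: eq_integral => u _.
rewrite /h patchE indicE; case: (u \in _); rewrite ?mul1r//; by rewrite mul0r.
Qed.

(** Off the hyperplanes carrying the faces, each arctangent tends to pi/2 times the sign of its
    argument, so each factor tends to 2 pi inside its interval and to 0 outside. *)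
Lemma cvg_boxker n (a b : 'I_n -> R) : (forall i, a i < b i) ->
  {ae lebesgue_measure_Rn R n, forall x,
     boxker m.+1%:R^-1 a b x @[m --> \oo] --> (2 * pi) ^+ n * \1_(boxRn a b) x}.
Proof.
move=> ab.
have : {ae lebesgue_measure_Rn R n, forall x : Rn R n, forall i, tnth x i != a i /\ tnth x i != b i}.
  apply: filter_forall => i; have := ae_tnth_neq i (b i); have := ae_tnth_neq i (a i).
  by move=> h1 h2; near=> x; split; near: x.
apply: filterS => x xab; rewrite /boxker indic_boxRn.
rewrite -[X in X ^+ n * _](mulr1) -[n in _ ^+ n](card_ord n) -prodr_const -big_split/=.
apply: cvg_big => [|i _]; first exact: mul_continuous.
have [xa xb] := xab i.
have -> : 2 * pi * 1 * (\1_(`]a i, b i]%classic : set R) (tnth x i)) =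
    2 * (Num.sg (b i - tnth x i) * (pi / 2) - Num.sg (a i - tnth x i) * (pi / 2)) :> R.
  rewrite indicE; case: (ltgtP (tnth x i : R) (a i)) xa => // xa _.
    rewrite memNset; last by rewrite /= in_itv/= ltNge (ltW xa).
    rewrite !gtr0_sg ?subr_gt0//; last exact: lt_trans (ab i).
    by rewrite subrr !mulr0.
  rewrite (ltr0_sg (_ : a i - _ < 0)) ?subr_lt0//.
  case: (ltgtP (tnth x i : R) (b i)) xb => // xb _.
    rewrite mem_set; last by rewrite /= in_itv/= xa (ltW xb).
    rewrite (gtr0_sg (_ : 0 < b i - _)) ?subr_gt0// (_ : (true%:R : R) = 1)//.
    by move: (pi : R) => q; field.
  rewrite memNset; last by rewrite /= in_itv/= xa/= leNgt xb.
  by rewrite ltr0_sg ?subr_lt0// subrr !mulr0.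
apply: cvgM; first exact: cvg_cst.
by apply: cvgB; apply: cvg_atan_div; rewrite subr_eq0 eq_sym.
Unshelve. all: by end_near. Qed.

End indicator_kernel.

(** * Fourier inversion on boxes and its stability under limits *)

Section inversion.
Context (R : realType) (n : nat).
Local Notation mu := (lebesgue_measure_Rn R n).
Local Open Scope complex_scope.
Implicit Types (f g : Rn R n -> R[i]) (a b : 'I_n -> R).
Local Notation ind A := (fun x : Rn R n => (\1_A x : R)%:C).

Lemma L2_0 : L2 (fun _ : Rn R n => 0 : R[i]).
Proof.
split; first exact: cmeas_cst.
by rewrite /N2 [X in (X < _)%E](_ : _ = 0%E)//; apply: integral0_eq => x _; rewrite /sqn/= expr0n addr0.
Qed.

Lemma ind_D12 (A : set (Rn R n)) : measurable A -> (mu A < +oo)%E -> D12 (ind A).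
Proof.
move=> mA Aoo.
have iA : mu.-integrable setT (EFin \o (\1_A : Rn R n -> R)).
  apply/integrableP; split; first by apply/measurable_EFinP; exact: measurable_indic.
  under eq_integral do rewrite /= ger0_norm//.
  by rewrite integral_indic// setIT.
split.
  by split => //=; apply: eq_integrable (integrable0 _ _) => //.
rewrite /N2 (_ : \int[mu]_x _ = mu A)%E//.
under eq_integral do rewrite sqn_real indicE.
transitivity (mu (A `&` setT)); last by rewrite setIT.
rewrite -integral_indic//; apply: eq_integral => x _.
by rewrite indicE; case: (_ \in _); rewrite ?expr1n ?expr0n.
Qed.

Lemma ind_L2 (A : set (Rn R n)) : measurable A -> (mu A < +oo)%E -> L2 (ind A).
Proof. by move=> mA Aoo; apply/D12_L2/ind_D12. Qed.

Variables (sg c c' : R).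
Hypothesis sg1 : sg ^+ 2 = 1.
Hypothesis cc' : c' * c * (2 * pi) ^+ n = 1.

Let sg1' : (- sg) ^+ 2 = 1. Proof. by rewrite sqrrN. Qed.

Local Notation G f := (gftL2 (- sg) c' (gftL2 sg c f)).

(** The functions for which inversion holds. They will be shown to contain boxes, to form a vector
    space, and to be closed in L^2. *)
Definition invertible f := L2 f /\ {ae mu, forall x, G f x = f x}.

Let L2G f : L2 f -> L2 (G f).
Proof. by move=> f2; do 2! apply: gftL2_L2 => //. Qed.

Lemma gftL2_ae s k f g : {ae mu, forall x, f x = g x} -> gftL2 s k f = gftL2 s k g.
Proof. by move=> fg; apply: Lp_ext_ae. Qed.

(** Linearity of the inner transform holds only a.e., but by [gftL2_ae] the outer transform does not
    notice: its values are equal as functions. *)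
Lemma invertible_lin (k : R[i]) f g : invertible f -> invertible g -> invertible (fun x => k * f x + g x).
Proof.
move=> [f2 Gf] [g2 Gg]; split; first exact: L2_lin.
rewrite (gftL2_ae (- sg) c' (gftL2_lin c sg1 k f2 g2)).
have := gftL2_lin c' sg1' k (gftL2_L2 c sg1 f2) (gftL2_L2 c sg1 g2).
by apply: filterS3 Gf Gg => x -> -> ->.
Qed.

(** The double transform is continuous on L^2, so [f_ k] tends both to f and to the double transform
    of f. *)
Lemma invertible_cvg (f_ : nat -> Rn R n -> R[i]) f : (forall k, invertible (f_ k)) -> L2 f ->
  tends0 (fun k => N2 mu (fun x => f_ k x - f x)) -> invertible f.
Proof.
move=> If f2 ff; split => //.
have I2 k : L2 (f_ k) by case: (If k).
have h := gftL2_continuous c' sg1' (gftL2_L2 c sg1 f2) (fun k => gftL2_L2 c sg1 (I2 k))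
  (gftL2_continuous c sg1 f2 I2 ff).
apply: (@L2_ae_uniq _ _ (fun k => G (f_ k))) => //.
- by move=> k; case: (L2G (I2 k)).
- by case: (L2G f2).
- by case: f2.
- move=> e /ff[N hN]; exists N => k /hN; apply: le_trans.
  have [mfk _] := I2 k; have [mGk _] := L2G (I2 k); have [mf _] := f2.
  rewrite (@ae_N2 _ _ _ mu _ (fun x => f_ k x - f x))//; [exact: cmeasB|exact: cmeasB|].
  by have [_] := If k; apply: filterS => x ->.
Qed.

Lemma invertible0 : invertible (fun=> 0).
Proof.
have z : N2 mu (fun=> 0) = 0%E by apply: integral0_eq => x _; rewrite /sqn/= expr0n addr0.
split; first exact: L2_0.
apply: N2_eq0; first by case: (L2G L2_0).
apply/eqP; rewrite eq_le N2_ge0 andbT; apply: le_trans (gftL2_bnd c' sg1' (gftL2_L2 c sg1 L2_0)) _.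
rewrite (_ : N2 mu (gftL2 sg c (fun=> 0)) = 0%E) ?mule0//.
apply/eqP; rewrite eq_le N2_ge0 andbT; apply: le_trans (gftL2_bnd c sg1 L2_0) _.
by rewrite z mule0.
Qed.

(** The weighted transform of the box converges to the transform in L^2, so its inverse transforms
    converge in L^2 to the double transform; by [gft_regularized] they are also multiples of
    [boxker], which converge a.e. to the indicator. Fatou's lemma identifies the two limits. A box
    with some b i <= a i is empty. *)
Lemma invertible_box a b : invertible (ind (boxRn a b)).
Proof.
have [ab|/existsNP[i /negP]] := pselect (forall i, a i < b i); last first.
  rewrite -leNgt => ba; rewrite (_ : boxRn a b = set0).
    rewrite (_ : ind set0 = fun=> 0); first exact: invertible0.
    by apply/funext => x; rewrite indicE in_set0.
  rewrite -subset0 => x /(_ i) /=; rewrite in_itv/= => /andP[h1 h2].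
  by have := lt_le_trans (lt_le_trans h1 h2) ba; rewrite ltxx.
have mB := @measurable_boxRn R n a b; have Boo := boxRn_lty a b.
have D := ind_D12 mB Boo; have f2 := D12_L2 D; split => //.
have Ai : mu.-integrable setT (EFin \o (\1_(boxRn a b) : Rn R n -> R)) by case: D => -[].
pose F := gft sg c (ind (boxRn a b)).
have F2 : L2 F by exact: gft_L2.
have GF : G (ind (boxRn a b)) = gftL2 (- sg) c' F.
  by apply: gftL2_ae; exact: gftL2_D12.
have e0 m : 0 < m.+1%:R^-1 :> R by rewrite invr_gt0.
pose W m x := (expwRn (m.+1%:R^-1) x)%:C * F x.
have WD m : D12 (W m) by exact: L2_expwRn_D12.
have lim := gftL2_continuous c' sg1' F2 (fun m => D12_L2 (WD m)) (expwRn_tends F2).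
pose u m (x : Rn R n) : R[i] := (c' * c * boxker m.+1%:R^-1 a b x)%:C.
have uE m : {ae mu, forall x, gftL2 (- sg) c' (W m) x = u m x}.
  apply: filterS (gftL2_D12 c' sg1' (WD m)) => x ->.
  by rewrite /W /F gft_regularized// Rintegral_boxker.
have mG : cmeas (gftL2 (- sg) c' F) by case: (gftL2_L2 c' sg1' F2).
have mW m : cmeas (gftL2 (- sg) c' (W m)) by case: (gftL2_L2 c' sg1' (D12_L2 (WD m))).
rewrite GF; have [mf _] := f2.
apply: (N2B_eq0 (mu := mu)) => // e ee; rewrite N2BC.
apply: (@N2_fatou _ _ _ mu (fun m x => gftL2 (- sg) c' (W m) x - gftL2 (- sg) c' F x)).
- by move=> k; exact: cmeasB.
- exact: cmeasB.
- have : {ae mu, forall x, forall m, gftL2 (- sg) c' (W m) x = u m x} by exact: ae_foralln.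
  apply: filterS2 (cvg_boxker ab) => x kx ux.
  have cu : c' * c * boxker m.+1%:R^-1 a b x @[m --> \oo] --> (\1_(boxRn a b) x : R).
    rewrite -[X in _ --> X](_ : c' * c * ((2 * pi) ^+ n * \1_(boxRn a b) x) = _); last by rewrite mulrA cc' mul1r.
    by apply: cvgM; [exact: cvg_cst|exact: kx].
  split.
    rewrite ReD ReN; under eq_fun do rewrite ReD ReN ux /=.
    by apply: cvgB => //; exact: cvg_cst.
  rewrite ImD ImN; under eq_fun do rewrite ImD ImN ux /=.
  by apply: cvgB => //; exact: cvg_cst.
- by have [N hN] := lim e ee; exists N => // k /= /hN.
Qed.

End inversion.

(** * Half-open rectangles generate the Borel sets *)

Section boxes_generate.
Context (R : realType) (n : nat).

Definition ocrect : set (set (Rn R n)) :=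
  [set A | exists B : 'I_n -> set R, (forall i, ocitv (B i)) /\ A = [set x | forall i, B i (tnth x i)]].

Lemma measurable_ocitv (B : set R) : ocitv B -> measurable (B : set (measurableTypeR R)).
Proof. by move=> [[a b] _ <-] /=; exact: measurable_itvR. Qed.

(** The sigma-algebra on tuples is generated by cylinders over one coordinate, and the base of a
    cylinder may be taken half-open by minimality of the Borel sigma-algebra. *)
Lemma measurable_ocrectE : @measurable _ (Rn R n) = <<s ocrect >>.
Proof.
apply/seteqP; split; last first.
  apply: smallest_sub; first exact: sigma_algebra_measurable.
  by move=> _ [B [oB ->]]; apply: (@measurable_forall_tnth R n B) => i; exact: measurable_ocitv.
apply: smallest_sub; first exact: smallest_sigma_algebra.
have S := smallest_sigma_algebra [set: Rn R n] ocrect.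
suff gen i (B : set R) : measurable (B : set (measurableTypeR R)) -> <<s ocrect >> ((fun x : Rn R n => tnth x i) @^-1` B).
  apply: (big_ind (fun X => X `<=` <<s ocrect >>)) => [//|X Y hX hY|i _ _ [B mB <-]].
    by rewrite subUset.
  by rewrite setTI; exact: gen.
move: B; apply: smallest_sub.
  split; first by rewrite preimage_set0; case: S.
  - by move=> B hB; rewrite setTD -preimage_setC; case: S => _ /(_ _ hB); rewrite setTD.
  - by move=> F hF; rewrite preimage_bigcup; case: S => _ _; apply.
move=> B oB.
(* A cylinder is the union of the rectangles whose other sides are ]-k, k]. *)
rewrite [X in <<s _ >> X](_ : _ = \bigcup_k [set x : Rn R n | forall j, (if j == i then B else `]- k%:R, k%:R]%classic) (tnth x j)]).
  case: S => _ _; apply => k; apply: sub_gen_smallest.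
  exists (fun j => if j == i then B else `]- k%:R, k%:R]%classic); split => // j.
  by case: eqP => // _; exact: is_ocitv.
apply/seteqP; split => x /=; last by move=> [k _ /(_ i)]; rewrite eqxx.
move=> Bx; pose M := \sum_(j < n) `|tnth x j : R|.
exists (Num.truncn M).+1 => // j; case: eqP => [->//|_] /=.
have xM : `|tnth x j : R| < (Num.truncn M).+1%:R.
  apply: le_lt_trans (truncnS_gt _); rewrite /M (bigD1 j)//= lerDl sumr_ge0//.
by move: xM; rewrite ltr_norml in_itv/= => /andP[-> /ltW].
Qed.

Lemma ocrectI : setI_closed ocrect.
Proof.
move=> _ _ [A [oA ->]] [B [oB ->]]; exists (fun i => A i `&` B i); split.
  by move=> i; exact: ocitvI.
apply/seteqP; split => x /=; first by move=> [h1 h2] i; split.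
by move=> h; split => i; have [] := h i.
Qed.

Lemma ocrect_box (A : set (Rn R n)) (a b : 'I_n -> R) : ocrect A ->
  exists a' b', A `&` boxRn a b = boxRn a' b'.
Proof.
move=> [B [oB ->]].
have h i : exists x : R * R, B i `&` `]a i, b i]%classic = `]x.1, x.2]%classic.
  have /(_ _ _ (oB i) (is_ocitv (a i) (b i))) [x _ <-] := @ocitvI R.
  by exists x.
have [x hx] := choice h; exists (fst \o x), (snd \o x).
apply/seteqP; split => y /=.
  by move=> [h1 h2] i; have := hx i => /seteqP[/(_ (tnth y i)) + _]; apply; split.
by move=> hy; split => i; have /seteqP[_ /(_ (tnth y i) (hy i))[]] := hx i.
Qed.

End boxes_generate.

Section L2_inversion.
Context (R : realType) (n : nat).
Local Notation mu := (lebesgue_measure_Rn R n).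
Local Open Scope complex_scope.
Implicit Types (f g : Rn R n -> R[i]) (a b : 'I_n -> R).

Lemma L2_dominated f (f_ : nat -> Rn R n -> R[i]) : L2 f -> (forall k, cmeas (f_ k)) ->
  (forall k x, sqn (f_ k x - f x) <= sqn (f x)) ->
  (forall x, sqn (f_ k x - f x) @[k --> \oo] --> 0) ->
  tends0 (fun k => N2 mu (fun x => f_ k x - f x)).
Proof.
move=> [mf f2] mf_ le lim; apply/tends0P; first by move=> k; exact: N2_ge0.
have fi : mu.-integrable [set: Rn R n] (fun x => (sqn (f x))%:E).
  apply/integrableP; split; first exact: emeasurable_sqn.
  by under eq_integral do rewrite gee0_abs ?lee_fin ?sqn_ge0//.
rewrite -[X in _ --> X](integral0 mu setT).
have [] // := @dominated_convergence _ _ R mu setT measurableT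
   (fun k x => (sqn (f_ k x - f x))%:E) (cst 0%E) (fun x => (sqn (f x))%:E).
- by move=> k; apply: emeasurable_sqn; exact: cmeasB.
- by apply: aeW => x _; apply: cvg_EFin; [exact: nearW|exact: lim].
- by apply: aeW => x k _; rewrite gee0_abs ?lee_fin ?sqn_ge0//.
Qed.

Definition cubeRn (k : nat) : set (Rn R n) := boxRn (fun=> - k%:R) (fun=> k%:R).

Lemma cubeRn_in (x : Rn R n) : exists N, forall k, (N <= k)%N -> cubeRn k x.
Proof.
pose M := \sum_(j < n) `|tnth x j : R|.
exists (Num.truncn M).+1 => k Mk i /=.
have xM : `|tnth x i : R| < k%:R.
  apply: (@lt_le_trans _ _ (Num.truncn M).+1%:R); last by rewrite ler_nat.
  by apply: le_lt_trans (truncnS_gt _); rewrite /M (bigD1 i)//= lerDl sumr_ge0.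
by move: xM; rewrite ltr_norml in_itv/= => /andP[-> /ltW].
Qed.

Variables (sg c c' : R).
Hypothesis sg1 : sg ^+ 2 = 1.
Hypothesis cc' : c' * c * (2 * pi) ^+ n = 1.
Local Notation inv := (invertible sg c c').
Local Notation ind A := (fun x : Rn R n => (\1_A x : R)%:C).

Lemma invertible_eq f g : f =1 g -> inv f -> inv g.
Proof. by move=> /funext ->. Qed.

Lemma invertible_indU (A B : set (Rn R n)) : A `&` B = set0 -> inv (ind A) -> inv (ind B) -> inv (ind (A `|` B)).
Proof.
move=> AB hA hB; apply: invertible_eq (invertible_lin sg1 1 hA hB) => x /=.
have dis : ~~ ((x \in A) && (x \in B)) by rewrite -in_setI AB in_set0.
rewrite mul1r !indicE in_setU -rmorphD; congr (_%:C).
by case: (x \in A) dis; case: (x \in B) => //= _; rewrite ?addr0 ?add0r.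
Qed.

(** Dynkin's theorem on the rectangles. The intersection with a box keeps every indicator in L^2,
    and turns the complement into a difference from an invertible box; countable disjoint unions are
    L^2 limits. *)
Lemma invertible_indic (A : set (Rn R n)) : measurable A ->
  forall a b, inv (ind (A `&` boxRn a b)).
Proof.
rewrite measurable_ocrectE.
apply: (@dynkin_induction _ (Rn R n) (@ocrect R n) (fun A => forall a b, inv (ind (A `&` boxRn a b)))
  (@measurable_ocrectE R n) (@ocrectI R n)).
- by move=> a b; rewrite setTI; exact: invertible_box.
- move=> B oB a b; have [a' [b' ->]] := ocrect_box a b oB; exact: invertible_box.
- move=> S mS hS a b.
  apply: invertible_eq (invertible_lin sg1 (-1) (hS a b) (invertible_box sg1 cc' a b)) => x /=.
  rewrite !indicE !in_setI in_setC; case: (x \in S); case: (x \in boxRn a b) => /=; by ring.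
move=> F mF tF hF a b.
have fin m : inv (ind (\big[setU/set0]_(k < m) F k `&` boxRn a b)).
  elim: m => [|m IH].
    rewrite big_ord0 set0I; apply: invertible_eq (@invertible0 R n sg c c' sg1) => x.
    by rewrite indicE in_set0.
  rewrite big_ord_recr/= setIUl; apply: invertible_indU => //.
  rewrite setIACA (@trivIset_bigsetUI _ xpredT)//; first by rewrite set0I.
  by rewrite [X in trivIset X F](_ : _ = [set: nat])//; exact/seteqP.
have mU : measurable (\bigcup_k F k) by exact: bigcupT_measurable.
have mUb : measurable (\bigcup_k F k `&` boxRn a b) by apply: measurableI => //; exact: measurable_boxRn.
have f2 : L2 (ind (\bigcup_k F k `&` boxRn a b)).
  apply: ind_L2 => //; apply: le_lt_trans (boxRn_lty a b).
  by apply: le_measure; rewrite ?inE//; exact: measurable_boxRn.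
apply: (@invertible_cvg _ _ _ _ _ sg1 _ _ fin f2).
(* Adding the complement of the whole union makes these sets exhaust the space, as [L2_trunc] wants,
   while truncation by them still gives the finite unions. *)
have mV k : measurable (\big[setU/set0]_(j < k) F j `|` ~` (\bigcup_j F j)).
  by apply: measurableU; [exact: bigsetU_measurable|exact: measurableC].
have := L2_trunc f2 mV _.
have H x : exists N : nat, forall k, (N <= k)%N -> (\big[setU/set0]_(j < k) F j `|` ~` (\bigcup_j F j)) x.
  have [[j _ Fjx]|xF] := pselect ((\bigcup_j F j) x); last by exists 0%N => k _; right.
  exists j.+1 => k jk; left; rewrite -bigcup_mkord; by exists j.
move=> /(_ H); congr tends0; apply/funext => k; apply: eq_N2 => x; congr sqn; congr (_ - _).
rewrite -rmorphM/= !indicE !in_setI in_setU in_setC; congr (_%:C).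
have [xk|xk] := boolP (x \in \big[setU/set0]_(j < k) F j).
  rewrite mulr1 (_ : x \in \bigcup_j F j)//.
  by move: xk; rewrite !inE -bigcup_mkord => -[j _ Fj]; exists j.
by rewrite andFb/=; case: (_ \in \bigcup_j F j); rewrite /= ?mulr0 ?mul0r.
Qed.

Import HBNNSimple.

(** Simple functions increase to h, and domination by h turns pointwise into L^2 convergence. The
    bounded support makes the level sets of nonzero values bounded. *)
Lemma invertible_nneg (h : Rn R n -> R) (N : nat) : measurable_fun setT h -> (forall x, 0 <= h x) ->
  (forall x, ~ cubeRn N x -> h x = 0) -> L2 (fun x => (h x)%:C) -> inv (fun x => (h x)%:C).
Proof.
move=> mh h0 hN h2.
have mh' : measurable_fun setT (EFin \o h) by exact/measurable_EFinP.
have hh0 x : [set: Rn R n] x -> (0 <= (EFin \o h) x)%E by move=> _; rewrite lee_fin.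
have [g [ndg cg]] := approximation measurableT mh' hh0.
have cg' x : g k x @[k --> \oo] --> h x by case/fine_cvgP: (cg x I).
have gh k x : g k x <= h x.
  rewrite -(cvg_lim (@Rhausdorff R) (cg' x)).
  apply: nondecreasing_cvgn_le; last by apply/cvg_ex; exists (h x); exact: cg'.
  by move=> i j ij; have /lefP := ndg _ _ ij; apply.
have mgk k : measurable_fun setT (g k) by [].
have ig k : inv (fun x => (g k x)%:C).
  (* The finite list of values of the simple function; the sum over its level sets is built up one
     value at a time. *)
  pose s := finmap.enum_fset (fset_set (range (g k))).
  have hsum (m : nat) : inv (fun x : Rn R n => (\sum_(i < m) (s`_i * \1_(g k @^-1` [set s`_i]) x))%:C).
    elim: m => [|m IH].
      by apply: invertible_eq (@invertible0 R n sg c c' sg1) => x; rewrite big_ord0.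
    have term : inv (fun x : Rn R n => (s`_m * \1_(g k @^-1` [set s`_m]) x)%:C).
      have [s0|s0] := eqVneq (s`_m) 0.
        by apply: invertible_eq (@invertible0 R n sg c c' sg1) => x; rewrite s0 mul0r.
      have mS : measurable (g k @^-1` [set s`_m]).
        by rewrite -[X in measurable X]setTI; apply: mgk => //; exact: measurable_set1.
      (* Intersecting with the cube changes nothing: outside it h = 0, hence [g k] = 0, while the
         value here is not 0. *)
      have := invertible_lin sg1 (s`_m)%:C (invertible_indic mS (fun=> - N%:R) (fun=> N%:R)) (@invertible0 R n sg c c' sg1).
      apply: invertible_eq => x /=; rewrite addr0 rmorphM; congr (_ * _%:C).
      rewrite !indicE in_setI; have [xS|//] := boolP (x \in _).
      have [xC|xC] := boolP (x \in _) => //=; exfalso; move/negP: s0; apply.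
      move: xS; rewrite inE /= => <-; rewrite eq_le fun_ge0 andbT.
      rewrite (le_trans (gh k x))// hN// => /mem_set; exact/negP.
    apply: invertible_eq (invertible_lin sg1 1 IH term) => x.
    by rewrite big_ord_recr/= mul1r rmorphD.
  by apply: invertible_eq (hsum (size s)) => x; rewrite (fimfunEord (g k) x).
apply: (@invertible_cvg _ _ _ _ _ sg1 _ _ ig h2).
apply: L2_dominated => //.
- move=> k x; rewrite -rmorphB !sqn_real.
  have := gh k x; have : 0 <= g k x by exact: fun_ge0.
  have := h0 x; nra.
- move=> x; have H : (g k x - h x) ^+ 2 @[k --> \oo] --> (h x - h x) ^+ 2.
    by apply: cvgM; (apply: cvgB; [exact: cg'|exact: cvg_cst]).
  rewrite subrr expr0n in H; apply: cvg_trans H; apply: near_eq_cvg.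
  by apply: nearW => k; rewrite -rmorphB sqn_real.
Qed.

(** Truncation to cubes, then real and imaginary parts, then positive and negative parts reduce to
    [invertible_nneg]. *)
Theorem L2_invertible f : L2 f -> inv f.
Proof.
move=> f2; have mC k : measurable (cubeRn k) by exact: measurable_boxRn.
pose fk k x := f x * (\1_(cubeRn k) x : R)%:C.
suff ik k : inv (fk k) by apply: (@invertible_cvg _ _ _ _ _ sg1 _ _ ik f2); exact: L2_trunc f2 mC cubeRn_in.
have [mk k2] : L2 (fk k) by have := L2_indic_D12 (mC k) (boxRn_lty _ _) f2 => /D12_L2.
have [m1 m2] := mk.
have pos (u : Rn R n -> R) : measurable_fun setT u -> (forall x, u x ^+ 2 <= sqn (fk k x)) ->
    inv (fun x => (u x)%:C).
  move=> mu_ ule.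
  have part (v : Rn R n -> R) : measurable_fun setT v -> (forall x, 0 <= v x) ->
      (forall x, v x ^+ 2 <= u x ^+ 2) -> inv (fun x => (v x)%:C).
    move=> mv v0 vu; apply: (@invertible_nneg v k) => //.
      move=> x xk; have := le_trans (vu x) (ule x).
      rewrite /fk indicE memNset// mulr0 sqn0 => v2.
      by apply/eqP; rewrite -sqrf_eq0 eq_le v2 sqr_ge0.
    split; first exact: cmeas_real.
    apply: le_lt_trans k2; apply: N2_le => // x.
    by rewrite sqn_real (le_trans (vu x)).
  have h1 : measurable_fun setT (fun x => Num.max (- u x) 0).
    by apply: measurable_maxr => //; exact: measurable_funN.
  have h2 : measurable_fun setT (fun x => Num.max (u x) 0) by exact: measurable_maxr.
  have i1 : inv (fun x => (Num.max (- u x) 0)%:C).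
    apply: part => // x; first by rewrite le_max lexx orbT.
    by case: (leP 0 (- u x)) => _; rewrite ?sqrrN// expr0n sqr_ge0.
  have i2 : inv (fun x => (Num.max (u x) 0)%:C).
    apply: part => // x; first by rewrite le_max lexx orbT.
    by case: (leP 0 (u x)) => _; rewrite ?expr0n ?sqr_ge0.
  apply: invertible_eq (invertible_lin sg1 (-1) i1 i2) => x.
  rewrite mulN1r addrC -rmorphB; congr (_%:C).
  by case: (leP 0 (u x)) => u0; case: (leP 0 (- u x)); lra.
have i1 := pos _ m1 (fun x => ler_wpDr (sqr_ge0 _) (lexx _)).
have i2 := pos _ m2 (fun x => ler_wpDl (sqr_ge0 _) (lexx _)).
apply: invertible_eq (invertible_lin sg1 'i i2 i1) => x.
by case: (fk k x) => r s; simpc.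
Qed.

End L2_inversion.

Section plancherel.
Context (R : realType) (n : nat).
Local Notation mu := (lebesgue_measure_Rn R n).
Local Open Scope complex_scope.
Implicit Types (f g : Rn R n -> R[i]).

Lemma fourierL2E : @fourierL2 R n = gftL2 (-1) 1.
Proof.
rewrite /fourierL2 /gftL2; congr (Lp_ext _ _ _).
apply/funext => f; apply/funext => xi; rewrite /fourier /gft mul1r.
by congr cintegral; apply/funext => x; rewrite mulN1r.
Qed.

Lemma inv_fourierL2E : @inv_fourierL2 R n = gftL2 1 ((2 * pi) ^- n).
Proof.
rewrite /inv_fourierL2 /gftL2; congr (Lp_ext _ _ _).
apply/funext => f; apply/funext => xi; rewrite /inv_fourier /gft; congr (_ * _).
by congr cintegral; apply/funext => x; rewrite mul1r dotRnC.
Qed.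

Let pi2n : (2 * pi) ^+ n != 0 :> R.
Proof. by rewrite expf_neq0// mulf_neq0 ?pnatr_eq0// gt_eqF// pi_gt0. Qed.

(** Inversion with [sg] = 1, c = (2 pi)^-n and c' = 1. This order of the two transforms recovers the
    spectrum F from f. *)
Lemma inv_fourierL2K f : L2 f -> {ae mu, forall x, fourierL2 (inv_fourierL2 f) x = f x}.
Proof.
move=> f2; rewrite fourierL2E inv_fourierL2E.
have s1 : 1 ^+ 2 = 1 :> R by rewrite expr1n.
have cc : 1 * (2 * pi) ^- n * (2 * pi) ^+ n = 1 :> R by rewrite mul1r mulVf.
by have [_] := L2_invertible s1 cc f2.
Qed.

End plancherel.

(** * Dyadic decay of the spectrum of a Bessel potential *)

Section balls.
Context (R : realType) (n : nat).
Local Notation mu := (lebesgue_measure_Rn R n).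

Lemma dotRn_ge0 (x : Rn R n) : 0 <= dotRn x x.
Proof. by rewrite /dotRn sumr_ge0// => i _; rewrite -expr2 sqr_ge0. Qed.

Lemma normRn_ge0 (x : Rn R n) : 0 <= normRn x.
Proof. exact: sqrtr_ge0. Qed.

Lemma sqr_normRn (x : Rn R n) : normRn x ^+ 2 = dotRn x x.
Proof. by rewrite sqr_sqrtr// dotRn_ge0. Qed.

Lemma measurable_normRn : measurable_fun [set: Rn R n] (@normRn R n).
Proof.
apply: (measurableT_comp (f := @Num.sqrt R)).
  by apply: continuous_measurable_fun; exact: sqrt_continuous.
by apply: measurable_dotRn; exact: measurable_id.
Qed.

Lemma coord_le_normRn (x : Rn R n) i : `|tnth x i : R| <= normRn x.
Proof.
rewrite -sqrtr_sqr ler_wsqrtr// /dotRn (bigD1 i)//= -expr2 lerDl sumr_ge0// => j _.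
by rewrite -expr2 sqr_ge0.
Qed.

Definition ballRn (rho : R) : set (Rn R n) := [set x | normRn x < rho].

Lemma measurable_ballRn rho : measurable (ballRn rho).
Proof.
rewrite (_ : ballRn rho = @normRn R n @^-1` `]-oo, rho[%classic); last first.
  by apply/seteqP; split => x /=; rewrite in_itv.
by rewrite -[X in measurable X]setTI; exact: measurable_normRn.
Qed.

Lemma lebesgue_measure_boxRn (a b : 'I_n -> R) : (forall i, a i <= b i) ->
  mu (boxRn a b) = (\prod_(i < n) (b i - a i))%:E.
Proof.
move=> ab; rewrite (@lebesgue_measure_Rn_box R n (fun i => `]a i, b i]%classic)); last by move=> i; exact: measurable_itvR.
rewrite -prodEFin; apply: eq_bigr => i _.
rewrite (@lebesgue_measure_itv R `]a i, b i])/= lte_fin -EFinB.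
by case: (ltgtP (a i) (b i)) (ab i) => // ->; rewrite subrr.
Qed.

(** Comparison with the circumscribed cube; only the power of [rho] matters. *)
Lemma ballRn_measure rho : 0 < rho -> (mu (ballRn rho) <= ((2 * rho) ^+ n)%:E)%E.
Proof.
move=> r0; have h : - rho <= rho by rewrite ge0_cp// ltW.
apply: (@le_trans _ _ (mu (boxRn (fun _ : 'I_n => - rho) (fun=> rho)))).
  apply: le_measure; rewrite ?inE; [exact: measurable_ballRn|exact: measurable_boxRn|].
  move=> x xr i /=; have := le_lt_trans (coord_le_normRn x i) xr.
  by rewrite ltr_norml in_itv/= => /andP[-> /ltW].
by rewrite lebesgue_measure_boxRn// prodr_const card_ord opprK -mulr2n mulr_natl.
Qed.

End balls.

Section Np_theory.
Context (R : realType) (n : nat).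
Local Notation mu := (lebesgue_measure_Rn R n).
Local Notation normc := (@ComplexField.Normc.normc _).
Local Open Scope complex_scope.
Implicit Types (f g h : Rn R n -> R[i]) (p : R).

Lemma normcD (z w : R[i]) : normc (z + w) <= normc z + normc w.
Proof. exact: (@le_normcD R). Qed.

Lemma powRD_le p (x y : R) : 0 < p -> 0 <= x -> 0 <= y ->
  (x + y) `^ p <= 2 `^ p * (x `^ p + y `^ p).
Proof.
move=> p0 x0 y0.
wlog xy : x y x0 y0 / x <= y.
  move=> h; case: (leP x y) => [xy|/ltW yx]; first exact: h.
  by rewrite addrC (addrC (x `^ p)); exact: h.
apply: (@le_trans _ _ ((2 * y) `^ p)).
  rewrite ge0_ler_powR ?nnegrE ?addr_ge0 ?mulr_ge0 ?(ltW p0)//.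
  by rewrite mulrDl mul1r lerD2r.
by rewrite powRM// ler_wpM2l ?powR_ge0// lerDr powR_ge0.
Qed.

Lemma NpD p f g : 0 < p -> cmeas f -> cmeas g ->
  (Np p (fun x => (f x + g x)%R) <= (2 `^ p)%:E * (Np p f + Np p g))%E.
Proof.
move=> p0 mf mg; rewrite /Np -ge0_integralD//; first last.
- by apply/measurable_EFinP; exact: measurable_normc_powR.
- by move=> x _; rewrite lee_fin powR_ge0.
- by apply/measurable_EFinP; exact: measurable_normc_powR.
- by move=> x _; rewrite lee_fin powR_ge0.
rewrite -ge0_integralZl//; first last.
- by move=> x _; rewrite -EFinD lee_fin addr_ge0 ?powR_ge0.
- by apply: emeasurable_funD; apply/measurable_EFinP; exact: measurable_normc_powR.
apply: ge0_le_integral => //.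
- by move=> x _; rewrite lee_fin powR_ge0.
- by apply/measurable_EFinP; apply: measurable_normc_powR; exact: (cmeasD mf mg).
- apply/measurable_EFinP; apply: measurable_funM; first exact: measurable_cst.
  by apply: measurable_funD; exact: measurable_normc_powR.
- move=> x _; rewrite -EFinD -EFinM lee_fin.
  apply: le_trans (powRD_le p0 (normc_ge0 _) (normc_ge0 _)).
  by rewrite ge0_ler_powR ?nnegrE ?addr_ge0 ?normc_ge0 ?(ltW p0)// normcD.
Qed.

Lemma normcN (z : R[i]) : normc (- z) = normc z.
Proof. by rewrite !normcE sqnN. Qed.

Lemma NpN p f : Np p (fun x => - f x) = Np p f.
Proof. by apply: eq_integral => x _; rewrite normcN. Qed.

Lemma NpB p f g : 0 < p -> cmeas f -> cmeas g ->
  (Np p (fun x => (f x - g x)%R) <= (2 `^ p)%:E * (Np p f + Np p g))%E.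
Proof. by move=> p0 mf mg; rewrite -(NpN p g); apply: NpD => //; exact: cmeasN. Qed.

Lemma sqn_cintegral_le f (A : R) : 0 <= A -> cintegrable f -> (Np 1 f <= A%:E)%E ->
  sqn (cintegral f) <= 2 * A ^+ 2.
Proof.
move=> A0 fi fA; have [f1 f2] := fi; have mf := cintegrable_cmeas fi; have [m1 m2] := mf.
have key (u : Rn R n -> R) : measurable_fun setT u -> mu.-integrable setT (EFin \o u) ->
    (forall x, `|u x| <= normc (f x)) -> (\int[mu]_x u x) ^+ 2 <= A ^+ 2.
  move=> mu_ ui uf; rewrite -[leLHS]real_normK ?num_real// lerXn2r ?nnegrE//.
  rewrite -lee_fin; apply: le_trans fA; rewrite -abse_EFin EFin_Rintegral//.
  apply: le_trans (le_abse_integral _ _ _) _ => //; first exact/measurable_EFinP.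
  apply: ge0_le_integral => //.
  - by apply: measurableT_comp => //; exact/measurable_EFinP.
  - by apply/measurable_EFinP; exact: measurable_normc_powR.
  - by move=> x _; rewrite /= lee_fin powRr1 ?normc_ge0.
have h1 := key _ m1 f1 (fun x => let: And3 a _ _ := normc_ReIm (f x) in a).
have h2 := key _ m2 f2 (fun x => let: And3 _ a _ := normc_ReIm (f x) in a).
by rewrite mulr_natl mulr2n /sqn lerD.
Qed.

Lemma sqn_gft_le sg c f (A : R) xi : 0 <= A -> cintegrable f -> (Np 1 f <= A%:E)%E ->
  sqn (gft sg c f xi) <= c ^+ 2 * (2 * A ^+ 2).
Proof.
move=> A0 fi fA; rewrite /gft sqnM sqn_real ler_wpM2l ?sqr_ge0//.
apply: sqn_cintegral_le A0 _ _; first exact: (cintegrable_phase (measurable_phase sg xi) fi).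
suff -> : Np 1 (fun x => expi (sg * dotRn xi x) * f x) = Np 1 f by exact: fA.
apply: eq_integral => x _; by rewrite !normcE sqn_expiM.
Qed.

Lemma N2_indic_bound (B : set (Rn R n)) f (K : R) : measurable B -> cmeas f -> (forall x, sqn (f x) <= K) ->
  (N2 mu (fun x => (f x * (\1_B x : R)%:C)%R) <= K%:E * mu B)%E.
Proof.
move=> mB mf fK; have K0 : 0 <= K by apply: le_trans (fK point); exact: sqn_ge0.
rewrite -[B in mu B]setIT -integral_indic//.
rewrite -[leRHS]ge0_integralZl//; last by apply/measurable_EFinP; exact: measurable_indic.
apply: ge0_le_integral => //.
- by move=> x _; rewrite lee_fin sqn_ge0.
- by apply: emeasurable_sqn; exact: cmeas_indic.
- by apply/measurable_EFinP; apply: measurable_funM; [exact: measurable_cst|exact: measurable_indic].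
- by move=> x _; rewrite -EFinM lee_fin sqn_indic ler_wpM2r.
Qed.

(** The tall part of g lies in L^1 with norm at most M^(1-p) N, so its transform is bounded, and the
    ball contributes the factor rho^n. The low part has squared L^2 norm at most M^(2-p) N. No
    normalisation of g is made, hence the inhomogeneous N + N^2. *)
Lemma N2_fourierL2_ball p : 1 < p -> p < 2 -> exists2 C : R, 0 <= C &
  forall g (N rho : R), L2 g -> 0 <= N -> (Np p g <= N%:E)%E -> 0 < rho ->
  (N2 mu (fun x => (fourierL2 g x * (\1_(ballRn rho) x : R)%:C)%R) <=
    (C * rho `^ (2 * n%:R / p - n%:R) * (N + N ^+ 2))%:E)%E.
Proof.
move=> p1 p2; have p0 : 0 < p by exact: lt_trans p1.
have G0 := gftC_ge0 n (1 : R).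
exists (4 * 2 ^+ n + 8 * gftC n (1 : R)); first by rewrite addr_ge0// mulr_ge0// exprn_ge0.
move=> g N rho g2 N0 gN r0; have [mg g2oo] := g2.
(* With M^p = rho^n the powers M^(2(1-p)) rho^n and M^(2-p) coincide, both being rho^(2n/p - n). *)
pose M := rho `^ (n%:R / p); have M0 : 0 < M by exact: powR_gt0.
pose B := [set x | M < normc (g x)].
have mB : measurable B.
  rewrite (_ : B = (fun x => normc (g x)) @^-1` `]M, +oo[%classic); last first.
    by apply/seteqP; split => x /=; rewrite in_itv/= andbT.
  by rewrite -[X in measurable X]setTI; exact: measurable_normc.
have mB' : measurable (~` B) by exact: measurableC.
pose g1 x := g x * (\1_B x : R)%:C; pose g2' x := g x * (\1_(~` B) x : R)%:C.
have mg1 : cmeas g1 by exact: cmeas_indic.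
have mg2 : cmeas g2' by exact: cmeas_indic.
have L2g1 : L2 g1 by split => //; apply: le_lt_trans g2oo; exact: N2_indic_le.
have L2g2 : L2 g2' by split => //; apply: le_lt_trans g2oo; exact: N2_indic_le.
have Z k : 0 <= k -> (\int[mu]_x (k * normc (g x) `^ p)%:E <= (k * N)%:E)%E.
  move=> k0; under eq_integral do rewrite EFinM.
  rewrite ge0_integralZl//; first by rewrite EFinM lee_wpmul2l.
  - by apply/measurable_EFinP; exact: measurable_normc_powR.
  - by move=> x _; rewrite lee_fin powR_ge0.
have mZ (k : R) : measurable_fun [set: Rn R n] (fun x => (k * normc (g x) `^ p)%:E).
  by apply/measurable_EFinP; apply: measurable_funM; [exact: measurable_cst|exact: measurable_normc_powR].
have N1 : (Np 1 g1 <= (M `^ (1 - p) * N)%:E)%E.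
  apply: le_trans (Z _ (powR_ge0 _ _)); apply: ge0_le_integral => //.
  - by move=> x _; rewrite lee_fin powR_ge0.
  - by apply/measurable_EFinP; exact: measurable_normc_powR.
  move=> x _; rewrite lee_fin powRr1 ?normc_ge0// normcE sqn_indic indicE.
  have [xB|xB] := boolP (x \in B); last by rewrite mulr0 sqrtr0 mulr_ge0 ?powR_ge0.
  rewrite mulr1 -normcE; move: xB; rewrite inE /B /= => Mg.
  have gg0 : 0 < normc (g x) by exact: lt_trans Mg.
  rewrite -[leLHS]mul1r -[1 in leLHS](powRr0 M) (_ : 0 = (1 - p) + (p - 1)); last by ring.
  rewrite powRD; last by rewrite (gt_eqF M0) implybT.
  rewrite -mulrA ler_wpM2l ?powR_ge0//.
  rewrite -[X in _ <= _ `^ X](subrK 1 p) (@powRD _ (normc (g x))); last by rewrite (gt_eqF gg0) implybT.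
  rewrite powRr1 ?normc_ge0// ler_wpM2r ?normc_ge0// ge0_ler_powR ?nnegrE ?normc_ge0 ?subr_ge0 ?(ltW p1) ?(ltW M0)//.
  exact: ltW.
have D1 : D12 g1.
  split; last by case: L2g1.
  by apply/cintegrableP; split => //; apply: le_lt_trans N1 _; exact: ltry.
have N22 : (N2 mu g2' <= (M `^ (2 - p) * N)%:E)%E.
  apply: le_trans (Z _ (powR_ge0 _ _)); apply: ge0_le_integral => //.
  - by move=> x _; rewrite lee_fin sqn_ge0.
  - exact: emeasurable_sqn.
  move=> x _; rewrite lee_fin sqn_indic indicE.
  have [xB|xB] := boolP (x \in ~` B); last by rewrite mulr0 mulr_ge0 ?powR_ge0.
  rewrite mulr1 -sqr_normc; move: xB; rewrite inE /B /= => /negP; rewrite -leNgt => gM.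
  rewrite -powR_mulrn ?normc_ge0// -[X in _ `^ X](subrK p 2) powRD; last first.
    by rewrite subrK pnatr_eq0.
  rewrite ler_wpM2r ?powR_ge0// ge0_ler_powR ?nnegrE ?normc_ge0 ?subr_ge0 ?(ltW p2) ?(ltW M0)//.
have mF (u : Rn R n -> R[i]) : L2 u -> cmeas (fourierL2 u).
  by move=> u2; rewrite fourierL2E; case: (gftL2_L2 (sg := -1) 1 _ u2) => //; rewrite sqrrN expr1n.
have s1 : (-1) ^+ 2 = 1 :> R by rewrite sqrrN expr1n.
pose E := ballRn (n := n) rho; have mE : measurable E by exact: measurable_ballRn.
have E1 : {ae mu, forall x, fourierL2 g x = gft (-1) 1 g1 x + fourierL2 g2' x}.
  have gE : g = fun x => 1 * g1 x + g2' x.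
    apply/funext => x; rewrite mul1r /g1 /g2' -mulrDr -rmorphD !indicE in_setC.
    by case: (x \in B); rewrite ?addr0 ?add0r mulr1.
  have gE' : fourierL2 g = gftL2 (-1) 1 (fun x => 1 * g1 x + g2' x) by rewrite fourierL2E -gE.
  have h1 := gftL2_D12 1 s1 D1; have h2 := gftL2_lin 1 s1 1 L2g1 L2g2.
  near=> x; rewrite gE' fourierL2E (near h2 x)// (near h1 x)// mul1r//.
have mG1 : cmeas (gft (-1) 1 g1) by case: (gft_L2 1 s1 D1).
rewrite (@ae_N2 _ _ _ mu _ (fun x => gft (-1) 1 g1 x * (\1_E x : R)%:C + fourierL2 g2' x * (\1_E x : R)%:C)); first last.
- by apply: filterS E1 => x ->; rewrite mulrDl.
- by apply: cmeasD; apply: cmeas_indic => //; exact: mF.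
- by apply: cmeas_indic => //; exact: mF.
have H := N2D mu (cmeas_indic mE mG1) (cmeas_indic mE (mF _ L2g2)).
apply: (le_trans H) => {H}.
set Q := rho `^ _.
have rn : rho ^+ n = rho `^ n%:R by rewrite powR_mulrn// ltW.
have b1 : (N2 mu (fun x => (gft (-1) 1 g1 x * (\1_E x : R)%:C)%R) <= (2 * 2 ^+ n * Q * N ^+ 2)%:E)%E.
  have A0 : 0 <= M `^ (1 - p) * N by rewrite mulr_ge0 ?powR_ge0.
  have [D1c _] := D1.
  apply: le_trans (N2_indic_bound mE mG1 (fun x => sqn_gft_le (-1) 1 x A0 D1c N1)) _.
  apply: le_trans (lee_wpmul2l _ (ballRn_measure _ r0)) _; first by rewrite lee_fin expr1n mul1r mulr_ge0 ?sqr_ge0.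
  rewrite -EFinM lee_fin expr1n mul1r exprMn exprMn rn /Q.
  rewrite (_ : 2 * n%:R / p - n%:R = n%:R / p * (1 - p) + n%:R / p * (1 - p) + n%:R); last first.
    by field; rewrite gt_eqF.
  rewrite /M -powRrM !powRD ?(gt_eqF r0) ?implybT//.
  by rewrite le_eqVlt; apply/orP; left; apply/eqP; ring.
have b2 : (N2 mu (fun x => (fourierL2 g2' x * (\1_E x : R)%:C)%R) <= (4 * gftC n (1 : R) * Q * N)%:E)%E.
  apply: le_trans (N2_indic_le mE (mF _ L2g2)) _; rewrite fourierL2E.
  apply: le_trans (gftL2_bnd 1 s1 L2g2) _.
  apply: le_trans (lee_wpmul2l _ N22) _; first by rewrite lee_fin mulr_ge0.
  rewrite -EFinM lee_fin /M -powRrM /Q mulrA.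
  rewrite (_ : n%:R / p * (2 - p) = 2 * n%:R / p - n%:R)//.
  by field; rewrite gt_eqF.
apply: le_trans (leeD (lee_wpmul2l _ b1) (lee_wpmul2l _ b2)) _; rewrite ?lee_fin//.
have Q0 : 0 <= Q by exact: powR_ge0.
have : 0 <= (4 * 2 ^+ n) * Q * N by rewrite !mulr_ge0// exprn_ge0.
have : 0 <= 8 * gftC n (1 : R) * Q * N ^+ 2 by do 3! (apply: mulr_ge0 => //); exact: sqr_ge0.
lra.
Unshelve. all: by end_near. Qed.

End Np_theory.

Section bessel_dyadic.
Context (R : realType) (n : nat).
Local Notation mu := (lebesgue_measure_Rn R n).
Local Notation normc := (@ComplexField.Normc.normc _).
Local Open Scope complex_scope.
Implicit Types (f g h u F : Rn R n -> R[i]) (p r s : R).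

Lemma pow2_powR (j : nat) (x : R) : (2 ^+ j : R) `^ x = (2 `^ x) ^+ j.
Proof. by rewrite -powR_mulrn// powRAC powR_mulrn ?powR_ge0. Qed.

Lemma pow2N_lt1 (s : R) : 0 < s -> 2 `^ (- (2 * s)) < 1 :> R.
Proof.
move=> s0; rewrite powRN invf_lt1 ?powR_gt0//.
by rewrite /powR pnatr_eq0/= expR_gt1 mulr_gt0 ?ln_gt0 ?ltr1n// mulr_gt0.
Qed.

Definition annRn (j : nat) : set (Rn R n) := [set x | 2 ^+ j <= normRn x < 2 ^+ j.+1].

Lemma measurable_annRn j : measurable (annRn j).
Proof.
rewrite (_ : annRn j = @normRn R n @^-1` `[2 ^+ j, 2 ^+ j.+1[%classic); last first.
  by apply/seteqP; split => x /=; rewrite in_itv.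
by rewrite -[X in measurable X]setTI; exact: measurable_normRn.
Qed.

Lemma measurable_bessel_symbol r : measurable_fun [set: Rn R n] (@bessel_symbol R n r).
Proof.
rewrite /bessel_symbol; have mp : measurable_fun [set: R] (fun t : R => t `^ (- r / 2)) by exact: measurable_powR.
apply: (measurableT_comp mp); apply: measurable_funD; first exact: measurable_cst.
by apply: measurable_funX; exact: measurable_normRn.
Qed.

Lemma bessel_symbol_le r (lam : R) (x : Rn R n) : 0 <= r -> 0 < lam -> lam ^+ 2 <= 1 + normRn x ^+ 2 ->
  bessel_symbol r x ^+ 2 <= lam `^ (- (2 * r)).
Proof.
move=> r0 l0 lx; rewrite /bessel_symbol.
have p0 : 0 < 1 + normRn x ^+ 2 by apply: lt_le_trans lx; exact: exprn_gt0.
rewrite -powR_mulrn ?powR_ge0// -powRrM (_ : - r / 2 * 2 = - r); last by field.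
rewrite !powRN lef_pV2 ?posrE ?powR_gt0// powRrM powR_mulrn ?(ltW l0)//.
by rewrite ge0_ler_powR ?nnegrE ?exprn_ge0 ?(ltW l0) ?(ltW p0).
Qed.

Lemma N2_indicD (A B : set (Rn R n)) F : measurable A -> measurable B -> A `&` B = set0 -> cmeas F ->
  (N2 mu (fun x => (F x * (\1_(A `|` B) x : R)%:C)%R) =
   N2 mu (fun x => (F x * (\1_A x : R)%:C)%R) + N2 mu (fun x => (F x * (\1_B x : R)%:C)%R))%E.
Proof.
move=> mA mB AB mF; rewrite /N2 -ge0_integralD//; first last.
- by apply: emeasurable_sqn; exact: cmeas_indic.
- by move=> x _; rewrite lee_fin sqn_ge0.
- by apply: emeasurable_sqn; exact: cmeas_indic.
- by move=> x _; rewrite lee_fin sqn_ge0.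
apply: eq_integral => x _; rewrite -EFinD !sqn_indic -mulrDr; congr (_ * _)%:E.
have : ~~ ((x \in A) && (x \in B)) by rewrite -in_setI AB in_set0.
by rewrite !indicE in_setU; case: (x \in A); case: (x \in B) => //= _; rewrite ?addr0 ?add0r.
Qed.

Lemma ballRn_annRn j : @ballRn R n (2 ^+ j.+1) = ballRn (2 ^+ j) `|` annRn j.
Proof.
apply/seteqP; split => x; rewrite /ballRn /annRn/=.
  by move=> ->; rewrite andbT; case: (ltP (normRn x) (2 ^+ j)) => h; [left|right].
by move=> [h|/andP[]//]; apply: lt_le_trans h _; rewrite exprS ler_peMl ?exprn_ge0// ler1n.
Qed.

Lemma ballRn_annRn0 j : @ballRn R n (2 ^+ j) `&` annRn j = set0.
Proof. by rewrite -subset0 => x [/= h] /andP[]; rewrite leNgt h. Qed.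

(** In terms of the function with spectrum F, this is membership in the Besov space of order s with
    indices 2 and infinity; K bounds the squared pieces. *)
Definition dyadic_bound s F (K : R) := 
  (N2 mu (fun x => (F x * (\1_(ballRn 1) x : R)%:C)%R) <= K%:E)%E /\
  (forall j, N2 mu (fun x => (F x * (\1_(annRn j) x : R)%:C)%R) <= (K * (2 ^+ j) `^ (- (2 * s)))%:E)%E.

Lemma dyadic_bound_ball s F K J : cmeas F -> 0 < s -> 0 <= K -> dyadic_bound s F K ->
  (N2 mu (fun x => (F x * (\1_(ballRn (2 ^+ J)) x : R)%:C)%R) <= (K * (1 + (1 - 2 `^ (- (2 * s)))^-1))%:E)%E.
Proof.
move=> mF s0 K0 [h0 h].
set q := 2 `^ _; have q0 : 0 <= q by exact: powR_ge0.
have q1 : q < 1.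
  exact: pow2N_lt1.
have key : (N2 mu (fun x => (F x * (\1_(ballRn (2 ^+ J)) x : R)%:C)%R) <= (K * (1 + (1 - q ^+ J) / (1 - q)))%:E)%E.
  elim: J => [|J IH].
    by rewrite expr0 subrr mul0r addr0 mulr1.
  rewrite ballRn_annRn N2_indicD//; [|exact: measurable_ballRn|exact: measurable_annRn|exact: ballRn_annRn0].
  apply: le_trans (leeD IH (h J)) _; rewrite -EFinD lee_fin pow2_powR -/q exprS.
  by rewrite le_eqVlt; apply/orP; left; apply/eqP; field; rewrite subr_eq0 gt_eqF.
apply: le_trans key _; rewrite lee_fin ler_wpM2l// lerD2l -[leRHS]mul1r ler_wpM2r//.
  by rewrite invr_ge0 subr_ge0 ltW.
by rewrite gerBl exprn_ge0.
Qed.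

Lemma cvg_ball_indic F (x : Rn R n) : exists N, forall J, (N <= J)%N -> F x * (\1_(ballRn (2 ^+ J)) x : R)%:C = F x.
Proof.
exists (Num.truncn (normRn x)).+1 => J hJ; rewrite indicE mem_set ?mulr1//= /ballRn/=.
apply: lt_le_trans (truncnS_gt _) _; apply: (@le_trans _ _ J%:R); first by rewrite ler_nat.
by rewrite -natrX ler_nat ltnW// ltn_expl.
Qed.

(** The bound on the balls, a partial geometric sum, is uniform in the radius; Fatou's lemma gives
    the whole space. *)
Lemma dyadic_bound_N2 s F K : cmeas F -> 0 < s -> 0 <= K -> dyadic_bound s F K ->
  (N2 mu F <= (K * (1 + (1 - 2 `^ (- (2 * s)))^-1))%:E)%E.
Proof.
move=> mF s0 K0 hF.
apply: (@N2_fatou _ _ _ mu (fun J x => F x * (\1_(ballRn (2 ^+ J)) x : R)%:C)) => //.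
- by move=> J; apply: cmeas_indic => //; exact: measurable_ballRn.
- apply: aeW => x; have [N hN] := cvg_ball_indic F x.
  split; apply: cvg_near_cst; exists N => // J /= /hN ->//.
- by apply: nearW => J; exact: dyadic_bound_ball hF.
Qed.

(** On the annulus the squared symbol is at most lam^(-2r), and [N2_fourierL2_ball] on the enclosing
    ball gives (2 lam)^b; the exponents add up to b - 2r = -2s. *)
Lemma bessel_dyadic p r : 1 < p -> p < 2 -> 0 < r -> exists2 C : R, 0 <= C &
  forall g (N : R), L2 g -> 0 <= N -> (Np p g <= N%:E)%E ->
  dyadic_bound (n%:R / 2 + r - n%:R / p) (fun x => (bessel_symbol r x)%:C * fourierL2 g x) (C * (N + N ^+ 2)).
Proof.
move=> p1 p2 r0; have [C C0 hC] := N2_fourierL2_ball n p1 p2.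
set b := 2 * n%:R / p - n%:R in hC.
(* The power 2^b comes from the outer radius 2 lam of the annuli, and the 1 covers the unit ball. *)
exists (C * (2 `^ b + 1)); first by rewrite mulr_ge0// addr_ge0 ?powR_ge0.
move=> g N g2 N0 gN.
have s1 : (-1) ^+ 2 = 1 :> R by rewrite sqrrN expr1n.
have mg : cmeas (fourierL2 g) by rewrite fourierL2E; case: (gftL2_L2 1 s1 g2).
have mk : cmeas (fun x : Rn R n => (bessel_symbol r x)%:C) by apply: cmeas_real; exact: measurable_bessel_symbol.
have NN : 0 <= N + N ^+ 2 by rewrite addr_ge0// exprn_ge0.
have key (A : set (Rn R n)) (lam rho : R) : measurable A -> 0 < lam -> 0 < rho -> A `<=` ballRn rho ->
    (forall x, A x -> lam ^+ 2 <= 1 + normRn x ^+ 2) ->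
    (N2 mu (fun x => (((bessel_symbol r x)%:C * fourierL2 g x) * (\1_A x : R)%:C)%R) <=
     (lam `^ (- (2 * r)) * (C * rho `^ b * (N + N ^+ 2)))%:E)%E.
  move=> mA l0 rho0 Arho Al.
  apply: (@le_trans _ _ ((lam `^ (- (2 * r)))%:E * N2 mu (fun x => (fourierL2 g x * (\1_(ballRn rho) x : R)%:C)%R))%E); last first.
    by rewrite EFinM lee_wpmul2l ?lee_fin ?powR_ge0//; exact: hC.
  rewrite -N2Zl ?powR_ge0//; last by apply: cmeas_indic => //; exact: measurable_ballRn.
  apply: ge0_le_integral => //.
  - by move=> x _; rewrite lee_fin sqn_ge0.
  - by apply: emeasurable_sqn; apply: cmeas_indic => //; exact: cmeasM.
  - apply/measurable_EFinP; apply: measurable_funM; first exact: measurable_cst.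
    by apply: measurable_sqn; apply: cmeas_indic => //; exact: measurable_ballRn.
  - move=> x _; rewrite lee_fin !sqnM !sqn_real !indicE.
    have [xA|xA] := boolP (x \in A); last by rewrite expr0n mulr0 mulr_ge0 ?powR_ge0// mulr_ge0 ?sqn_ge0 ?sqr_ge0.
    rewrite (_ : x \in ballRn rho); last by apply/mem_set/Arho; exact: set_mem.
    by rewrite expr1n !mulr1 ler_wpM2r ?sqn_ge0//; apply: bessel_symbol_le; [exact: ltW|by []|exact: Al (set_mem xA)].
split.
  have k1 (x : Rn R n) : ballRn 1 x -> (1 : R) ^+ 2 <= 1 + normRn x ^+ 2.
    by move=> _; rewrite expr1n lerDl sqr_ge0.
  have k0 := key (@ballRn R n 1) 1 1 (measurable_ballRn 1) ltr01 ltr01 (@subset_refl _ _) k1.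
  apply: (le_trans k0).
  rewrite !powR1 lee_fin mul1r mulr1 ler_wpM2r// ler_peMr// lerDr powR_ge0//.
move=> j.
have p2' i : 0 < 2 ^+ i :> R by rewrite exprn_gt0.
have k2 x : annRn j x -> (2 ^+ j : R) ^+ 2 <= 1 + normRn x ^+ 2.
  move=> /andP[h _]; apply: (@le_trans _ _ (normRn x ^+ 2)); last by rewrite lerDr.
  by rewrite lerXn2r ?nnegrE ?exprn_ge0 ?normRn_ge0.
have k3 : annRn j `<=` ballRn (2 ^+ j.+1) by move=> x /andP[].
apply: (le_trans (key _ (2 ^+ j) (2 ^+ j.+1) (measurable_annRn _) (p2' _) (p2' _) k3 k2)).
have L0 : 2 ^+ j != 0 :> R by rewrite expf_neq0.
rewrite lee_fin (_ : - (2 * (n%:R / 2 + r - n%:R / p)) = - (2 * r) + b); last first.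
  by rewrite /b; field; rewrite gt_eqF// (lt_trans _ p1).
rewrite (@powRD _ (2 ^+ j) (- (2 * r)) b); last by rewrite L0 implybT.
rewrite (exprS _ j) powRM ?exprn_ge0//.
set X := (2 ^+ j) `^ b; set Y := (2 ^+ j) `^ _.
have XY : 0 <= C * X * Y * (N + N ^+ 2) by rewrite !mulr_ge0// powR_ge0.
lra.
Qed.

End bessel_dyadic.

(** * The spectrum of a function in a Bessel potential space *)

Section bessel_space.
Context (R : realType) (n : nat).
Local Notation mu := (lebesgue_measure_Rn R n).
Local Notation normc := (@ComplexField.Normc.normc _).
Local Open Scope complex_scope.
Implicit Types (f g h u F : Rn R n -> R[i]) (p r s : R).

(** The sum of the two integrands tends to 0 in L^1, so a common subsequence converges a.e. to both
    limits. This matches the L^p limit that defines [bessel_op] with an L^2 limit on the Fourier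
    side. *)
Lemma Lp_L2_ae_eq p (u_ : nat -> Rn R n -> R[i]) f g : 0 < p -> (forall k, cmeas (u_ k)) -> cmeas f -> cmeas g ->
  tends0 (fun k => Np p (fun x => u_ k x - f x)) -> tends0 (fun k => N2 mu (fun x => u_ k x - g x)) ->
  {ae mu, forall x, f x = g x}.
Proof.
move=> p0 mu_ mf mg uf ug.
pose v k x := normc (u_ k x - f x) `^ p + sqn (u_ k x - g x).
have mv k : measurable_fun [set: Rn R n] (v k).
  apply: measurable_funD; first by apply: measurable_normc_powR; exact: cmeasB.
  by apply: measurable_sqn; exact: cmeasB.
have v0 k x : 0 <= v k x by rewrite addr_ge0 ?powR_ge0 ?sqn_ge0.
have vt : tends0 (fun k => \int[mu]_x (v k x)%:E)%E.
  apply: (@tends0_lin _ _ _ _ 1 1 ler01 ler01 _ uf ug) => k.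
  rewrite !mul1e /v; under eq_integral do rewrite EFinD.
  rewrite ge0_integralD//.
  - by move=> x _; rewrite lee_fin powR_ge0.
  - by apply/measurable_EFinP; apply: measurable_normc_powR; exact: cmeasB.
  - by move=> x _; rewrite lee_fin sqn_ge0.
  - by apply: emeasurable_sqn; exact: cmeasB.
have [phi [_ h]] := ae_cvg0_subseq mv v0 vt.
apply: filterS h => x vx.
have : forall e : R, 0 < e -> normc (f x - g x) <= e.
  move=> e e0; have e2 : 0 < e / 2 by rewrite divr_gt0.
  have m0 : 0 < Num.min ((e / 2) `^ p) ((e / 2) ^+ 2) by rewrite lt_min powR_gt0// exprn_gt0.
  have /cvgrPdist_lt/(_ _ m0)[N _ hN] := vx.
  have := hN N (leqnn N); rewrite /= sub0r normrN ger0_norm// lt_min => /andP[h1 h2].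
  have a1 : normc (u_ (phi N) x - f x) <= e / 2.
    rewrite leNgt; apply/negP => lt.
    have : normc (u_ (phi N) x - f x) `^ p < (e / 2) `^ p by apply: le_lt_trans h1; rewrite lerDl sqn_ge0.
    by apply/negP; rewrite -leNgt ge0_ler_powR ?nnegrE ?normc_ge0// ltW.
  have a2 : normc (u_ (phi N) x - g x) <= e / 2.
    rewrite leNgt; apply/negP => lt.
    have : sqn (u_ (phi N) x - g x) < (e / 2) ^+ 2 by apply: le_lt_trans h2; rewrite lerDr powR_ge0.
    by apply/negP; rewrite -leNgt -sqr_normc lerXn2r ?nnegrE ?normc_ge0// ltW.
  rewrite (_ : f x - g x = - (u_ (phi N) x - f x) + (u_ (phi N) x - g x)); last by ring.
  by apply: le_trans (normcD _ _) _; rewrite normcN (splitr e) lerD.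
move=> he; have : normc (f x - g x) = 0.
  by apply/eqP; rewrite eq_le normc_ge0 andbT; apply/ler_addgt0Pr => e e0; rewrite add0r he.
by move=> h0; apply/eqP; rewrite -subr_eq0; apply/eqP; apply: sqn_eq0; rewrite -sqr_normc h0 expr0n.
Qed.

Lemma dyadic_bound0 s : dyadic_bound s (fun _ : Rn R n => 0 : R[i]) 0.
Proof.
have z (A : set (Rn R n)) : N2 mu (fun x => (0 * (\1_A x : R)%:C)%R) = 0%E.
  by apply: integral0_eq => x _; rewrite mul0r sqn0.
by split; [rewrite z|move=> j; rewrite z mul0r].
Qed.

(** For g merely in L^p the transform is not given by [fourierL2]. Instead F is the L^2 limit of the
    symbol times the transforms of approximants of g: [bessel_dyadic] applied to differences shows
    that these are Cauchy, and applied to the approximants it gives annulus bounds that pass to the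
    limit. *)
Lemma bessel_space_spectrum p r f : 1 < p -> p < 2 -> 0 < r -> 0 < n%:R / 2 + r - n%:R / p ->
  bessel_space p r f -> exists F, exists2 K : R, 0 <= K &
  [/\ L2 F, dyadic_bound (n%:R / 2 + r - n%:R / p) F K,
      {ae mu, forall x, inv_fourierL2 F x = f x} & {ae mu, forall x, fourierL2 f x = F x}].
Proof.
move=> p1 p2 r0; set s := _ + r - _ => s0 [g gp fh].
have p0 : 0 < p by exact: lt_trans p1.
suff [F [K K0 [F2 dF hF]]] : exists F, exists2 K : R, 0 <= K &
    [/\ L2 F, dyadic_bound s F K & {ae mu, forall x, bessel_op p r g x = inv_fourierL2 F x}].
  exists F, K => //; have fF : {ae mu, forall x, f x = inv_fourierL2 F x}.
    by apply: filterS2 fh hF => x -> ->.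
  split => //; first by apply: filterS fF => x ->.
  rewrite fourierL2E (gftL2_ae _ _ fF) -fourierL2E; exact: inv_fourierL2K.
rewrite /bessel_op /Lp_ext; set S := (X in xget _ X).
(* If the extension had no value at g, [xget] would return 0, and F = 0 would do; so its existence
   need not be settled. *)
have [eS|nS] := pselect (exists h, S h); last first.
  rewrite xgetPN; last by move=> h Sh; apply: nS; exists h.
  exists (fun=> 0), 0 => //; split; [exact: L2_0|exact: dyadic_bound0|].
  have s1 : 1 ^+ 2 = 1 :> R by rewrite expr1n.
  rewrite inv_fourierL2E; have := @gftL2_sub _ n 1 ((2 * pi) ^- n) s1 _ _ (L2_0 R n) (L2_0 R n).
  have e0 : (fun _ : Rn R n => (0 : R[i]) - 0) = fun=> 0 by apply/funext => x; rewrite subrr.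
  by apply: filterS => x; rewrite e0 subrr => ->.
have := xgetPex (fun=> 0) eS; move: (xget _ _) => h [hp [g_ [Dg gcvg Tcvg]]].
have [C C0 hC] := bessel_dyadic n p1 p2 r0.
have s1 : (-1) ^+ 2 = 1 :> R by rewrite sqrrN expr1n.
have s1' : 1 ^+ 2 = 1 :> R by rewrite expr1n.
have [mg gfin] := (memLpP g p0).1 gp.
have [mh _] := (memLpP h p0).1 hp.
have g2 k : L2 (g_ k) by apply/memLp2P; case: (Dg k).
have mg_ k : cmeas (g_ k) by case: (g2 k).
have mk : cmeas (fun x : Rn R n => (bessel_symbol r x)%:C) by apply: cmeas_real; exact: measurable_bessel_symbol.
have mF (v : Rn R n -> R[i]) : L2 v -> cmeas (fourierL2 v) by move=> v2; rewrite fourierL2E; case: (gftL2_L2 1 s1 v2).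
pose q := 1 + (1 - 2 `^ (- (2 * s)))^-1 : R.
pose u k x := (bessel_symbol r x)%:C * fourierL2 (g_ k) x.
have mu_ k : cmeas (u k) by apply: cmeasM => //; exact: mF.
have /(cvgLpP _ _ p0) gt := gcvg.
have Nfin (v : Rn R n -> R[i]) (N : R) : L2 v -> 0 <= N -> (Np p v <= N%:E)%E ->
    (N2 mu (fun x => ((bessel_symbol r x)%:C * fourierL2 v x)%R) <= (C * (N + N ^+ 2) * q)%:E)%E.
  move=> v2 N0 vN; apply: dyadic_bound_N2 (hC _ _ v2 N0 vN) => //; first by apply: cmeasM => //; exact: mF.
  by rewrite mulr_ge0// addr_ge0// sqr_ge0.
have q0 : 0 <= q.
  by rewrite addr_ge0// invr_ge0 subr_ge0 ltW// pow2N_lt1.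
have cauchy (e : R) : 0 < e -> exists N, forall k m, (N <= k)%N -> (N <= m)%N ->
    (N2 mu (fun x => u k x - u m x)%R <= e%:E)%E.
  (* As d <= 1, the inhomogeneous d + d^2 is at most 2 d, and 2 C q d <= e by the second entry of
     the minimum. *)
  move=> e0; pose d := Num.min 1 (e / (2 * (C * q) + 1)).
  have Cq : 0 <= C * q by rewrite mulr_ge0.
  have d0 : 0 < d by rewrite lt_min ltr01 divr_gt0// ltr_wpDl// mulr_ge0.
  have p2p : 0 < 2 `^ p * 2 :> R by rewrite mulr_gt0// powR_gt0.
  have [N hN] := gt (d / (2 `^ p * 2)) (divr_gt0 d0 p2p).
  exists N => k m Nk Nm.
  have Lkm := L2B (g2 k) (g2 m).
  have NN : (Np p (fun x => (g_ k x - g_ m x)%R) <= d%:E)%E.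
    rewrite (_ : Np p _ = Np p (fun x => ((g_ k x - g x) - (g_ m x - g x))%R)); last first.
      by congr Np; apply/funext => x; ring.
    apply: (le_trans (NpB p0 (cmeasB (mg_ k) mg) (cmeasB (mg_ m) mg))).
    apply: (@le_trans _ _ ((2 `^ p)%:E * ((d / (2 `^ p * 2))%:E + (d / (2 `^ p * 2))%:E))%E).
      by rewrite lee_wpmul2l ?lee_fin ?powR_ge0// leeD//; exact: hN.
    rewrite -EFinD -EFinM lee_fin le_eqVlt; apply/orP; left; apply/eqP; field.
    by rewrite gt_eqF// powR_gt0.
  have := Nfin _ _ Lkm (ltW d0) NN.
  rewrite (@ae_N2 _ _ _ mu _ (fun x => u k x - u m x)); first last.
  - have := gftL2_sub 1 s1 (g2 k) (g2 m); rewrite -fourierL2E; apply: filterS => x ->.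
    by rewrite mulrBr.
  - exact: cmeasB.
  - by apply: cmeasM => //; exact: mF.
  move=> H; apply: (le_trans H); rewrite lee_fin.
  have d1 : d <= 1 by rewrite ge_min lexx.
  have d2 : d * (2 * (C * q) + 1) <= e.
    by rewrite -ler_pdivlMr ?ge_min ?lexx ?orbT// ltr_wpDl// mulr_ge0.
  have dd : d + d ^+ 2 <= 2 * d by rewrite expr2; have := ltW d0; nra.
  have : C * q * (d + d ^+ 2) <= C * q * (2 * d) by rewrite ler_wpM2l.
  lra.
have [F mFF uF] := @cauchy_N2_cvg _ _ _ mu u mu_ cauchy.
have u2 k : L2 (u k).
  split => //; have /(memLpP _ p0)[_ gk] : memLp p (g_ k) by case: (Dg k).
  have fin : Np p (g_ k) \is a fin_num by rewrite ge0_fin_numE ?Np_ge0.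
  apply: le_lt_trans (Nfin _ (fine (Np p (g_ k))) (g2 k) _ _) (ltry _); first by rewrite fine_ge0 ?Np_ge0.
  by rewrite fineK.
have F2 : L2 F.
  split => //; have [N hN] := uF 1 ltr01; have [_ uN] := u2 N.
  have := N2B mu (mu_ N) (cmeasB (mu_ N) mFF).
  under eq_fun do rewrite opprB addrC subrK.
  move=> H; apply: (le_lt_trans H); rewrite lte_add_pinfty// lte_mul_pinfty//.
  exact: le_lt_trans (hN _ (leqnn N)) (ltry _).
have Npg : Np p g \is a fin_num by rewrite ge0_fin_numE ?Np_ge0.
pose Nb := 2 `^ p * (1 + fine (Np p g)).
have Nb0 : 0 <= Nb by rewrite mulr_ge0 ?powR_ge0// addr_ge0// fine_ge0 ?Np_ge0.
have NpNb : exists N, forall k, (N <= k)%N -> (Np p (g_ k) <= Nb%:E)%E.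
  have [N hN] := gt 1 ltr01; exists N => k /hN Nk.
  have := NpD p0 (cmeasB (mg_ k) mg) mg; under eq_fun do rewrite subrK.
  move=> H; apply: (le_trans H); rewrite /Nb EFinM lee_wpmul2l ?lee_fin ?powR_ge0//.
  by rewrite EFinD fineK// leeD.
(* Writing F as u_k - (u_k - F) costs a factor 2 and an error that tends to 0. *)
have lim (A : set (Rn R n)) (b : R) : measurable A ->
    (exists N, forall k, (N <= k)%N -> N2 mu (fun x => (u k x * (\1_A x : R)%:C)%R) <= b%:E)%E ->
    (N2 mu (fun x => (F x * (\1_A x : R)%:C)%R) <= (2 * b)%:E)%E.
  move=> mA [N1 h1]; apply/lee_addgt0Pr => e e0.
  have e2 : 0 < e / 2 by rewrite divr_gt0.
  have [N2' h2] := uF _ e2; pose k := maxn N1 N2'.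
  have := N2B mu (cmeas_indic mA (mu_ k)) (cmeas_indic mA (cmeasB (mu_ k) mFF)).
  under eq_fun do rewrite -mulrBl opprB addrC subrK.
  move=> H; apply: (le_trans H); rewrite [X in (_ <= X%:E + _)%E]/= EFinM; apply: leeD.
    by rewrite lee_wpmul2l//; apply: h1; rewrite leq_maxl.
  rewrite (_ : e = 2 * (e / 2)); last by field.
  rewrite [leRHS]EFinM lee_wpmul2l//; apply: le_trans (N2_indic_le mA (cmeasB (mu_ k) mFF)) _.
  by apply: h2; rewrite leq_maxr.
exists F, (2 * (C * (Nb + Nb ^+ 2))).
  by rewrite !mulr_ge0// addr_ge0// sqr_ge0.
have [N hN] := NpNb.
split=> //.
  split; first by apply: lim; [exact: measurable_ballRn|exists N => k /hN hk; case: (hC _ _ (g2 k) Nb0 hk)].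
  move=> j; rewrite -mulrA; apply: lim; first exact: measurable_annRn.
  by exists N => k /hN hk; case: (hC _ _ (g2 k) Nb0 hk).
apply: (@Lp_L2_ae_eq p (fun k => inv_fourierL2 (u k))) => //.
- by move=> k; rewrite inv_fourierL2E; case: (gftL2_L2 ((2 * pi) ^- n) s1' (u2 k)).
- by rewrite inv_fourierL2E; case: (gftL2_L2 ((2 * pi) ^- n) s1' F2).
- by apply/(cvgLpP _ _ p0).
- by rewrite inv_fourierL2E; exact: gftL2_continuous.
Qed.

End bessel_space.

(** * Local smoothing *)

Section schur_kernel.
Context (R : realType).
Local Notation mu1 := (@lebesgue_measure R).
Implicit Types (a lam rho X u w N : R).

(** A mean value inequality without derivatives: y^a = y^(a-1) y, and y^(a-1) is monotone and at
    least lam^(a-1). *)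
Lemma powRB_ge a lam X rho : 1 < a -> 0 < lam -> lam <= rho -> rho <= X ->
  lam `^ (a - 1) * (X - rho) <= X `^ a - rho `^ a.
Proof.
move=> a1 l0 lr rX; have r0 : 0 < rho by exact: lt_le_trans lr.
have X0 : 0 < X by exact: lt_le_trans rX.
have a0 : 0 <= a - 1 by rewrite subr_ge0 ltW.
have E y : 0 < y -> y `^ a = y `^ (a - 1) * y.
  move=> y0; rewrite -[X in _ = _ * X](powRr1 (ltW y0)) -powRD ?subrK//.
  by rewrite (gt_eqF y0) implybT.
rewrite !E//.
apply: (@le_trans _ _ (X `^ (a - 1) * (X - rho))).
  by rewrite ler_wpM2r ?subr_ge0// ge0_ler_powR ?nnegrE ?(ltW l0) ?(ltW X0)// (le_trans lr).
rewrite mulrBr lerD2l lerN2 ler_wpM2r ?(ltW r0)//.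
by rewrite ge0_ler_powR ?nnegrE ?(ltW r0) ?(ltW X0).
Qed.

Lemma powRB_dist a lam X rho : 1 < a -> 0 < lam -> lam <= rho -> lam <= X ->
  lam `^ (a - 1) * `|rho - X| <= `|rho `^ a - X `^ a|.
Proof.
move=> a1 l0 lr lX; have [rX|/ltW Xr] := leP rho X.
  rewrite distrC (distrC (_ `^ _)) ger0_norm ?subr_ge0//.
  by apply: le_trans (powRB_ge a1 l0 lr rX) (ler_norm _).
rewrite ger0_norm ?subr_ge0//.
by apply: le_trans (powRB_ge a1 l0 lX Xr) (ler_norm _).
Qed.

(** Along a line parallel to an axis, X is the radius at height u, w collects the other coordinates,
    and [u0] is the height at which the radius equals rho, or 0 if the line stays outside that
    sphere. Then | |u| - u0 | |u| <= |rho^2 - X^2| <= 3 X |rho - X|, and |u| >= X / N is divided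
    out. *)
Lemma dist_radius X rho u w N : 0 < X -> 0 <= rho -> rho <= 2 * X -> 0 <= w -> X ^+ 2 = u ^+ 2 + w ->
  X <= N * `|u| -> `| `|u| - Num.sqrt (Num.max (rho ^+ 2 - w) 0)| <= 3 * N * `|rho - X|.
Proof.
move=> X0 r0 rX w0 XE XN; set u0 := Num.sqrt _.
have u00 : 0 <= u0 by exact: sqrtr_ge0.
have m0 : 0 <= Num.max (rho ^+ 2 - w) 0 by rewrite le_max lexx orbT.
have u0E : u0 ^+ 2 = Num.max (rho ^+ 2 - w) 0 by rewrite sqr_sqrtr.
have ua0 : 0 < `|u|.
  by rewrite lt_neqAle normr_ge0 andbT eq_sym; apply/eqP => h; move: XN; rewrite h mulr0 leNgt X0.
have sqE : `|u| ^+ 2 = u ^+ 2 by rewrite real_normK ?num_real.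
have h : `| `|u| - u0| * (`|u| + u0) <= `|rho - X| * (rho + X).
  have e1 : `| `|u| - u0| * (`|u| + u0) = `|u ^+ 2 - u0 ^+ 2|.
    by rewrite -[X in _ * X]ger0_norm ?addr_ge0// -normrM -subr_sqr sqE.
  have e2 : `|rho - X| * (rho + X) = `|rho ^+ 2 - X ^+ 2|.
    by rewrite -[X in _ * X]ger0_norm ?addr_ge0 ?(ltW X0)// -normrM -subr_sqr.
  rewrite e1 e2 u0E XE distrC; case: (leP (rho ^+ 2 - w) 0) => hw.
    rewrite sub0r normrN ger0_norm ?sqr_ge0// distrC.
    by apply: le_trans (ler_norm _); lra.
  by rewrite (_ : rho ^+ 2 - w - u ^+ 2 = rho ^+ 2 - (u ^+ 2 + w)); [|ring].
rewrite -(ler_pM2r ua0); apply: (@le_trans _ _ (`| `|u| - u0| * (`|u| + u0))).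
  by rewrite ler_wpM2l// lerDl.
apply: le_trans h _; rewrite (_ : 3 * N * _ * _ = `|rho - X| * (3 * (N * `|u|))); last by ring.
by rewrite ler_wpM2l//; lra.
Qed.

(** The two preceding estimates give |rho^a - X^a| >= L | |u| - u0 |. So the kernel is below 2 / (1
    + (L v)^2), a Poisson kernel of width 1/L times 1/L, with v measured from u0 or -u0 according to
    the sign of u. The prefactor 1/L is the smoothing gain. *)
Lemma poisson_radius a lam X rho u w N L u0 : 1 < a -> 0 < lam -> lam <= rho -> lam <= X -> rho <= 2 * X ->
  0 <= w -> X ^+ 2 = u ^+ 2 + w -> 0 < N -> X <= N * `|u| ->
  L = lam `^ (a - 1) / (3 * N) -> u0 = Num.sqrt (Num.max (rho ^+ 2 - w) 0) ->
  poisson 1 (rho `^ a - X `^ a) <= L^-1 * (poisson L^-1 (u - u0) + poisson L^-1 (u - - u0)).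
Proof.
move=> a1 l0 lr lX rX w0 XE N0 XN LE u0E.
have X0 : 0 < X by exact: lt_le_trans lX.
have L0 : 0 < L by rewrite LE divr_gt0 ?powR_gt0// mulr_gt0.
have d1 : L * `| `|u| - u0| <= `|rho `^ a - X `^ a|.
  apply: le_trans (powRB_dist a1 l0 lr lX).
  rewrite LE u0E -mulrA ler_wpM2l ?powR_ge0// ler_pdivrMl ?mulr_gt0//.
  by apply: dist_radius => //; exact: le_trans (ltW l0) lr.
have PE v : L^-1 * poisson L^-1 v = 2 / (1 + (L * v) ^+ 2).
  rewrite /poisson exprMn; field.
  by rewrite (gt_eqF L0) andbT gt_eqF// ltr_wpDr// sqr_ge0.
have dec (s t : R) : 0 <= s -> s <= t -> 2 / (1 + t ^+ 2) <= 2 / (1 + s ^+ 2).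
  move=> s0 st; rewrite ler_pM2l// lef_pV2 ?posrE ?ltr_wpDr ?sqr_ge0//.
  by rewrite lerD2l lerXn2r ?nnegrE// (le_trans s0).
apply: (@le_trans _ _ (2 / (1 + (L * `| `|u| - u0|) ^+ 2))).
  rewrite /poisson mulr1 expr1n -(real_normK (num_real (rho `^ a - X `^ a))).
  by apply: dec => //; rewrite mulr_ge0// ltW.
rewrite mulrDr !PE exprMn (real_normK (num_real (_ - u0))) -exprMn.
have pos v : 0 <= 2 / (1 + (L * v) ^+ 2).
  by rewrite divr_ge0// addr_ge0// sqr_ge0.
case: (leP 0 u) => hu; first by rewrite ger0_norm// lerDl.
rewrite ltr0_norm// (_ : L * (- u - u0) = - (L * (u - - u0))); last by ring.
by rewrite sqrrN lerDr.
Qed.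

End schur_kernel.

Section schur_kernel_Rn.
Context (R : realType) (m : nat).
Local Notation n := m.+1.
Local Notation mu k := (lebesgue_measure_Rn R k).
Local Notation mu1 := (@lebesgue_measure R).

(** The Fourier transform of the space-time weight e^(-|t|) phi, evaluated at the difference of the
    points of the surface (|xi|^a, xi) above [z.1] and [z.2]. *)
Definition dispker (a : R) (z : Rn R n * Rn R n) : R :=
  poisson 1 (normRn z.1 `^ a - normRn z.2 `^ a) * poissonRn 1 (subRn z.1 z.2).

Lemma measurable_normRn_powR (a : R) k : measurable_fun [set: Rn R k] (fun x => normRn x `^ a).
Proof.
have mp : measurable_fun [set: R] (fun t : R => t `^ a) by exact: measurable_powR.
exact: (measurableT_comp mp (@measurable_normRn R k)).
Qed.

Lemma measurable_dispker (a : R) : measurable_fun setT (dispker a).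
Proof.
apply: measurable_funM.
  have mp : measurable_fun [set: R] (poisson (1 : R)) by exact: measurable_poisson.
  apply: (measurableT_comp mp); apply: measurable_funB.
    exact: (measurableT_comp (measurable_normRn_powR a (k := n)) measurable_fst).
  exact: (measurableT_comp (measurable_normRn_powR a (k := n)) measurable_snd).
have ms : measurable_fun setT (fun z : Rn R n * Rn R n => subRn z.1 z.2).
  by apply: measurable_subRn; [exact: measurable_fst|exact: measurable_snd].
have mp : measurable_fun [set: Rn R n] (@poissonRn R 1 n) by exact: measurable_poissonRn.
exact: (measurableT_comp mp ms).
Qed.

Lemma sqr_normRn_insert i u (y : Rn R m) :
  normRn (insert_Rn i u y) ^+ 2 = u ^+ 2 + dotRn y y.
Proof.
rewrite sqr_normRn /dotRn (bigD1_ord i)//= tnth_insert -expr2; congr (_ + _).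
by apply: eq_bigr => k _; rewrite tnth_insert_lift.
Qed.

(** Otherwise n times each squared coordinate would be below |x|^2, and summation over the n
    coordinates gives a contradiction. *)
Lemma cone_cover (x : Rn R n) : exists i, normRn x <= Num.sqrt n%:R * `|tnth x i : R|.
Proof.
apply/not_existsP => h.
have h' i : (tnth x i : R) ^+ 2 * n%:R < normRn x ^+ 2.
  have /negP := h i; rewrite -ltNge => hi.
  rewrite -real_normK ?num_real// -[n%:R]sqr_sqrtr ?ler0n// -exprMn mulrC.
  by rewrite ltrXn2r// ?nnegrE ?mulr_ge0 ?sqrtr_ge0 ?normRn_ge0.
have : \sum_(i < n) (tnth x i : R) ^+ 2 * n%:R < \sum_(i < n) normRn x ^+ 2.
  by apply: ltr_sum => [|i _]; [apply/hasP; exists ord0; rewrite ?mem_index_enum|exact: h'].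
rewrite sumr_const card_ord -mulr_suml sqr_normRn /dotRn.
under eq_bigr do rewrite expr2.
by rewrite -[X in _ < X]mulr_natr ltxx.
Qed.

(** The annulus is covered by n cones. In the i-th, the variable y_i is integrated first:
    [poisson_radius] yields 1/L times two Poisson kernels of mass 2 pi each. The kernels in the
    other m coordinates contribute (2 pi)^m, and 1/L is 3 N lam^(1-a). *)
Lemma dispker_schur (a : R) : 1 < a -> exists2 C : R, 0 <= C & forall j (x : Rn R n), annRn j x ->
  (\int[mu n]_y (\1_(annRn j) y * dispker a (x, y))%:E <= (C * (2 ^+ j) `^ (1 - a))%:E)%E.
Proof.
move=> a1; pose N : R := Num.sqrt n%:R; have N0 : 0 < N by rewrite sqrtr_gt0 ltr0n.
have pi0 : 0 < pi :> R by exact: pi_gt0.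
exists (n%:R * (2 * (3 * N) * (4 * pi) * (2 * pi) ^+ m)).
  by rewrite !mulr_ge0 ?exprn_ge0 ?mulr_ge0 ?(ltW N0) ?(ltW pi0).
move=> j x xj; set lam : R := 2 ^+ j; have l0 : 0 < lam by exact: exprn_gt0.
pose L := lam `^ (a - 1) / (3 * N).
have L0 : 0 < L by rewrite divr_gt0 ?powR_gt0// mulr_gt0.
have Li0 : 0 < L^-1 by rewrite invr_gt0.
pose Cn i : set (Rn R n) := [set y | normRn y <= N * `|tnth y i : R|].
have mCn i : measurable (Cn i).
  rewrite (_ : Cn i = (fun y => N * `|tnth y i : R| - normRn y) @^-1` `[0, +oo[%classic); last first.
    by apply/seteqP; split => y /=; rewrite in_itv/= andbT subr_ge0.
  rewrite -[X in measurable X]setTI.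
  have mf : measurable_fun [set: Rn R n] (fun y => N * `|tnth y i : R| - normRn y).
    apply: measurable_funB; last exact: measurable_normRn.
    apply: measurable_funM; first exact: measurable_cst.
    by apply: measurableT_comp => //; exact: measurable_tnth.
  exact: mf.
have mA := @measurable_annRn R n j.
have mker : measurable_fun [set: Rn R n] (fun y => dispker a (x, y)).
  exact: (measurableT_comp (measurable_dispker a) (measurable_pair1 x)).
have k0 y : 0 <= dispker a (x, y) by rewrite mulr_ge0 ?poisson_ge0 ?poissonRn_ge0.
pose g i y := \1_(annRn j `&` Cn i) y * dispker a (x, y).
have mg i : measurable_fun [set: Rn R n] (fun y => (g i y)%:E).
  apply/measurable_EFinP; apply: measurable_funM => //; apply: measurable_indic; exact: measurableI.
have g0 i y : (0 <= (g i y)%:E)%E by rewrite lee_fin mulr_ge0.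
apply: (@le_trans _ _ (\int[mu n]_y (\sum_(i < n) (g i y)%:E))%E).
  apply: ge0_le_integral => //.
  - by move=> y _; rewrite lee_fin mulr_ge0.
  - by apply/measurable_EFinP; apply: measurable_funM => //; exact: measurable_indic.
  - by apply: emeasurable_sum => i; exact: mg.
  move=> y _; have [i hi] := cone_cover y; rewrite sumEFin lee_fin.
  apply: (@le_trans _ _ (g i y)); last first.
    by rewrite (bigD1 i)//= lerDl sumr_ge0// => k _; rewrite mulr_ge0.
  by rewrite /g ler_wpM2r// !indicE in_setI (mem_set hi : y \in Cn i) andbT.
rewrite ge0_integral_sum//.
have main i : (\int[mu n]_y (g i y)%:E <= (2 * (3 * N) * (4 * pi) * (2 * pi) ^+ m * lam `^ (1 - a))%:E)%E.
  rewrite (ge0_integral_insert i (mg i) (g0 i)).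
  pose x' : Rn R m := [tuple (tnth x (lift i k) : R) | k < m].
  pose rho := normRn x; pose u0 (y : Rn R m) := Num.sqrt (Num.max (rho ^+ 2 - dotRn y y) 0).
  have P0 y : 0 <= poissonRn 1 (subRn x' y) by exact: poissonRn_ge0.
  have PE u (y : Rn R m) : poissonRn 1 (subRn x (insert_Rn i u y)) = poisson 1 (tnth x i - u) * poissonRn 1 (subRn x' y).
    rewrite {1}/poissonRn (bigD1_ord i)//= tnth_mktuple tnth_insert; congr (_ * _).
    by apply: eq_bigr => k _; rewrite !tnth_mktuple; congr (poisson _ (_ - _)); rewrite liftK.
  have pw u (y : Rn R m) : g i (insert_Rn i u y) <= 2 * L^-1 * poissonRn 1 (subRn x' y) *
      (poisson L^-1 (u - u0 y) + poisson L^-1 (u - - u0 y)).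
    rewrite /g indicE; case: (boolP (_ \in _)) => [|_]; last first.
      by rewrite mul0r !mulr_ge0 ?addr_ge0 ?poisson_ge0 ?(ltW Li0).
    rewrite inE mul1r => -[/andP[X1 X2] XN].
    rewrite /Cn /= tnth_insert in XN.
    have /andP[x1 x2] := xj.
    have rX : rho <= 2 * normRn (insert_Rn i u y).
      by apply: le_trans (ltW x2) _; rewrite exprS ler_wpM2l.
    have H := poisson_radius a1 l0 x1 X1 rX (dotRn_ge0 y) (sqr_normRn_insert i u y) N0 XN (erefl L) (erefl (u0 y)).
    rewrite /dispker /= PE.
    (* The spatial kernel in the i-th coordinate is given away as a bound 2; integrability in that
       direction comes from the dispersive factor. *)
    have q2 : poisson (1 : R) (tnth x i - u) <= 2.
      by rewrite /poisson mulr1 expr1n ler_pdivrMr ?ltr_wpDr ?sqr_ge0// ler_peMr// lerDl sqr_ge0.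
    have A0 (v : R) : 0 <= poisson 1 v by exact: poisson_ge0.
    rewrite (_ : 2 * L^-1 * _ * _ = (L^-1 * (poisson L^-1 (u - u0 y) + poisson L^-1 (u - - u0 y))) *
      (2 * poissonRn 1 (subRn x' y))); last by ring.
    by apply: ler_pM => //; [exact: mulr_ge0|rewrite ler_wpM2r].
  have mp (v : R) : measurable_fun [set: R] (fun u : R => (poisson L^-1 (u - v))%:E).
    by apply/measurable_EFinP; exact: measurable_poissonB.
  have inner (y : Rn R m) : (\int[mu1]_u (g i (insert_Rn i u y))%:E <=
      (2 * L^-1 * (4 * pi))%:E * (poissonRn 1 (subRn x' y))%:E)%E.
    have mD : measurable_fun [set: R] (fun u : R => (poisson L^-1 (u - u0 y))%:E + (poisson L^-1 (u - - u0 y))%:E)%E.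
      exact: (emeasurable_funD (mp _) (mp _)).
    have c0 : 0 <= 2 * L^-1 * poissonRn 1 (subRn x' y) by rewrite !mulr_ge0// ltW.
    apply: (@le_trans _ _ (\int[mu1]_u ((2 * L^-1 * poissonRn 1 (subRn x' y))%:E *
       ((poisson L^-1 (u - u0 y))%:E + (poisson L^-1 (u - - u0 y))%:E)))%E).
      apply: ge0_le_integral => //.
      - have mi := @measurable_insert R m i.
        exact: (measurableT_comp (mg i) (measurableT_comp mi (measurable_pair2 y))).
      - exact: (emeasurable_funM (measurable_cst _) mD).
      - by move=> u _; rewrite -EFinD -EFinM lee_fin.
    rewrite ge0_integralZl//; first last.
    - by move=> u _; rewrite -EFinD lee_fin addr_ge0// poisson_ge0// ltW.
    rewrite ge0_integralD//; first last.
    - exact: mp.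
    - by move=> u _; rewrite lee_fin poisson_ge0// ltW.
    - exact: mp.
    - by move=> u _; rewrite lee_fin poisson_ge0// ltW.
    apply: (le_trans (lee_wpmul2l _ (leeD (integral_poisson_le _ Li0) (integral_poisson_le _ Li0)))) => //.
    by rewrite -EFinD -!EFinM lee_fin le_eqVlt; apply/orP; left; apply/eqP; ring.
  have mP : measurable_fun [set: Rn R m] (fun y : Rn R m => (poissonRn 1 (subRn x' y))%:E).
    apply/measurable_EFinP.
    have ms : measurable_fun setT (fun y : Rn R m => subRn x' y).
      by apply: measurable_subRn; [exact: measurable_cst|exact: measurable_id].
    have mp' : measurable_fun [set: Rn R m] (@poissonRn R 1 m) by exact: measurable_poissonRn.
    exact: (measurableT_comp mp' ms).
  have K0 : 0 <= 2 * L^-1 * (4 * pi) by rewrite !mulr_ge0// ltW.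
  apply: (@le_trans _ _ (\int[mu m]_y ((2 * L^-1 * (4 * pi))%:E * (poissonRn 1 (subRn x' y))%:E))%E).
    apply: ge0_le_integral => //.
    - by move=> y _; apply: integral_ge0 => u _; exact: g0.
    - have mi := @measurable_insert R m i.
      apply: (@measurable_fun_fubini_tonelli_G _ _ _ _ R mu1 (fun z => (g i (insert_Rn i z.1 z.2))%:E)).
        exact: (measurableT_comp (mg i) mi).
      by move=> z; exact: g0.
    - exact: emeasurable_funM.
  rewrite ge0_integralZl//; last by move=> y _; rewrite lee_fin.
  apply: (le_trans (lee_wpmul2l _ (integral_poissonRn_le _ ltr01))) => //.
  rewrite -EFinM lee_fin le_eqVlt; apply/orP; left; apply/eqP.
  rewrite /L (_ : 1 - a = - (a - 1)); last by ring.
  by rewrite powRN; field; rewrite !gt_eqF// powR_gt0.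
apply: (@le_trans _ _ (\sum_(i < n) (2 * (3 * N) * (4 * pi) * (2 * pi) ^+ m * lam `^ (1 - a))%:E)%E).
  by apply: lee_sum => i _.
rewrite sumEFin sumr_const card_ord lee_fin le_eqVlt; apply/orP; left; apply/eqP.
by rewrite -[LHS]mulr_natl; ring.
Qed.

End schur_kernel_Rn.

Section propagator.
Context (R : realType) (n : nat).
Local Notation mu := (lebesgue_measure_Rn R n).
Local Notation mu1 := (@lebesgue_measure R).
Local Open Scope complex_scope.
Implicit Types (F G : Rn R n -> R[i]) (a t : R) (x xi : Rn R n).

Definition cinv : R := (2 * pi) ^- n.

(* The solution with (integrable) data of Fourier transform [F]. *)
Definition propag a F t x : R[i] := gft 1 cinv (fun xi => expi (t * normRn xi `^ a) * F xi) x.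

Lemma cmeas_propag_phase a t : cmeas (fun xi : Rn R n => expi (t * normRn xi `^ a)).
Proof.
by apply: cmeas_expi; apply: measurable_funM; [exact: measurable_cst|exact: measurable_normRn_powR].
Qed.

Definition propag_phase a (z : R * Rn R n) xi : R := dotRn z.2 xi + z.1 * normRn xi `^ a.

Lemma cintegrable_propag a t F : cintegrable F -> cintegrable (fun xi => expi (t * normRn xi `^ a) * F xi).
Proof.
move=> Fi; apply: (cintegrable_phase (ph := fun xi => t * normRn xi `^ a) _ Fi).
by apply: measurable_funM; [exact: measurable_cst|exact: measurable_normRn_powR].
Qed.

Lemma propagE a F t x : propag a F t x =
  cinv%:C * cintegral (fun xi => expi (dotRn x xi + t * normRn xi `^ a) * F xi).
Proof.
rewrite /propag /gft; congr (_ * _); congr cintegral; apply/funext => xi.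
by rewrite mul1r expiD mulrA.
Qed.

Lemma measurable_propag_phase a : measurable_fun [set: (measurableTypeR R * Rn R n) * Rn R n]
  (fun z => propag_phase a z.1 z.2).
Proof.
apply: measurable_funD.
  apply: measurable_dotRn; last exact: measurable_snd.
  exact: (measurableT_comp measurable_snd measurable_fst).
apply: measurable_funM.
  exact: (measurableT_comp measurable_fst measurable_fst).
exact: (measurableT_comp (measurable_normRn_powR a (k := n)) measurable_snd).
Qed.

Lemma cmeas_propag2 a F : cintegrable F ->
  cmeas (fun z : measurableTypeR R * Rn R n => propag a F z.1 z.2).
Proof.
move=> Fi; under eq_fun do rewrite propagE.
by apply: cmeasM; [exact: cmeas_cst|exact: (measurable_cintegral_phase (measurable_propag_phase a) Fi)].
Qed.

Lemma cmeas_propag a F t : cintegrable F -> cmeas (propag a F t).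
Proof.
by move=> Fi; have [mU _] := @gft_bnd R n 1 cinv _ (expr1n _ _) (cintegrable_propag a t Fi).
Qed.

Lemma N2_propag a F t : cintegrable F -> (N2 mu (propag a F t) <= (gftC n cinv)%:E * N2 mu F)%E.
Proof.
move=> Fi; have [_ h] := @gft_bnd R n 1 cinv _ (expr1n _ _) (cintegrable_propag a t Fi).
apply: le_trans h _; rewrite (@eq_N2 _ _ _ mu _ F)// => xi; exact: sqn_expiM.
Qed.

End propagator.

Section local_smoothing.
Context (R : realType) (m : nat).
Local Notation n := m.+1.
Local Notation mu := (lebesgue_measure_Rn R n).
Local Notation mu1 := (@lebesgue_measure R).
Local Open Scope complex_scope.
Implicit Types (F G : Rn R n -> R[i]) (a t : R).

Lemma poissonRn_cons e k (u : R) (v : Rn R k) : poissonRn e (cons_Rn (u, v)) = poisson e u * poissonRn e v.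
Proof.
rewrite /poissonRn big_ord_recl; congr (_ * _).
by apply: eq_bigr => i _; rewrite tnthS.
Qed.

Lemma subRn_cons k (u u' : R) (v v' : Rn R k) :
  subRn (cons_Rn (u, v)) (cons_Rn (u', v')) = cons_Rn (u - u', subRn v v').
Proof.
apply: eq_from_tnth => i; rewrite tnth_mktuple.
by have [k' ->|->] := unliftP ord0 i; rewrite ?tnthS ?tnth_mktuple.
Qed.

Lemma dispkerC a (x y : Rn R n) : dispker a (x, y) = dispker a (y, x).
Proof.
have E (u v : R) : poisson (1 : R) (u - v) = poisson 1 (v - u).
  by rewrite /poisson -(sqrrN (u - v)) opprB.
by rewrite /dispker/= E (poissonRn_subC 1 x y).
Qed.

(** Time is treated as the first coordinate of a point of R^(n+1) with frequency (|xi|^a, xi). The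
    weight is then [expwRn 1] in n+1 dimensions, its transform is [dispker], and TT* with
    [dispker_schur] applies. *)
Lemma local_smoothing a : 1 < a -> exists2 C : R, 0 <= C & forall j F, D12 F ->
  (forall xi, ~ annRn j xi -> F xi = 0) ->
  (\int[lebesgue_measure_Rn R n.+1]_X (expwRn 1 X * sqn (propag a F (thead X) (uncons_Rn X).2))%:E <=
    (C * (2 ^+ j) `^ (1 - a))%:E * N2 mu F)%E.
Proof.
move=> a1; have [C C0 hC] := dispker_schur m a1.
have c20 : 0 <= cinv R n ^+ 2 by exact: sqr_ge0.
exists (cinv R n ^+ 2 * (2 * C)); first by rewrite mulr_ge0// mulr_ge0.
move=> j F [Fi F2] FA.
pose th (X : Rn R n.+1) (xi : Rn R n) := dotRn X (cons_Rn (normRn xi `^ a, xi)).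
have mc : measurable_fun setT (fun xi : Rn R n => cons_Rn (normRn xi `^ a, xi)).
  apply: (measurableT_comp (@measurable_cons_Rn R n)).
  by apply/measurable_fun_pairP; split; [exact: measurable_normRn_powR|exact: measurable_id].
have mth : measurable_fun setT (fun z : Rn R n.+1 * Rn R n => th z.1 z.2).
  by apply: measurable_dotRn; [exact: measurable_fst|exact: (measurableT_comp mc measurable_snd)].
have hT := @TTstar_complex R n _ _ (lebesgue_measure_Rn R n.+1) (@expwRn R 1 n.+1) th (@dispker R m a).
have L0 : 0 <= C * (2 ^+ j) `^ (1 - a) by rewrite mulr_ge0// powR_ge0.
have key : (\int[lebesgue_measure_Rn R n.+1]_X (expwRn 1 X * sqn (cintegral (fun y => (expi (th X y) * F y)%R)))%:E <=
    (2 * (C * (2 ^+ j) `^ (1 - a)))%:E * N2 mu F)%E.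
  refine (hT _ _ mth (measurable_dispker a) _ _ _ F (annRn j) _ Fi (measurable_annRn j) L0 FA (hC j)).
  - exact: integrable_expwRn.
  - by move=> X; exact: expwRn_ge0.
  - by move=> z; rewrite mulr_ge0 ?poisson_ge0 ?poissonRn_ge0.
  - exact: dispkerC.
  - move=> [x y] /=.
    have -> : dispker a (x, y) = poissonRn 1 (subRn (cons_Rn (normRn x `^ a, x)) (cons_Rn (normRn y `^ a, y))).
      by rewrite subRn_cons poissonRn_cons.
    have [<- _] := @Rintegral_expwRn_trig R 1 n.+1 (subRn (cons_Rn (normRn x `^ a, x)) (cons_Rn (normRn y `^ a, y))) ltr01.
    by apply: eq_Rintegral => X _; rewrite dotRn_subr.
have E : (\int[lebesgue_measure_Rn R n.+1]_X (expwRn 1 X * sqn (propag a F (thead X) (uncons_Rn X).2))%:E =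
   \int[lebesgue_measure_Rn R n.+1]_X ((cinv R n ^+ 2)%:E * (expwRn 1 X * sqn (cintegral (fun y => (expi (th X y) * F y)%R)))%:E))%E.
  apply: eq_integral => X _; rewrite -EFinM; congr EFin.
  rewrite propagE sqnM sqn_real mulrCA; congr (_ * (_ * sqn (cintegral _))).
  apply/funext => xi; congr (expi _ * _).
  transitivity (dotRn (cons_Rn (uncons_Rn X)) (cons_Rn (normRn xi `^ a, xi))); last by rewrite uncons_RnK.
  by rewrite [RHS]dotRn_cons addrC.
rewrite E ge0_integralZl//; last 2 first.
- apply/measurable_EFinP; apply: measurable_funM; first exact: measurable_expwRn.
  by apply: measurable_sqn; exact: (measurable_cintegral_phase mth Fi).
- by move=> X _; rewrite lee_fin mulr_ge0 ?expwRn_ge0 ?sqn_ge0.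
apply: le_trans (lee_wpmul2l _ key) _; first by rewrite lee_fin.
by rewrite muleA -EFinM !mulrA.
Qed.

(** On [0, 1] the time weight is at least e^(-1), whence the factor [expR 1]. *)
Lemma local_smoothing_strip a : 1 < a -> exists2 C : R, 0 <= C & forall j F, D12 F ->
  (forall xi, ~ annRn j xi -> F xi = 0) ->
  (\int[mu]_x \int[mu1]_(t in `[0%R, 1%R]) (expwRn 1 x * sqn (propag a F t x))%:E <=
    (C * (2 ^+ j) `^ (1 - a))%:E * N2 mu F)%E.
Proof.
move=> a1; have [C C0 hC] := local_smoothing a1.
exists (expR 1 * C); first by rewrite mulr_ge0// expR_ge0.
move=> j F DF FA; have [Fi F2] := DF.
have mp : measurable_fun [set: measurableTypeR R * Rn R n] (fun z => sqn (propag a F z.1 z.2)).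
  by apply: measurable_sqn; exact: cmeas_propag2.
have mw : measurable_fun [set: measurableTypeR R * Rn R n] (fun z => expwRn (1 : R) z.2).
  exact: (measurableT_comp (measurable_expwRn 1 (n := n)) measurable_snd).
have mw1 : measurable_fun [set: measurableTypeR R * Rn R n] (fun z => expw (1 : R) z.1).
  exact: (measurableT_comp (measurable_expw 1) measurable_fst).
pose gL (z : measurableTypeR R * Rn R n) := \1_(`[0, 1]%classic : set R) z.1 * (expwRn 1 z.2 * sqn (propag a F z.1 z.2)).
pose gR (z : measurableTypeR R * Rn R n) := expR 1 * (expw 1 z.1 * expwRn 1 z.2 * sqn (propag a F z.1 z.2)).
have mgL : measurable_fun setT gL.
  apply: measurable_funM; last exact: measurable_funM.
  have mi : measurable_fun [set: measurableTypeR R] (\1_(`[0, 1]%classic : set R) : R -> R).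
    by apply: measurable_indic; exact: (@measurable_itv R `[0, 1]).
  exact: (measurableT_comp mi measurable_fst).
have mgR : measurable_fun setT gR.
  by apply: measurable_funM; [exact: measurable_cst|apply: measurable_funM => //; exact: measurable_funM].
have gL0 z : 0 <= gL z by rewrite mulr_ge0 ?mulr_ge0 ?expwRn_ge0 ?sqn_ge0.
have gR0 z : 0 <= gR z by rewrite mulr_ge0 ?expR_ge0// !mulr_ge0 ?expw_ge0 ?expwRn_ge0 ?sqn_ge0.
have gLR z : gL z <= gR z.
  rewrite /gL /gR -mulrA mulrA; have S0 : 0 <= expwRn 1 z.2 * sqn (propag a F z.1 z.2) by rewrite mulr_ge0 ?expwRn_ge0 ?sqn_ge0.
  rewrite ler_wpM2r// indicE; case: (boolP (_ \in _)) => [|_]; last by rewrite mulr_ge0 ?expR_ge0 ?expw_ge0.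
  rewrite inE /= in_itv/= => /andP[z0 z1].
  by rewrite /expw mul1r -expRD -[leLHS]expR0 ler_expR ger0_norm// subr_ge0.
apply: (@le_trans _ _ ((expR 1)%:E * \int[lebesgue_measure_Rn R n.+1]_X (expwRn 1 X * sqn (propag a F (thead X) (uncons_Rn X).2))%:E)%E).
  have mX : measurable_fun [set: Rn R n.+1] (fun X => (expwRn 1 X * sqn (propag a F (thead X) (uncons_Rn X).2))%:E).
    apply/measurable_EFinP; apply: measurable_funM; first exact: measurable_expwRn.
    exact: (measurableT_comp mp (@measurable_uncons_Rn R n)).
  rewrite -ge0_integralZl//; last by move=> X _; rewrite lee_fin mulr_ge0 ?expwRn_ge0 ?sqn_ge0.
  rewrite [leRHS]ge0_integral_consC; last 2 first.
  - exact: (emeasurable_funM (measurable_cst _) mX).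
  - by move=> X; rewrite -EFinM lee_fin !mulr_ge0 ?expR_ge0 ?expwRn_ge0 ?sqn_ge0.
  apply: (@le_trans _ _ (\int[mu]_x \int[mu1]_t (gL (t, x))%:E)%E).
    rewrite le_eqVlt; apply/orP; left; apply/eqP; apply: eq_integral => x _.
    rewrite [LHS]integral_mkcond; apply: eq_integral => t _.
    by rewrite patchE /gL indicE /=; case: (t \in _); rewrite ?mul1r ?mul0r.
  have mGL : measurable_fun [set: measurableTypeR R * Rn R n] (fun z => (gL z)%:E) by exact/measurable_EFinP.
  have mGR : measurable_fun [set: measurableTypeR R * Rn R n] (fun z => (gR z)%:E) by exact/measurable_EFinP.
  apply: (@le_trans _ _ (\int[mu]_x \int[mu1]_t (gR (t, x))%:E)%E); last first.
    rewrite le_eqVlt; apply/orP; left; apply/eqP; apply: eq_integral => x _; apply: eq_integral => t _.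
    by rewrite -EFinM /gR/= expwRn_cons; congr (_ * (_ * sqn (propag a F _ _)))%:E; apply/val_inj.
  apply: ge0_le_integral => //.
  - by move=> x _; apply: integral_ge0 => t _; rewrite lee_fin.
  - by apply: (@measurable_fun_fubini_tonelli_G _ _ _ _ R mu1 (fun z => (gL z)%:E)) => // z; rewrite lee_fin.
  - by apply: (@measurable_fun_fubini_tonelli_G _ _ _ _ R mu1 (fun z => (gR z)%:E)) => // z; rewrite lee_fin.
  move=> x _; apply: ge0_le_integral => //.
  - by move=> t _; rewrite lee_fin.
  - exact: (measurableT_comp mGL (measurable_pair2 x)).
  - exact: (measurableT_comp mGR (measurable_pair2 x)).
  - by move=> t _; rewrite lee_fin.
apply: le_trans (lee_wpmul2l _ (hC j F DF FA)) _; first by rewrite lee_fin expR_ge0.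
by rewrite muleA -EFinM mulrA.
Qed.

End local_smoothing.

(** * A one-dimensional Sobolev inequality in time *)

Section sobolev.
Context (R : realType).
Local Notation mu1 := (@lebesgue_measure R).
Variables (f f' : R -> R).
Hypothesis df : forall u : R, is_derive u 1 f (f' u).
Hypothesis cf' : continuous f'.

Let cf : continuous f.
Proof. by move=> u; apply: differentiable_continuous; apply/derivable1_diffP; case: (df u). Qed.

Let mf (D : set R) : measurable D -> measurable_fun D f.
Proof. by move=> mD; apply: measurable_funTS; exact: continuous_measurable_fun. Qed.

Let mf' (D : set R) : measurable D -> measurable_fun D f'.
Proof. by move=> mD; apply: measurable_funTS; exact: continuous_measurable_fun. Qed.

Let q l u := l^-1 * f u ^+ 2 + l * f' u ^+ 2.

Let q0 l u : 0 < l -> 0 <= q l u.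
Proof. by move=> l0; rewrite addr_ge0// mulr_ge0 ?sqr_ge0 ?invr_ge0 ?(ltW l0). Qed.

Let mq l (D : set R) : measurable D -> measurable_fun D (fun u => (q l u)%:E).
Proof.
move=> mD; apply/measurable_EFinP; apply: measurable_funD; apply: measurable_funM => //;
  apply: measurable_funX; [exact: mf|exact: mf'].
Qed.

(** The derivative of f^2 is 2 f f', and 2|f f'| <= f^2 / l + l f'^2. *)
Let sqr_osc l (a b : R) : 0 < l -> a < b ->
  (`|f b ^+ 2 - f a ^+ 2|%:E <= \int[mu1]_(u in `[a, b]) (q l u)%:E)%E.
Proof.
move=> l0 ab; pose g u := 2 * (f u * f' u).
have mI : measurable (`[a, b]%classic : set R) by exact: measurable_itv.
have dg (u : R) : is_derive u 1 (fun u : R => f u ^+ 2) (g u).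
  rewrite (_ : (fun u : R => f u ^+ 2) = f * f); last by apply/funext => v; rewrite expr2.
  have d2 := is_deriveM (df u) (df u).
  by apply: (is_derive_eq d2); rewrite /g /GRing.scale/=; ring.
have E : (\int[mu1]_(u in `[a, b]) (g u)%:E = (f b ^+ 2 - f a ^+ 2)%:E)%E.
  rewrite (@continuous_FTC2 _ _ (fun u => f u ^+ 2))//.
  - apply: continuous_subspaceT => u; apply: cvgM; first exact: cvg_cst.
    by apply: cvgM; [exact: cf|exact: cf'].
  - have c2 u : {for u, continuous (fun u => f u ^+ 2)}.
      by apply: differentiable_continuous; apply/derivable1_diffP; case: (dg u).
    split; first by move=> u _; case: (dg u).
      by apply: cvg_at_right_filter; exact: c2.
    by apply: cvg_at_left_filter; exact: c2.
  - by move=> u _; rewrite derive1E; case: (dg u).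
have mg : measurable_fun (`[a, b]%classic : set R) (fun u => (g u)%:E).
  by apply/measurable_EFinP; apply: measurable_funM => //; apply: measurable_funM; [exact: mf|exact: mf'].
rewrite -abse_EFin -E; have H := le_abse_integral mu1 mI mg; apply: (le_trans H) => {H}.
apply: ge0_le_integral => //.
- exact: measurableT_comp.
- exact: mq.
move=> u _; rewrite abse_EFin lee_fin /g /q.
have li : l * l^-1 = 1 by rewrite mulfV// gt_eqF.
have l1 : 0 < l^-1 by rewrite invr_gt0.
rewrite normrM (ger0_norm (ler0n _ 2)) normrM -(real_normK (num_real (f u))) -(real_normK (num_real (f' u))).
have := normr_ge0 (f u); have := normr_ge0 (f' u); move: `|f u| `|f' u| => x y y0 x0.
have : 0 <= l^-1 * (x - l * y) ^+ 2 by rewrite mulr_ge0 ?sqr_ge0// ltW.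
rewrite (_ : l^-1 * (x - l * y) ^+ 2 = l^-1 * x ^+ 2 + l * y ^+ 2 - 2 * (x * y)); first by lra.
by field; rewrite gt_eqF.
Qed.

(** The value at t exceeds the one at any u in an interval I of length l around t by at most the
    oscillation over I; averaging over u in I gives the bound. The average and the oscillation each
    contribute 1/l, hence 2/l. *)
Lemma sobolev_itv (l T t : R) : 0 < l -> l <= T -> 0 <= t -> t <= T ->
  ((f t ^+ 2)%:E <= (2 / l)%:E * \int[mu1]_(u in `[0%R, T]) (f u ^+ 2)%:E +
     l%:E * \int[mu1]_(u in `[0%R, T]) (f' u ^+ 2)%:E)%E.
Proof.
move=> l0 lT t0 tT.
(* I = [al, al + l] starts at t unless it would leave [0, T], in which case it ends at T. *)
pose al := Num.min t (T - l); pose I : set R := `[al, al + l]%classic.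
have al0 : 0 <= al by rewrite le_min t0 subr_ge0.
have alT : al + l <= T by rewrite -lerBrDr ge_min lexx orbT.
have alt : al <= t by rewrite ge_min lexx.
have tal : t <= al + l.
  by rewrite /al; case: (leP t (T - l)) => h; [rewrite lerDl ltW|rewrite subrK].
have mI : measurable I by exact: measurable_itv.
have It : I t by rewrite /I/= in_itv/= alt tal.
have II : I `<=` `[0, T]%classic.
  move=> u; rewrite /I/= !in_itv/= => /andP[h1 h2].
  by rewrite (le_trans al0 h1) (le_trans h2 alT).
set J := (\int[mu1]_(u in I) (q l u)%:E)%E.
have J0 : (0 <= J)%E by apply: integral_ge0 => u _; rewrite lee_fin q0.
have osc u : I u -> ((f t ^+ 2)%:E <= (f u ^+ 2)%:E + J)%E.
  move=> Iu; have sub (a b : R) : I a -> I b -> (\int[mu1]_(u in `[a, b]) (q l u)%:E <= J)%E.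
    rewrite /I/= !in_itv/= => /andP[a1 a2] /andP[b1 b2].
    apply: ge0_subset_integral => //; [exact: mq|by move=> v _; rewrite lee_fin q0|].
    move=> v; rewrite /I/= !in_itv/= => /andP[v1 v2].
    by rewrite (le_trans a1 v1) (le_trans v2 b2).
  have [ut|tu|->] := ltgtP u t.
  - apply: (@le_trans _ _ ((f u ^+ 2)%:E + `|f t ^+ 2 - f u ^+ 2|%:E)%E).
      by rewrite -EFinD lee_fin -lerBlDl ler_norm.
    by rewrite leeD2l//; apply: le_trans (sqr_osc l0 ut) _; exact: sub.
  - apply: (@le_trans _ _ ((f u ^+ 2)%:E + `|f u ^+ 2 - f t ^+ 2|%:E)%E).
      by rewrite -EFinD lee_fin -lerBlDl distrC ler_norm.
    by rewrite leeD2l//; apply: le_trans (sqr_osc l0 tu) _; exact: sub.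
  - by rewrite leeDl.
have muI : mu1 I = l%:E.
  rewrite /I lebesgue_measure_itv/= lte_fin ltrDl l0 -EFinB; congr EFin; ring.
set A := (\int[mu1]_(u in I) (f u ^+ 2)%:E)%E.
set B := (\int[mu1]_(u in I) (f' u ^+ 2)%:E)%E.
have A0 : (0 <= A)%E by apply: integral_ge0 => u _; rewrite lee_fin sqr_ge0.
have B0 : (0 <= B)%E by apply: integral_ge0 => u _; rewrite lee_fin sqr_ge0.
have mf2 : measurable_fun I (fun u => (f u ^+ 2)%:E).
  by apply/measurable_EFinP; apply: measurable_funX; exact: mf.
have mf'2 : measurable_fun I (fun u => (f' u ^+ 2)%:E).
  by apply/measurable_EFinP; apply: measurable_funX; exact: mf'.
have JE : (J = l^-1%:E * A + l%:E * B)%E.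
  rewrite /J /q; under eq_integral do rewrite EFinD !EFinM.
  rewrite ge0_integralD//; first last.
  - by apply: emeasurable_funM => //; exact: measurable_cst.
  - by move=> u _; rewrite -EFinM lee_fin mulr_ge0 ?sqr_ge0 ?(ltW l0).
  - by apply: emeasurable_funM => //; exact: measurable_cst.
  - by move=> u _; rewrite -EFinM lee_fin mulr_ge0 ?sqr_ge0 ?invr_ge0 ?(ltW l0).
  by congr (_ + _)%E; rewrite ge0_integralZl// ?lee_fin ?invr_ge0 ?(ltW l0)// => u _; rewrite lee_fin sqr_ge0.
have C z : (\int[mu1]_(u in I) z = l%:E * z)%E.
  by rewrite integral_cst//= muleC; congr (_ * _)%E; exact: muI.
have main : (l%:E * (f t ^+ 2)%:E <= A + l%:E * J)%E.
  have -> : (l%:E * (f t ^+ 2)%:E = \int[mu1]_(u in I) (f t ^+ 2)%:E)%E.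
    by rewrite C.
  have -> : (A + l%:E * J = \int[mu1]_(u in I) ((f u ^+ 2)%:E + J))%E.
    rewrite ge0_integralD//; last by move=> u _; rewrite lee_fin sqr_ge0.
    by rewrite C.
  apply: ge0_le_integral => //.
  - by move=> u _; rewrite lee_fin sqr_ge0.
  - by apply: emeasurable_funD => //; exact: measurable_cst.
have : ((f t ^+ 2)%:E <= (2 / l)%:E * A + l%:E * B)%E.
  have := lee_wpmul2l (_ : 0 <= l^-1%:E)%E main; rewrite lee_fin invr_ge0 (ltW l0) => /(_ isT).
  have ll : (l^-1%:E * l%:E = 1)%E by rewrite -EFinM mulVf ?gt_eqF.
  rewrite muleA ll mul1e => /le_trans; apply.
  rewrite ge0_muleDr ?mule_ge0 ?lee_fin ?(ltW l0)// muleA ll mul1e.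
  rewrite JE addeA -ge0_muleDl ?lee_fin ?invr_ge0 ?(ltW l0)// -EFinD.
  by rewrite (_ : 2 / l = l^-1 + l^-1)//; field; rewrite gt_eqF.
move=> h; apply: (le_trans h); apply: leeD; rewrite lee_wpmul2l ?lee_fin ?divr_ge0 ?(ltW l0)//.
- apply: ge0_subset_integral => //; last by move=> u _; rewrite lee_fin sqr_ge0.
  by apply/measurable_EFinP; apply: measurable_funX; exact: mf.
- apply: ge0_subset_integral => //; last by move=> u _; rewrite lee_fin sqr_ge0.
  by apply/measurable_EFinP; apply: measurable_funX; exact: mf'.
Qed.

End sobolev.

Section oscillatory_derivative.
Context (R : realType) d (Y : measurableType d) (m : {measure set Y -> \bar R}).
Variables (th w : Y -> R).
Hypotheses (mth : measurable_fun setT th) (mw : measurable_fun setT w).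

Let mph t : measurable_fun setT (fun y => th y + t * w y).
Proof. by apply: measurable_funD => //; apply: measurable_funM => //; exact: measurable_cst. Qed.

Lemma continuous_osc (K : Y -> R) (c : R -> R) : m.-integrable setT (EFin \o K) -> continuous c ->
  (forall u, `|c u| <= 1) -> continuous (fun t : R => \int[m]_y (K y * c (th y + t * w y))).
Proof.
move=> Ki cc c1 t.
have mc : measurable_fun [set: R] c by exact: continuous_measurable_fun.
have Ii x : m.-integrable setT (EFin \o (fun y => K y * c (th y + x * w y))).
  by apply: (integrable_mul1 Ki (measurableT_comp mc (mph x))) => y; exact: c1.
apply: (@continuity_under_integral R _ Y m (fun x y => K y * c (th y + x * w y)) setT measurableT (t - 1) (t + 1) _ _ (fun y => `|K y|)).
- by move=> x _; exact: Ii.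
- apply: aeW => y _ x _; apply: cvgM; first exact: cvg_cst.
  apply: continuous_cvg; first exact: cc.
  by apply: cvgD; [exact: cvg_cst|apply: cvgM; [exact: cvg_id|exact: cvg_cst]].
- exact: integrable_norm.
- by move=> x _; apply: aeW => y _; rewrite normrM ler_piMr.
- by apply/mem_set; rewrite /= in_itv/= ltrBlDr ltrDl ltr01.
Qed.

(** Differentiation under the integral, dominated by |w H|; the interval ]t - 1, t + 1[ merely
    serves as a neighbourhood of t. *)
Lemma is_derive_osc (H : Y -> R) (c c' : R -> R) (t : R) :
  m.-integrable setT (EFin \o H) -> m.-integrable setT (EFin \o (fun y => w y * H y)) ->
  (forall u : R, is_derive u 1 c (c' u)) -> (forall u, `|c u| <= 1) -> (forall u, `|c' u| <= 1) ->
  is_derive t 1 (fun t => \int[m]_y (H y * c (th y + t * w y))) (\int[m]_y (w y * H y * c' (th y + t * w y))).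
Proof.
move=> Hi wHi dc c1 c'1.
pose f x y := H y * c (th y + x * w y).
have cc : continuous c by move=> u; apply: differentiable_continuous; apply/derivable1_diffP; case: (dc u).
have mc : measurable_fun [set: R] c by exact: continuous_measurable_fun.
have Ii x : m.-integrable setT (EFin \o f x).
  by apply: (integrable_mul1 Hi (measurableT_comp mc (mph x))) => y; exact: c1.
have dfy (x : R) y : is_derive x 1 (f ^~ y) (w y * H y * c' (th y + x * w y)).
  have d1 : is_derive x 1 (fun x => th y + x * w y) (w y).
    by apply: is_derive_eq; rewrite /GRing.scale/=; ring.
  have d2 := @is_derive1_comp _ c (fun x => th y + x * w y) x _ _ (dc _) d1.
  have d3 : is_derive x 1 (f ^~ y) (H y *: (c' (th y + x * w y) * w y)).
    exact: (@is_deriveZ _ _ _ (c \o (fun x => th y + x * w y)) (H y)).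
  by apply: (is_derive_eq d3); rewrite /GRing.scale/=; ring.
have p1 x y : partial1of2 f x y = w y * H y * c' (th y + x * w y).
  by rewrite partial1of2E; case: (dfy x y).
have tI : (`]t - 1, t + 1[%classic : set R) t by rewrite /= in_itv/= ltrBlDr ltrDl ltr01.
have gub x y : (`]t - 1, t + 1[%classic : set R) x -> [set: Y] y -> `|partial1of2 f x y| <= `|w y * H y|.
  by move=> _ _; rewrite p1 normrM ler_piMr.
have h1 := @derivable_under_integral R _ Y m f setT measurableT t (t - 1) (t + 1) tI
  (fun x _ => Ii x) (fun x y _ _ => let: DeriveDef a _ := dfy x y in a) (fun y => `|w y * H y|)
  (fun y => normr_ge0 _) (integrable_norm wHi) gub.
have h2 := @differentiation_under_integral R _ Y m f setT measurableT t (t - 1) (t + 1) tI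
  (fun x _ => Ii x) (fun x y _ _ => let: DeriveDef a _ := dfy x y in a) (fun y => `|w y * H y|)
  (fun y => normr_ge0 _) (integrable_norm wHi) gub.
apply: DeriveDef; first exact: h1.
by rewrite -derive1E h2; apply: eq_Rintegral => y _; rewrite p1.
Qed.

End oscillatory_derivative.

Section propag_derivative.
Context (R : realType) (n : nat).
Local Notation mu := (lebesgue_measure_Rn R n).
Local Notation mu1 := (@lebesgue_measure R).
Local Open Scope complex_scope.
Implicit Types (F G : Rn R n -> R[i]) (a t : R) (x xi : Rn R n).

(** The multiplier of the time derivative: d/dt of the solution is i times the solution with data
    [wmul a F], so real and imaginary parts are exchanged. *)
Definition wmul a F xi : R[i] := (normRn xi `^ a)%:C * F xi.

Let ph a x t xi := dotRn x xi + t * normRn xi `^ a.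

Let mdot x : measurable_fun setT (fun xi : Rn R n => dotRn x xi).
Proof. by apply: measurable_dotRn; [exact: measurable_cst|exact: measurable_id]. Qed.

Let mph a x t : measurable_fun setT (ph a x t).
Proof.
apply: measurable_funD; first exact: mdot.
by apply: measurable_funM; [exact: measurable_cst|exact: measurable_normRn_powR].
Qed.

Lemma Re_propag a F t x : cintegrable F -> complex.Re (propag a F t x) =
  cinv R n * (\int[mu]_xi (complex.Re (F xi) * cos (dotRn x xi + t * normRn xi `^ a)) -
    \int[mu]_xi (complex.Im (F xi) * sin (dotRn x xi + t * normRn xi `^ a))).
Proof.
move=> Fi; rewrite propagE (cintegral_phase (mph a x t) Fi) ReM/= mul0r subr0.
by [].
Qed.

Lemma Im_propag a F t x : cintegrable F -> complex.Im (propag a F t x) =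
  cinv R n * (\int[mu]_xi (complex.Re (F xi) * sin (dotRn x xi + t * normRn xi `^ a)) +
    \int[mu]_xi (complex.Im (F xi) * cos (dotRn x xi + t * normRn xi `^ a))).
Proof.
move=> Fi; rewrite propagE (cintegral_phase (mph a x t) Fi) ImM/= mul0r addr0.
by [].
Qed.

Lemma Re_wmul a F xi : complex.Re (wmul a F xi) = normRn xi `^ a * complex.Re (F xi).
Proof. by rewrite /wmul ReM/= mul0r subr0. Qed.

Lemma Im_wmul a F xi : complex.Im (wmul a F xi) = normRn xi `^ a * complex.Im (F xi).
Proof. by rewrite /wmul ImM/= mul0r addr0. Qed.

Lemma continuous_propag a F x : cintegrable F ->
  continuous (fun t => complex.Re (propag a F t x)) /\ continuous (fun t => complex.Im (propag a F t x)).
Proof.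
move=> Fi; have [f1 f2] := Fi.
have C K c : mu.-integrable setT (EFin \o K) -> continuous c -> (forall u, `|c u| <= 1) ->
    continuous (fun t : R => \int[mu]_xi (K xi * c (dotRn x xi + t * normRn xi `^ a))).
  exact: (continuous_osc (mdot x) (@measurable_normRn_powR R a n)).
split=> t; under eq_fun do rewrite ?Re_propag ?Im_propag//; rewrite ?Re_propag ?Im_propag//.
  apply: cvgM; first exact: cvg_cst.
  apply: cvgB; [exact: (C _ _ f1 (@continuous_cos R) (@cos_abs1 R))|exact: (C _ _ f2 (@continuous_sin R) (@sin_abs1 R))].
apply: cvgM; first exact: cvg_cst.
apply: cvgD; [exact: (C _ _ f1 (@continuous_sin R) (@sin_abs1 R))|exact: (C _ _ f2 (@continuous_cos R) (@cos_abs1 R))].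
Qed.

Lemma is_derive_propag a F x t : cintegrable F -> cintegrable (wmul a F) ->
  is_derive t 1 (fun t : R => complex.Re (propag a F t x)) (- complex.Im (propag a (wmul a F) t x)) /\
  is_derive t 1 (fun t : R => complex.Im (propag a F t x)) (complex.Re (propag a (wmul a F) t x)).
Proof.
move=> Fi wFi; have [f1 f2] := Fi; have [wf1 wf2] := wFi.
have w1 : mu.-integrable setT (EFin \o (fun xi => normRn xi `^ a * complex.Re (F xi))).
  by apply: eq_integrable wf1 => // xi _; rewrite /= Re_wmul.
have w2 : mu.-integrable setT (EFin \o (fun xi => normRn xi `^ a * complex.Im (F xi))).
  by apply: eq_integrable wf2 => // xi _; rewrite /= Im_wmul.
have D K (c c' : R -> R) : mu.-integrable setT (EFin \o K) ->
    mu.-integrable setT (EFin \o (fun xi => normRn xi `^ a * K xi)) ->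
    (forall u : R, is_derive u 1 c (c' u)) -> (forall u, `|c u| <= 1) -> (forall u, `|c' u| <= 1) ->
    is_derive t 1 (fun t : R => \int[mu]_xi (K xi * c (dotRn x xi + t * normRn xi `^ a)))
      (\int[mu]_xi (normRn xi `^ a * K xi * c' (dotRn x xi + t * normRn xi `^ a))).
  exact: (is_derive_osc (mdot x) (@measurable_normRn_powR R a n)).
have nsin (u : R) : `|- sin u| <= 1 by rewrite normrN; exact: sin_abs1.
have d1 := D _ _ _ f1 w1 (@is_derive_cos R) (@cos_abs1 R) nsin.
have d2 := D _ _ _ f2 w2 (@is_derive_sin R) (@sin_abs1 R) (@cos_abs1 R).
have d3 := D _ _ _ f1 w1 (@is_derive_sin R) (@sin_abs1 R) (@cos_abs1 R).
have d4 := D _ _ _ f2 w2 (@is_derive_cos R) (@cos_abs1 R) nsin.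
have neg K : mu.-integrable setT (EFin \o K) ->
    \int[mu]_xi (K xi * - sin (dotRn x xi + t * normRn xi `^ a)) =
    - \int[mu]_xi (K xi * sin (dotRn x xi + t * normRn xi `^ a)).
  move=> Ki; rewrite -mulN1r -RintegralZl//; first by apply: eq_Rintegral => xi _; rewrite mulrN mulN1r.
  exact: (integrable_mul1 Ki (measurable_sin_comp (mph a x t)) (fun y => sin_abs1 _)).
split.
  rewrite (_ : (fun t : R => _) = (fun t : R => cinv R n * (\int[mu]_xi (complex.Re (F xi) * cos (dotRn x xi + t * normRn xi `^ a)) -
    \int[mu]_xi (complex.Im (F xi) * sin (dotRn x xi + t * normRn xi `^ a))))); last first.
    by apply/funext => u; rewrite Re_propag.
  have dd := @is_deriveZ _ _ _ _ (cinv R n) t 1 _ (is_deriveB d1 d2).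
  apply: (is_derive_eq dd); rewrite Im_propag// neg// /GRing.scale/= -mulrN; congr (_ * _).
  rewrite opprD; congr (- _ - _); apply: eq_Rintegral => xi _; by rewrite ?Re_wmul ?Im_wmul.
rewrite (_ : (fun t : R => _) = (fun t : R => cinv R n * (\int[mu]_xi (complex.Re (F xi) * sin (dotRn x xi + t * normRn xi `^ a)) +
    \int[mu]_xi (complex.Im (F xi) * cos (dotRn x xi + t * normRn xi `^ a))))); last first.
  by apply/funext => u; rewrite Im_propag.
have dd := @is_deriveZ _ _ _ _ (cinv R n) t 1 _ (is_deriveD d3 d4).
apply: (is_derive_eq dd); rewrite Re_propag// neg// /GRing.scale/=; congr (_ * _).
by congr (_ - _); apply: eq_Rintegral => xi _; rewrite ?Re_wmul ?Im_wmul.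
Qed.

Definition timesq a F (T : R) x : \bar R := (\int[mu1]_(t in `[0%R, T]) (sqn (propag a F t x))%:E)%E.

Lemma timesq_ge0 a F T x : (0 <= timesq a F T x)%E.
Proof. by apply: integral_ge0 => t _; rewrite lee_fin sqn_ge0. Qed.

Lemma propag_sobolev a F x (l T t : R) : cintegrable F -> cintegrable (wmul a F) ->
  0 < l -> l <= T -> 0 <= t -> t <= T ->
  ((sqn (propag a F t x))%:E <= (2 / l)%:E * timesq a F T x + l%:E * timesq a (wmul a F) T x)%E.
Proof.
move=> Fi wFi l0 lT t0 tT.
have [c1 c2] := continuous_propag a x wFi.
have [c3 c4] := continuous_propag a x Fi.
have c2' : continuous (fun t => - complex.Im (propag a (wmul a F) t x)).
  by move=> u; apply: cvgN; exact: c2.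
have h1 := sobolev_itv (fun u => (is_derive_propag x u Fi wFi).1) c2' l0 lT t0 tT.
have h2 := sobolev_itv (fun u => (is_derive_propag x u Fi wFi).2) c1 l0 lT t0 tT.
have mI : measurable (`[0%R, T]%classic : set (measurableTypeR R)) by exact: (@measurable_itv R `[0%R, T]).
have add (f g : R -> R) : continuous f -> continuous g ->
    (\int[mu1]_(t in `[0%R, T]) (f t ^+ 2 + g t ^+ 2)%:E =
     \int[mu1]_(t in `[0%R, T]) (f t ^+ 2)%:E + \int[mu1]_(t in `[0%R, T]) (g t ^+ 2)%:E)%E.
  move=> cf cg; under eq_integral do rewrite EFinD.
  have msq (h : R -> R) : continuous h -> measurable_fun (`[0%R, T]%classic : set R) (fun u => (h u ^+ 2)%:E).
    move=> ch; apply/measurable_EFinP; apply: measurable_funX.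
    by apply: measurable_funTS; exact: continuous_measurable_fun.
  rewrite ge0_integralD//; first last.
  - exact: msq.
  - by move=> u _; rewrite lee_fin sqr_ge0.
  - exact: msq.
  - by move=> u _; rewrite lee_fin sqr_ge0.
have nn (f : R -> R) : (0 <= \int[mu1]_(t in `[0%R, T]) (f t ^+ 2)%:E)%E.
  by apply: integral_ge0 => u _; rewrite lee_fin sqr_ge0.
rewrite /timesq /sqn EFinD (add _ _ c3 c4) (add _ _ c1 c2).
(* The indices of the B terms are crossed because the real part has minus an imaginary part as its
   derivative, and conversely. *)
have gen (X1 X2 A1 A2 B1 B2 c e : \bar R) : (0 <= A1 -> 0 <= A2 -> 0 <= B1 -> 0 <= B2 ->
    X1 <= c * A1 + e * B2 -> X2 <= c * A2 + e * B1 -> X1 + X2 <= c * (A1 + A2) + e * (B1 + B2))%E.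
  move=> A10 A20 B10 B20 X1A X2A; rewrite !ge0_muleDr// (addeC (e * B1)%E) addeACA.
  exact: leeD.
apply: gen => //; apply: (le_trans h1); rewrite le_eqVlt; apply/orP; left; apply/eqP.
by congr (_ + _ * _)%E; apply: eq_integral => u _; rewrite sqrrN.
Qed.

Lemma measurable_timesq a F T : cintegrable F -> measurable_fun setT (timesq a F T).
Proof.
move=> Fi.
have mI : measurable (`[0%R, T]%classic : set (measurableTypeR R)) by exact: (@measurable_itv R `[0%R, T]).
pose g (z : measurableTypeR R * Rn R n) := (\1_(`[0, T]%classic : set R) z.1 * sqn (propag a F z.1 z.2))%:E.
have mg : measurable_fun setT g.
  apply/measurable_EFinP; apply: measurable_funM.
    have mi : measurable_fun [set: measurableTypeR R] (\1_(`[0, T]%classic : set R) : R -> R) by exact: measurable_indic.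
    exact: (measurableT_comp mi measurable_fst).
  by apply: measurable_sqn; exact: cmeas_propag2.
rewrite (_ : timesq a F T = fun x => \int[mu1]_t g (t, x))%E.
  apply: (@measurable_fun_fubini_tonelli_G _ _ _ _ R mu1 g) => // z.
  by rewrite lee_fin mulr_ge0 ?sqn_ge0.
apply/funext => x; rewrite /timesq [LHS]integral_mkcond; apply: eq_integral => t _.
by rewrite patchE /g indicE /=; case: (t \in _); rewrite ?mul1r ?mul0r.
Qed.

(** The weight, at most 1, is dropped; after exchanging the integrals, [N2_propag] bounds each time
    slice and the interval contributes its length T. *)
Lemma integral_timesq a F T : cintegrable F -> 0 <= T ->
  (\int[mu]_x ((expwRn 1 x)%:E * timesq a F T x) <= (T * gftC n (cinv R n))%:E * N2 mu F)%E.
Proof.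
move=> Fi T0.
have mI : measurable (`[0%R, T]%classic : set (measurableTypeR R)) by exact: (@measurable_itv R `[0%R, T]).
pose g (z : Rn R n * measurableTypeR R) := (\1_(`[0, T]%classic : set R) z.2 * sqn (propag a F z.2 z.1))%:E.
have mg : measurable_fun setT g.
  apply/measurable_EFinP; apply: measurable_funM.
    have mi : measurable_fun [set: measurableTypeR R] (\1_(`[0, T]%classic : set R) : R -> R) by exact: measurable_indic.
    exact: (measurableT_comp mi measurable_snd).
  apply: measurable_sqn.
  have [h1 h2] := cmeas_propag2 a Fi.
  by split; [exact: (measurableT_comp h1 (@measurable_swap _ _ _ _))|exact: (measurableT_comp h2 (@measurable_swap _ _ _ _))].
have g0 z : (0 <= g z)%E by rewrite lee_fin mulr_ge0 ?sqn_ge0.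
apply: (@le_trans _ _ (\int[mu]_x \int[mu1]_t g (x, t))%E).
  apply: ge0_le_integral => //.
  - by move=> x _; rewrite mule_ge0 ?timesq_ge0// lee_fin expwRn_ge0.
  - apply: emeasurable_funM; last exact: measurable_timesq.
    by apply/measurable_EFinP; exact: measurable_expwRn.
  - by apply: (@measurable_fun_fubini_tonelli_F _ _ _ _ R mu1 g).
  move=> x _; rewrite (_ : (\int[mu1]_t g (x, t))%E = timesq a F T x).
    by rewrite -[leRHS]mul1e lee_wpmul2r ?timesq_ge0// lee_fin expwRn_le1.
  rewrite /timesq [RHS]integral_mkcond; apply: eq_integral => t _.
  by rewrite patchE /g indicE /=; case: (t \in _); rewrite ?mul1r ?mul0r.
have -> : (\int[mu]_x \int[mu1]_t g (x, t) = \int[mu1]_t \int[mu]_x g (x, t))%E.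
  exact: (@fubini_tonelli _ _ _ _ R mu mu1 g mg g0).
set c := ((gftC n (cinv R n))%:E * N2 mu F)%E.
have c0 : (0 <= c)%E by rewrite mule_ge0 ?N2_ge0// lee_fin gftC_ge0.
apply: (@le_trans _ _ (\int[mu1]_t ((\1_(`[0, T]%classic : set R) t)%:E * c))%E).
  apply: ge0_le_integral => //.
  - by move=> t _; apply: integral_ge0 => x _; exact: g0.
  - by apply: (@measurable_fun_fubini_tonelli_G _ _ _ _ R mu g).
  - apply: emeasurable_funM; last exact: measurable_cst.
    by apply/measurable_EFinP; exact: measurable_indic.
  move=> t _; rewrite /g/= indicE; case: (t \in _).
    by rewrite mul1e; apply: le_trans (N2_propag a t Fi); rewrite le_eqVlt; apply/orP; left; apply/eqP;
      apply: eq_integral => x _; rewrite mul1r.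
  rewrite mul0e (_ : (\int[mu]_x _)%E = 0%E)//; apply: integral0_eq => x _; by rewrite mul0r.
rewrite ge0_integralZr//; last by apply/measurable_EFinP; exact: measurable_indic.
rewrite integral_indic// setIT.
have muT : mu1 (`[0, T]%classic : set (measurableTypeR R)) = T%:E.
  rewrite (@lebesgue_measure_itv R `[0, T])/= lte_fin -EFinB subr0.
  by case: (ltgtP 0 T) T0 => // <-.
rewrite EFinM -muleA -/c le_eqVlt; apply/orP; left; apply/eqP; congr (_ * _)%E.
exact: muT.
Qed.

End propag_derivative.

Lemma ge0_integral_comb d (T : measurableType d) (R : realType) (m : {measure set T -> \bar R})
    (f g : T -> \bar R) (c e : \bar R) :
  measurable_fun setT f -> measurable_fun setT g ->
  (forall x, (0 <= f x)%E) -> (forall x, (0 <= g x)%E) -> (0 <= c)%E -> (0 <= e)%E ->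
  (\int[m]_x (c * f x + e * g x) = c * \int[m]_x f x + e * \int[m]_x g x)%E.
Proof.
move=> mf mg f0 g0 c0 e0; rewrite ge0_integralD//; first last.
- exact: emeasurable_funM.
- by move=> x _; rewrite mule_ge0.
- exact: emeasurable_funM.
- by move=> x _; rewrite mule_ge0.
by rewrite !ge0_integralZl.
Qed.

(** * Maximal estimates *)

Section maximal.
Context (R : realType) (n : nat).
Local Notation mu := (lebesgue_measure_Rn R n).
Local Notation mu1 := (@lebesgue_measure R).
Local Open Scope complex_scope.
Implicit Types (F G : Rn R n -> R[i]) (a t s K : R) (x xi : Rn R n).

Lemma wmul_bound a F (rho : R) : 0 <= a -> 0 <= rho -> D12 F -> (forall xi, rho < normRn xi -> F xi = 0) ->
  D12 (wmul a F) /\ (N2 mu (wmul a F) <= ((rho `^ a) ^+ 2)%:E * N2 mu F)%E.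
Proof.
move=> a0 r0 [Fi F2] supp; have mF := cintegrable_cmeas Fi; have [m1 m2] := mF.
have [f1 f2] := Fi.
have wF xi : normRn xi `^ a * `|complex.Re (F xi)| <= rho `^ a * `|complex.Re (F xi)| /\
    normRn xi `^ a * `|complex.Im (F xi)| <= rho `^ a * `|complex.Im (F xi)|.
  case: (ltP rho (normRn xi)) => h; first by rewrite supp// normr0 !mulr0.
  by split; rewrite ler_wpM2r// ge0_ler_powR ?nnegrE ?normRn_ge0.
have mw : measurable_fun [set: Rn R n] (fun xi => normRn xi `^ a) by exact: measurable_normRn_powR.
have Z (u : Rn R n -> R) : mu.-integrable setT (EFin \o u) -> mu.-integrable setT (EFin \o (fun xi => rho `^ a * u xi)).
  by move=> ui; have := integrableZl measurableT (rho `^ a) ui; apply: eq_integrable => // xi _; rewrite /= EFinM.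
have wi : cintegrable (wmul a F).
  split; [apply: (integrable_bound (Z _ f1))|apply: (integrable_bound (Z _ f2))].
  - by under eq_fun do rewrite Re_wmul; exact: measurable_funM.
  - by move=> xi; rewrite Re_wmul !normrM !(ger0_norm (powR_ge0 _ _)); case: (wF xi).
  - by under eq_fun do rewrite Im_wmul; exact: measurable_funM.
  - by move=> xi; rewrite Im_wmul !normrM !(ger0_norm (powR_ge0 _ _)); case: (wF xi).
have le : (N2 mu (wmul a F) <= ((rho `^ a) ^+ 2)%:E * N2 mu F)%E.
  rewrite -N2Zl ?sqr_ge0//; apply: ge0_le_integral => //.
  - by move=> xi _; rewrite lee_fin sqn_ge0.
  - by apply: emeasurable_sqn; exact: cintegrable_cmeas.
  - by apply/measurable_EFinP; apply: measurable_funM; [exact: measurable_cst|exact: measurable_sqn].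
  move=> xi _; rewrite lee_fin /wmul sqnM sqn_real.
  case: (ltP rho (normRn xi)) => h; first by rewrite supp// sqn0 !mulr0.
  by rewrite ler_wpM2r ?sqn_ge0// lerXn2r ?nnegrE ?powR_ge0// ge0_ler_powR ?nnegrE ?normRn_ge0.
split=> //; split => //; apply: le_lt_trans le _.
by rewrite lte_mul_pinfty ?lee_fin ?sqr_ge0.
Qed.

Lemma wmul_supp a F xi : F xi = 0 -> wmul a F xi = 0.
Proof. by move=> F0; rewrite /wmul F0 mulr0. Qed.

(** The right side of [propag_sobolev]. It does not depend on t, so it majorises the supremum over
    [0, T] and is visibly measurable. *)
Definition sobmax a F (T l : R) x : \bar R :=
  ((2 / l)%:E * timesq a F T x + l%:E * timesq a (wmul a F) T x)%E.

Lemma sobmax_ge0 a F T l x : 0 <= l -> (0 <= sobmax a F T l x)%E.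
Proof. by move=> l0; rewrite adde_ge0// mule_ge0 ?timesq_ge0// lee_fin ?divr_ge0. Qed.

Lemma measurable_sobmax a F T l : cintegrable F -> cintegrable (wmul a F) ->
  measurable_fun setT (sobmax a F T l).
Proof.
move=> Fi wFi; apply: emeasurable_funD.
  by apply: emeasurable_funM; [exact: measurable_cst|exact: measurable_timesq].
by apply: emeasurable_funM; [exact: measurable_cst|exact: measurable_timesq].
Qed.

Lemma integral_sobmax a F (T l rho B : R) : 0 <= a -> 0 <= rho -> 0 < l -> 0 <= B -> D12 F ->
  (forall xi, rho < normRn xi -> F xi = 0) ->
  (\int[mu]_x ((expwRn 1 x)%:E * timesq a F T x) <= B%:E * N2 mu F)%E ->
  (\int[mu]_x ((expwRn 1 x)%:E * timesq a (wmul a F) T x) <= B%:E * N2 mu (wmul a F))%E ->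
  (\int[mu]_x ((expwRn 1 x)%:E * sobmax a F T l x) <=
    (B * (2 / l + l * (rho `^ a) ^+ 2))%:E * N2 mu F)%E.
Proof.
move=> a0 r0 l0 B0 DF supp h1 h2; have [[wFi wF2] wle] := wmul_bound a0 r0 DF supp.
have [Fi F2] := DF.
have mE : measurable_fun [set: Rn R n] (fun x => (expwRn 1 x)%:E) by apply/measurable_EFinP; exact: measurable_expwRn.
have mt1 := measurable_timesq a T Fi; have mt2 := measurable_timesq a T wFi.
have e0 x : (0 <= (expwRn 1 x)%:E :> \bar R)%E by rewrite lee_fin expwRn_ge0.
have -> : (\int[mu]_x ((expwRn 1 x)%:E * sobmax a F T l x) =
    \int[mu]_x ((2 / l)%:E * ((expwRn 1 x)%:E * timesq a F T x) + l%:E * ((expwRn 1 x)%:E * timesq a (wmul a F) T x)))%E.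
  have gen (e A A' c c' : \bar R) : (0 <= c -> 0 <= c' -> 0 <= A -> 0 <= A' ->
      e * (c * A + c' * A') = c * (e * A) + c' * (e * A'))%E.
    by move=> c0 c'0 A0 A'0; rewrite ge0_muleDr ?mule_ge0// !(muleCA e).
  by apply: eq_integral => x _; apply: gen; rewrite ?timesq_ge0 ?lee_fin ?divr_ge0 ?(ltW l0).
have m1 := emeasurable_funM mE mt1.
have m2 := emeasurable_funM mE mt2.
have g1 x : (0 <= (expwRn 1 x)%:E * timesq a F T x)%E by exact: (mule_ge0 (e0 x) (timesq_ge0 _ _ _ _)).
have g2 x : (0 <= (expwRn 1 x)%:E * timesq a (wmul a F) T x)%E by exact: (mule_ge0 (e0 x) (timesq_ge0 _ _ _ _)).
have l2 : (0 <= (2 / l)%:E :> \bar R)%E by rewrite lee_fin divr_ge0// ltW.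
have l1 : (0 <= l%:E :> \bar R)%E by rewrite lee_fin ltW.
rewrite (ge0_integral_comb mu m1 m2 g1 g2 l2 l1).
apply: (@le_trans _ _ ((2 / l)%:E * (B%:E * N2 mu F) + l%:E * (B%:E * (((rho `^ a) ^+ 2)%:E * N2 mu F)))%E).
  apply: leeD; rewrite lee_wpmul2l ?lee_fin ?divr_ge0 ?(ltW l0)//.
  by apply: (le_trans h2); rewrite lee_wpmul2l.
rewrite !muleA -!EFinM -ge0_muleDl ?lee_fin ?mulr_ge0 ?divr_ge0 ?invr_ge0 ?(ltW l0) ?powR_ge0//.
rewrite -EFinD le_eqVlt; apply/orP; left; apply/eqP; congr (_%:E * _)%E.
by ring.
Qed.

(** Indices are shifted: piece 0 is the unit ball and piece j+1 the annulus 2^j <= |xi| < 2^(j+1),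
    so that piece j lies in |xi| <= 2^j in all cases. *)
Definition piece F (j : nat) xi : R[i] :=
  F xi * (\1_(if j is j'.+1 then annRn j' else ballRn 1) xi : R)%:C.

Lemma measurable_piece_set (j : nat) : measurable (if j is j'.+1 then annRn j' else ballRn 1 : set (Rn R n)).
Proof. by case: j => [|j]; [exact: measurable_ballRn|exact: measurable_annRn]. Qed.

Lemma lebesgue_ballRn_lty (rho : R) : 0 < rho -> (mu (ballRn rho) < +oo)%E.
Proof. by move=> r0; apply: le_lt_trans (ballRn_measure n r0) (ltry _). Qed.

Lemma piece_D12 F j : L2 F -> D12 (piece F j).
Proof.
move=> F2; apply: L2_indic_D12 => //; first exact: measurable_piece_set.
case: j => [|j]; first exact: lebesgue_ballRn_lty.
apply: le_lt_trans (@lebesgue_ballRn_lty (2 ^+ j.+1) _); last exact: exprn_gt0.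
apply: le_measure; rewrite ?inE; [exact: measurable_annRn|exact: measurable_ballRn|].
by move=> x /andP[].
Qed.

Lemma piece_supp F j xi : ~ annRn j xi -> piece F j.+1 xi = 0.
Proof. by move=> h; rewrite /piece indicE memNset// mulr0. Qed.

Lemma piece_supp_ball F j xi : 2 ^+ j < normRn xi -> piece F j xi = 0.
Proof.
case: j => [|j] h; last by apply: piece_supp => /andP[_ h']; move: (lt_trans h h'); rewrite ltxx.
rewrite /piece indicE memNset ?mulr0// /ballRn /= => h'.
by move: (lt_trans h h'); rewrite expr0 ltxx.
Qed.

(** Measurable majorants stand in for the suprema over k. The weight is harmless for a.e.
    conclusions because it is positive everywhere. *)
Definition maximal_bound a F (tt : nat -> R) := exists C q : R, [/\ 0 <= C, 0 < q, q < 1 &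
  forall j, exists M : Rn R n -> \bar R, [/\ measurable_fun setT M, forall x, (0 <= M x)%E,
    forall k x, ((sqn (propag a (piece F j) (tt k) x))%:E <= M x)%E &
    (\int[mu]_x ((expwRn 1 x)%:E * M x) <= (C * q ^+ j)%:E)%E]].

Lemma sobmax_maximal a F j (T l t : R) x : 0 <= a -> L2 F -> 0 < l -> l <= T -> 0 <= t -> t <= T ->
  ((sqn (propag a (piece F j) t x))%:E <= sobmax a (piece F j) T l x)%E.
Proof.
move=> a0 F2 l0 lT t0 tT; have DF := piece_D12 j F2.
have r0 : 0 <= 2 ^+ j :> R by rewrite exprn_ge0.
have [[wFi _] _] := wmul_bound a0 r0 DF (@piece_supp_ball F j).
by apply: propag_sobolev => //; case: DF.
Qed.

Lemma measurable_sobmax_piece a F j T l : 0 <= a -> L2 F -> measurable_fun setT (sobmax a (piece F j) T l).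
Proof.
move=> a0 F2; have DF := piece_D12 j F2.
have r0 : 0 <= 2 ^+ j :> R by rewrite exprn_ge0.
have [[wFi _] _] := wmul_bound a0 r0 DF (@piece_supp_ball F j).
by apply: measurable_sobmax => //; case: DF.
Qed.

Lemma integral_sobmax_plancherel a F j (T l : R) : 0 <= a -> L2 F -> 0 < l -> 0 <= T ->
  (\int[mu]_x ((expwRn 1 x)%:E * sobmax a (piece F j) T l x) <=
    (T * gftC n (cinv R n) * (2 / l + l * ((2 ^+ j) `^ a) ^+ 2))%:E * N2 mu (piece F j))%E.
Proof.
move=> a0 F2 l0 T0; have DF := piece_D12 j F2.
have r0 : 0 <= 2 ^+ j :> R by rewrite exprn_ge0.
have [[wFi _] _] := wmul_bound a0 r0 DF (@piece_supp_ball F j).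
apply: integral_sobmax => //; first by rewrite mulr_ge0// gftC_ge0.
- exact: piece_supp_ball.
- by apply: integral_timesq => //; case: DF.
- exact: integral_timesq.
Qed.

(* The low frequencies: one unit time step suffices. *)
Lemma maximal_piece0 a F K (tt : nat -> R) : 0 <= a -> L2 F -> 0 <= K -> (N2 mu (piece F 0) <= K%:E)%E ->
  (forall k, 0 <= tt k <= 1) ->
  exists M : Rn R n -> \bar R, [/\ measurable_fun setT M, forall x, (0 <= M x)%E,
    forall k x, ((sqn (propag a (piece F 0) (tt k) x))%:E <= M x)%E &
    (\int[mu]_x ((expwRn 1 x)%:E * M x) <= (3 * gftC n (cinv R n) * K)%:E)%E].
Proof.
move=> a0 F2 K0 FK t01; exists (sobmax a (piece F 0) 1 1); split.
- exact: measurable_sobmax_piece.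
- by move=> x; exact: sobmax_ge0.
- by move=> k x; apply: sobmax_maximal => //; case/andP: (t01 k).
have h := integral_sobmax_plancherel 0 a0 F2 ltr01 ler01.
have E : 1 * gftC n (cinv R n) * (2 / 1 + 1 * ((2 ^+ 0) `^ a) ^+ 2) = 3 * gftC n (cinv R n).
  by rewrite expr0 powR1 expr1n invr1; ring.
by rewrite E in h; apply: (le_trans h); rewrite [leRHS]EFinM lee_wpmul2l// lee_fin mulr_ge0// gftC_ge0.
Qed.

End maximal.

Section maximal_cases.
Context (R : realType).
Local Notation mu1 := (@lebesgue_measure R).
Local Open Scope complex_scope.
Implicit Types (a s K : R).

(** Merges the constant of piece 0 with the decay q^j of piece j+1 into a single geometric bound;
    the shift of index costs 1/q. *)
Lemma geometric_shift (C0 C1 q : R) (j : nat) : 0 <= C0 -> 0 <= C1 -> 0 < q -> q < 1 ->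
  C0 <= C0 + C1 / q /\ C1 * q ^+ j <= (C0 + C1 / q) * q ^+ j.+1.
Proof.
move=> C00 C10 q0 q1; split; first by rewrite lerDl divr_ge0// ltW.
rewrite mulrDl (_ : C1 / q * q ^+ j.+1 = C1 * q ^+ j); last by rewrite exprS; field; rewrite gt_eqF.
by rewrite lerDr mulr_ge0// exprn_ge0// ltW.
Qed.

Lemma powR_ge1 (x y : R) : 1 <= x -> 0 <= y -> 1 <= x `^ y.
Proof. by move=> x1 y0; rewrite -[leLHS](powRr0 x) ler_powR. Qed.

(** The choice l = lam^(-a) balances the two Sobolev terms: with outer radius 2 lam, both are of
    order lam^a. *)
Lemma lam_algebra a (lam : R) : 0 < lam ->
  2 / lam `^ (- a) + lam `^ (- a) * ((2 * lam) `^ a) ^+ 2 = lam `^ a * (2 + (2 `^ a) ^+ 2).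
Proof.
move=> l0; rewrite powRM ?(ltW l0)// powRN invrK exprMn; field.
by rewrite gt_eqF// powR_gt0.
Qed.

(** One Sobolev estimate on [0, 1] per annulus: smoothing gives lam^(1-a), the Sobolev step lam^a
    and the spectrum lam^(-2s), so the ratio q is 2^(1-2s). *)
Lemma maximal_smooth m a s K (F : Rn R m.+1 -> R[i]) (tt : nat -> R) : 1 < a -> 1 / 2 < s -> L2 F -> 0 <= K ->
  dyadic_bound s F K -> (forall k, 0 <= tt k <= 1) -> maximal_bound a F tt.
Proof.
move=> a1 s1 F2 K0 [FK0 FK] t01.
have a0 : 0 <= a by rewrite ltW// (lt_trans _ a1).
have [C1 C10 hC1] := local_smoothing_strip m a1.
pose e : R := 2 + (2 `^ a) ^+ 2.
have e0 : 0 <= e by rewrite addr_ge0// sqr_ge0.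
pose q : R := 2 `^ (1 - 2 * s); have q0 : 0 < q by exact: powR_gt0.
have q1 : q < 1.
  have := @pow2N_lt1 R (s - 1 / 2); rewrite subr_gt0 => /(_ s1).
  by rewrite (_ : - (2 * (s - 1 / 2)) = 1 - 2 * s)//; field.
pose D0 := 3 * gftC m.+1 (cinv R m.+1) * K; pose D1 := C1 * e * K.
have D00 : 0 <= D0 by rewrite mulr_ge0// mulr_ge0// gftC_ge0.
have D10 : 0 <= D1 by rewrite mulr_ge0// mulr_ge0.
exists (D0 + D1 / q), q; split => //; first by rewrite addr_ge0// divr_ge0// ltW.
case=> [|j].
  have [M [mM M0 hM iM]] := maximal_piece0 a0 F2 K0 FK0 t01.
  exists M; split => //; apply: (le_trans iM); rewrite expr0 mulr1 lee_fin.
  by have [] := geometric_shift 0 D00 D10 q0 q1.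
pose lam : R := 2 ^+ j; have l0 : 0 < lam by exact: exprn_gt0.
have lam1 : 1 <= lam by rewrite exprn_ege1// ler1n.
pose l := lam `^ (- a).
have ll : 0 < l by exact: powR_gt0.
have l1 : l <= 1 by rewrite /l powRN invf_le1 ?powR_gt0// powR_ge1.
have DF := piece_D12 j.+1 F2.
have r0 : 0 <= 2 ^+ j.+1 :> R by rewrite exprn_ge0.
have [DwF wle] := wmul_bound a0 r0 DF (@piece_supp_ball R _ F j.+1).
exists (sobmax a (piece F j.+1) 1 l); split.
- exact: measurable_sobmax_piece.
- by move=> x; apply: sobmax_ge0; exact: ltW.
- by move=> k x; apply: sobmax_maximal => //; case/andP: (t01 k).
pose B := C1 * lam `^ (1 - a); have B0 : 0 <= B by rewrite mulr_ge0// powR_ge0.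
(* Stated for a general G because it serves twice: the piece and its product with |xi|^a are both
   supported in the annulus. *)
have conv G : D12 G -> (forall xi, ~ annRn j xi -> G xi = 0) ->
    (\int[lebesgue_measure_Rn R m.+1]_x ((expwRn 1 x)%:E * timesq a G 1 x) <=
     B%:E * N2 (lebesgue_measure_Rn R m.+1) G)%E.
  move=> DG Gs; apply: le_trans (hC1 j G DG Gs); rewrite le_eqVlt; apply/orP; left; apply/eqP.
  apply: eq_integral => x _; rewrite /timesq -ge0_integralZl//.
  - apply/measurable_EFinP; apply: measurable_funTS.
    have [Gi _] := DG; have mp := measurable_sqn (cmeas_propag2 a Gi).
    exact: (measurableT_comp mp (measurable_pair2 x)).
  - by move=> t _; rewrite lee_fin sqn_ge0.
  - by rewrite lee_fin expwRn_ge0.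
have h := integral_sobmax a0 r0 ll B0 DF (@piece_supp_ball R _ F j.+1)
  (conv _ DF (@piece_supp R _ F j)) (conv _ DwF (fun xi h => wmul_supp a (@piece_supp R _ F j xi h))).
apply: (le_trans h).
have -> : B * (2 / l + l * ((2 ^+ j.+1) `^ a) ^+ 2) = C1 * e * lam.
  rewrite (exprS _ j) -/lam /l lam_algebra// /B -/e.
  rewrite (@powRD _ lam 1 (- a)) ?(gt_eqF l0) ?implybT// powRr1 ?(ltW l0)// powRN; field.
  by rewrite gt_eqF// powR_gt0.
apply: (@le_trans _ _ (D1 * q ^+ j)%:E); last first.
  by rewrite lee_fin; have [] := geometric_shift j D00 D10 q0 q1.
apply: (@le_trans _ _ ((C1 * e * lam)%:E * (K * lam `^ (- (2 * s)))%:E)%E).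
  by rewrite lee_wpmul2l ?lee_fin ?mulr_ge0 ?(ltW l0)//; exact: FK.
rewrite -EFinM lee_fin le_eqVlt; apply/orP; left; apply/eqP.
rewrite /D1 /q -pow2_powR -/lam (@powRD _ lam 1 (- (2 * s))) ?(gt_eqF l0) ?implybT// powRr1 ?(ltW l0)//.
by ring.
Qed.

(** The majorant has two summands: [sobmax] on [0, [del]] for the short times, and for the others a
    sum over k of fixed-time squares, each bounded in L^1 through the L^2 estimate at that time. *)
Lemma maximal_sparse n a s K (F : Rn R n -> R[i]) (tt : nat -> R) (gam : R) :
  1 < a -> 0 < s -> s <= 1 / 2 -> L2 F -> 0 <= K -> dyadic_bound s F K ->
  (forall k, 0 < tt k < 1) -> gam = 2 * s / (a - s) ->
  (\sum_(0 <= k <oo) (tt k `^ gam)%:E < +oo)%E -> maximal_bound a F tt.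
Proof.
move=> a1 s0 s1 F2 K0 [FK0 FK] t01 gamE tsum.
pose mu := lebesgue_measure_Rn R n.
have a0 : 0 <= a by rewrite ltW// (lt_trans _ a1).
have as0 : 0 < a - s by lra.
have gam0 : 0 < gam by rewrite gamE divr_gt0// mulr_gt0.
(* [th gamma < 2 s] is needed below, and [a - s] would be the borderline case. *)
pose th := a - 3 * s / 2.
have th0 : 0 < th by rewrite /th; lra.
have tha : th <= a by rewrite /th; lra.
pose e : R := 2 + (2 `^ a) ^+ 2.
have e0 : 0 <= e by rewrite addr_ge0// sqr_ge0.
(* The ratios for the two groups of times, 2^(-s/2) and 2^(-gamma s/2), written in the form to which
   [pow2N_lt1] applies. *)
pose q1 : R := 2 `^ (- (2 * (s / 4))); pose q2 : R := 2 `^ (- (2 * (gam * s / 4))).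
pose q := Num.max q1 q2.
have q10 : 0 < q1 by exact: powR_gt0.
have q0 : 0 < q by rewrite lt_max q10.
have ql : q < 1 by rewrite gt_max !pow2N_lt1// divr_gt0// mulr_gt0.
have [S SE] : exists S : R, (\sum_(0 <= k <oo) (tt k `^ gam)%:E = S%:E)%E.
  exists (fine (\sum_(0 <= k <oo) (tt k `^ gam)%:E)%E); rewrite fineK// ge0_fin_numE//.
  by apply: nneseries_ge0 => k _ _; rewrite lee_fin powR_ge0.
have S0 : 0 <= S.
  by rewrite -lee_fin -SE; apply: nneseries_ge0 => k _ _; rewrite lee_fin powR_ge0.
pose c := gftC n (cinv R n); have c0 : 0 <= c by exact: gftC_ge0.
pose D0 := 3 * c * K; pose D1 := c * K * (e + S).
have D00 : 0 <= D0 by rewrite mulr_ge0// mulr_ge0.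
have D10 : 0 <= D1 by apply: mulr_ge0; [exact: mulr_ge0|exact: addr_ge0].
exists (D0 + D1 / q), q; split => //; first by rewrite addr_ge0// divr_ge0// ltW.
case=> [|j].
  have t01' k : 0 <= tt k <= 1 by case/andP: (t01 k) => /ltW -> /ltW ->.
  have [M [mM M0 hM iM]] := maximal_piece0 a0 F2 K0 FK0 t01'.
  exists M; split => //; apply: (le_trans iM); rewrite expr0 mulr1 lee_fin.
  by have [] := geometric_shift 0 D00 D10 q0 ql.
pose lam : R := 2 ^+ j; have l0 : 0 < lam by exact: exprn_gt0.
have lam1 : 1 <= lam by rewrite exprn_ege1// ler1n.
pose l := lam `^ (- a); pose del := lam `^ (- th).
have ll : 0 < l by exact: powR_gt0.
have del0 : 0 < del by exact: powR_gt0.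
have ld : l <= del by rewrite /l /del ler_powR// lerN2.
set G := piece F j.+1; have DG : D12 G := piece_D12 j.+1 F2; have [Gi _] := DG.
have G2 : (N2 mu G <= (K * lam `^ (- (2 * s)))%:E)%E := FK j.
(* The factor is at least 1 when [tt k] > [del], so it may be inserted there, and it makes the sum
   over all k finite: it adds up to [del]^(-gamma) S. *)
pose u k x := ((tt k / del) `^ gam * sqn (propag a G (tt k) x))%:E.
have u0 k x : (0 <= u k x)%E by rewrite lee_fin mulr_ge0 ?powR_ge0 ?sqn_ge0.
have mu_ k : measurable_fun setT (u k).
  apply/measurable_EFinP; apply: measurable_funM; first exact: measurable_cst.
  by apply: measurable_sqn; exact: cmeas_propag.
pose V x := (\sum_(0 <= k <oo) u k x)%E.
have V0 x : (0 <= V x)%E by exact: nneseries_ge0.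
have mV : measurable_fun setT V.
  have := @ge0_emeasurable_sum _ (Rn R n) R setT u xpredT.
  by apply => // k _; exact: mu_.
have mS : measurable_fun setT (sobmax a G del l) by exact: measurable_sobmax_piece.
have S0x x : (0 <= sobmax a G del l x)%E by apply: sobmax_ge0; exact: ltW.
exists (fun x => sobmax a G del l x + V x)%E; split.
- exact: emeasurable_funD.
- by move=> x; rewrite adde_ge0.
- move=> k x; have /andP[tk0 tk1] := t01 k.
  have [tkd|dtk] := leP (tt k) del.
    have h := sobmax_maximal j.+1 x a0 F2 ll ld (ltW tk0) tkd.
    by apply: (le_trans h); rewrite leeDl.
  apply: (@le_trans _ _ (u k x)).
    rewrite /u lee_fin ler_peMl ?sqn_ge0// powR_ge1 ?(ltW gam0)//.
    by rewrite ler_pdivlMr// mul1r ltW.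
  apply: (@le_trans _ _ (V x)); last by rewrite leeDr.
  apply: le_trans (nneseries_lim_ge k.+1 (fun i _ _ => u0 i x)).
  by rewrite big_nat_recr//= leeDr// sume_ge0.
have mE : measurable_fun [set: Rn R n] (fun x => (expwRn 1 x)%:E) by apply/measurable_EFinP; exact: measurable_expwRn.
have e0x (x : Rn R n) : (0 <= (expwRn 1 x)%:E :> \bar R)%E by rewrite lee_fin expwRn_ge0.
have -> : (\int[mu]_x ((expwRn 1 x)%:E * (sobmax a G del l x + V x)) =
    1 * \int[mu]_x ((expwRn 1 x)%:E * sobmax a G del l x) + 1 * \int[mu]_x ((expwRn 1 x)%:E * V x))%E.
  have m1 := emeasurable_funM mE mS; have m2 := emeasurable_funM mE mV.
  rewrite -(ge0_integral_comb mu m1 m2 (fun x => mule_ge0 (e0x x) (S0x x)) (fun x => mule_ge0 (e0x x) (V0 x)) lee01 lee01).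
  by apply: eq_integral => x _; rewrite ge0_muleDr// !mul1e.
rewrite !mul1e.
have hS : (\int[mu]_x ((expwRn 1 x)%:E * sobmax a G del l x) <= (c * K * e * lam `^ (- (2 * (s / 4))))%:E)%E.
  have h := integral_sobmax_plancherel j.+1 a0 F2 ll (ltW del0).
  apply: (le_trans h); rewrite (exprS _ j) -/lam /l lam_algebra// -/e -/c.
  apply: le_trans (lee_wpmul2l _ G2) _; first by rewrite lee_fin; apply: mulr_ge0; [exact: mulr_ge0 (ltW del0) c0|exact: mulr_ge0 (powR_ge0 _ _) e0].
  rewrite -EFinM lee_fin le_eqVlt; apply/orP; left; apply/eqP; rewrite /del.
  rewrite (_ : - (2 * (s / 4)) = - th + a + - (2 * s)); last by rewrite /th; field.
  by rewrite !powRD ?(gt_eqF l0) ?implybT//; ring.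
have hV : (\int[mu]_x ((expwRn 1 x)%:E * V x) <= (c * K * S * lam `^ (- (2 * (gam * s / 4))))%:E)%E.
  pose w k (x : Rn R n) := ((expwRn 1 x)%:E * u k x)%E.
  have mw k : measurable_fun setT (w k) by exact: (emeasurable_funM mE (mu_ k)).
  have w0 k x : (0 <= w k x)%E by exact: (mule_ge0 (e0x x) (u0 k x)).
  have -> : (\int[mu]_x ((expwRn 1 x)%:E * V x) = \sum_(0 <= k <oo) \int[mu]_x w k x)%E.
    rewrite -integral_nneseries//; apply: eq_integral => x _.
    by rewrite /V -nneseriesZl.
  pose Q := c * K * lam `^ (- (2 * s)) * (lam `^ th) `^ gam.
  have Q0 : 0 <= Q.
    by apply: mulr_ge0; [apply: mulr_ge0; [exact: mulr_ge0|exact: powR_ge0]|exact: powR_ge0].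
  apply: (@le_trans _ _ (\sum_(0 <= k <oo) (Q%:E * (tt k `^ gam)%:E))%E).
    apply: lee_nneseries => [k _ _|k _]; first exact: integral_ge0.
    apply: (@le_trans _ _ (((tt k / del) `^ gam)%:E * N2 mu (propag a G (tt k)))%E).
      rewrite -N2Zl ?powR_ge0//; last exact: cmeas_propag.
      apply: ge0_le_integral => //.
      - by apply/measurable_EFinP; apply: measurable_funM; [exact: measurable_cst|apply: measurable_sqn; exact: cmeas_propag].
      - by move=> x _; rewrite -[leRHS]mul1e lee_wpmul2r// lee_fin expwRn_le1.
    apply: (@le_trans _ _ (((tt k / del) `^ gam)%:E * (c%:E * (K * lam `^ (- (2 * s)))%:E))%E).
      rewrite lee_wpmul2l ?lee_fin ?powR_ge0//; apply: le_trans (N2_propag a (tt k) Gi) _.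
      by rewrite lee_wpmul2l.
    rewrite -!EFinM lee_fin le_eqVlt; apply/orP; left; apply/eqP.
    have /andP[tk0 _] := t01 k.
    rewrite powRM ?(ltW tk0) ?invr_ge0 ?(ltW del0)// /Q /del powRN invrK; ring.
  rewrite nneseriesZl; last by move=> k _; rewrite lee_fin powR_ge0.
  rewrite SE -EFinM lee_fin le_eqVlt; apply/orP; left; apply/eqP; rewrite /Q -powRrM.
  rewrite (_ : - (2 * (gam * s / 4)) = - (2 * s) + th * gam); last first.
    by rewrite /th gamE; field; rewrite gt_eqF.
  by rewrite powRD ?(gt_eqF l0) ?implybT//; ring.
apply: (le_trans (leeD hS hV)); rewrite -EFinD.
apply: (@le_trans _ _ (D1 * q ^+ j)%:E); last first.
  by rewrite lee_fin; have [] := geometric_shift j D00 D10 q0 ql.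
rewrite lee_fin (_ : D1 * q ^+ j = c * K * e * q ^+ j + c * K * S * q ^+ j); last by rewrite /D1; ring.
have cK : 0 <= c * K by exact: mulr_ge0.
apply: lerD; apply: ler_wpM2l; rewrite ?(mulr_ge0 cK)// pow2_powR.
  by rewrite lerXn2r ?nnegrE ?powR_ge0 ?(ltW q0)// le_max lexx.
by rewrite lerXn2r ?nnegrE ?powR_ge0 ?(ltW q0)// le_max lexx orbT.
Qed.

End maximal_cases.

(** * Almost everywhere convergence *)

Section tannery.
Context (R : realType).

(** A finite head converges termwise and the tails are controlled by [m]. The sums A k and B are
    specified only as cluster values of their partial sums, since that is what a.e. convergence
    along a subsequence provides. In the final bound each tail counts e/5 twice and the head
    once. *)
Lemma tannery (a : nat -> nat -> R) (b m A : nat -> R) (B : R) :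
  (forall k j, `|a k j| <= m j) -> (forall j, `|b j| <= m j) -> cvgn (series m) ->
  (forall j, a k j @[k --> \oo] --> b j) ->
  (forall k N (e : R), 0 < e -> exists2 J, (N <= J)%N & `|series (a k) J - A k| <= e) ->
  (forall N (e : R), 0 < e -> exists2 J, (N <= J)%N & `|series b J - B| <= e) ->
  A k @[k --> \oo] --> B.
Proof.
move=> am bm cm ab hA hB; apply/cvgrPdist_le => e e0.
have e5 : 0 < e / 5 by rewrite divr_gt0.
have m0 j : 0 <= m j by apply: le_trans (normr_ge0 _) (bm j).
have [N tail] : exists N, forall J, (N <= J)%N -> \sum_(N <= j < J) m j <= e / 5.
  have /cvg_ex[l ml] := cm.
  have ndm : nondecreasing_seq (series m).
    by apply: nondecreasing_series => j _ _; exact: m0.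
  have /cvgrPdist_le/(_ _ e5)[N _ hN] := ml.
  exists N => J NJ; rewrite -(sub_series_geq _ NJ).
  have h1 : series m J <= l.
    rewrite -(cvg_lim (@Rhausdorff R) ml); apply: nondecreasing_cvgn_le => //.
  have := hN N (leqnn N); rewrite /= ler_norml => /andP[_]; lra.
have rest (u : nat -> R) (U : R) : (forall j, `|u j| <= m j) ->
    (forall N (e : R), 0 < e -> exists2 J, (N <= J)%N & `|series u J - U| <= e) ->
    `|series u N - U| <= e / 5 + e / 5.
  move=> um hU; have [J NJ hJ] := hU N _ e5.
  rewrite (_ : series u N - U = - (series u J - series u N) + (series u J - U)); last by ring.
  apply: le_trans (ler_normD _ _) _; rewrite normrN lerD//.
  rewrite (sub_series_geq _ NJ); apply: le_trans (ler_norm_sum _ _ _) _.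
  by apply: le_trans (tail J NJ); apply: ler_sum => j _.
have fin : series (a k) N @[k --> \oo] --> series b N.
  rewrite /series/=; elim: (N) => [|N' IH].
    under eq_fun do rewrite big_geq//; rewrite big_geq//; exact: cvg_cst.
  under eq_fun do rewrite big_nat_recr//=; rewrite big_nat_recr//=.
  by apply: cvgD; [exact: IH|exact: ab].
have /cvgrPdist_le/(_ _ e5)[K _ hK] := fin.
exists K => // k Kk; have h1 := hK k Kk.
have h2 := rest _ _ (am k) (hA k); have h3 := rest _ _ bm hB.
rewrite (_ : B - A k = - (series b N - B) + (series b N - series (a k) N) + (series (a k) N - A k)); last by ring.
apply: le_trans (ler_normD _ _) _; apply: le_trans (lerD (ler_normD _ _) (lexx _)) _; rewrite normrN.
apply: le_trans (lerD (lerD h3 h1) h2) _; lra.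
Qed.

End tannery.

Section ae_summability.
Context (R : realType) (n : nat).
Local Notation mu := (lebesgue_measure_Rn R n).

(** A squared bound becomes a linear one through |y| <= y^2 / r^j + r^j. With r^2 = q, both terms
    integrate to multiples of r^j against the weight, so their sum over j is finite a.e.; dividing
    by the positive weight gives [m]. *)
Lemma ae_summable (M : nat -> Rn R n -> \bar R) (C q : R) : 0 <= C -> 0 < q -> q < 1 ->
  (forall j, measurable_fun setT (M j)) -> (forall j x, (0 <= M j x)%E) ->
  (forall j, (\int[mu]_x ((expwRn 1 x)%:E * M j x) <= (C * q ^+ j)%:E)%E) ->
  {ae mu, forall x, exists2 m : nat -> R, cvgn (series m) &
    forall j (y : R), ((y ^+ 2)%:E <= M j x)%E -> `|y| <= m j}.
Proof.
move=> C0 q0 q1 mM M0 iM; pose r := Num.sqrt q.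
have r0 : 0 < r by rewrite sqrtr_gt0.
have rq : r ^+ 2 = q by rewrite sqr_sqrtr// ltW.
have r1 : r < 1.
  rewrite ltNge; apply/negP => h; have : 1 <= r ^+ 2 by rewrite exprn_ege1.
  by rewrite rq leNgt q1.
have rj0 j : 0 < r ^+ j by rewrite exprn_gt0.
(* The weight also multiplies r^j, as a constant is not integrable over the whole space. *)
pose v j x : \bar R := (((r ^+ j)^-1)%:E * ((expwRn 1 x)%:E * M j x) + (r ^+ j)%:E * (expwRn 1 x)%:E)%E.
have m1 : measurable_fun setT (fun x : Rn R n => (expwRn 1 x)%:E) by apply/measurable_EFinP; exact: measurable_expwRn.
have m2 j : measurable_fun setT (fun x : Rn R n => ((expwRn 1 x)%:E * M j x)%E) by exact: emeasurable_funM m1 (mM j).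
have e0 x : (0 <= (expwRn 1 (x : Rn R n))%:E)%E by rewrite lee_fin ltW// expwRn_gt0.
have f0 j x : (0 <= (expwRn 1 x)%:E * M j x)%E by rewrite mule_ge0.
have c1 j : (0 <= ((r ^+ j)^-1)%:E)%E by rewrite lee_fin invr_ge0 ltW.
have c2 j : (0 <= (r ^+ j)%:E)%E by rewrite lee_fin ltW.
have v0 j x : (0 <= v j x)%E by rewrite /v adde_ge0// mule_ge0.
have mv j : measurable_fun setT (v j).
  by apply: emeasurable_funD; apply: emeasurable_funM.
have iv j : (\int[mu]_x v j x <= ((C + 2 ^+ n) * r ^+ j)%:E)%E.
  rewrite (ge0_integral_comb mu (m2 j) m1 (f0 j) e0 (c1 j) (c2 j)) integral_expwRn// divr1.
  apply: (@le_trans _ _ (((r ^+ j)^-1)%:E * (C * q ^+ j)%:E + (r ^+ j)%:E * (2 ^+ n)%:E)%E).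
    by rewrite leeD2r// lee_wpmul2l.
  rewrite -!EFinM -EFinD lee_fin le_eqVlt; apply/orP; left; apply/eqP.
  rewrite -rq -exprM mulnC exprM; field; rewrite ?gt_eqF//.
have sv : (\sum_(0 <= j <oo) \int[mu]_x v j x < +oo)%E.
  apply: (@le_lt_trans _ _ (\sum_(0 <= j <oo) ((C + 2 ^+ n)%:E * (r ^+ j)%:E))%E).
    by apply: lee_nneseries => [j _ _|j _]; [exact: integral_ge0|rewrite -EFinM; exact: iv].
  have c3 : 0 <= C + 2 ^+ n :> R by rewrite addr_ge0// exprn_ge0.
  rewrite nneseriesZl; last by move=> j _; exact: c2.
  by apply: lte_mul_pinfty; rewrite ?lee_fin//; apply: geometric_lty => //; exact: ltW.
apply: filterS (ae_nneseries_lty mv v0 sv) => x vx.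
have vfin j : (v j x < +oo)%E.
  apply: le_lt_trans vx; apply: (@le_trans _ _ (\sum_(0 <= i < j.+1) v i x)%E).
    by rewrite big_nat_recr//= leeDr// sume_ge0.
  by apply: nneseries_lim_ge => k _ _; exact: v0.
have vE j : v j x = (fine (v j x))%:E by rewrite fineK// ge0_fin_numE.
have px : 0 < expwRn 1 x by exact: expwRn_gt0.
exists (fun j => (expwRn 1 x)^-1 * fine (v j x)).
  apply: is_cvg_seriesZ; apply: series_lty => [k|]; first exact: fine_ge0.
  by under eq_eseriesr do rewrite -vE.
move=> j y yM; rewrite ler_pdivlMl//.
rewrite -lee_fin -vE /v.
apply: (@le_trans _ _ (((r ^+ j)^-1)%:E * ((expwRn 1 x)%:E * (y ^+ 2)%:E) + (r ^+ j)%:E * (expwRn 1 x)%:E)%E); last first.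
  by rewrite leeD2r// lee_wpmul2l// lee_wpmul2l.
rewrite -!EFinM -EFinD lee_fin.
rewrite (_ : _ + _ = expwRn 1 x * (y ^+ 2 / r ^+ j + r ^+ j)); last by ring.
rewrite ler_wpM2l ?(ltW px)//.
have := rj0 j; move: (r ^+ j) => c c0.
rewrite -(@ler_pM2r _ c)// mulrDl divfK ?gt_eqF// -real_normK ?num_real//.
have := sqr_ge0 (`|y| - c); have := sqr_ge0 (`|y|); have := normr_ge0 y; nra.
Qed.

End ae_summability.

Section maximal_convergence.
Context (R : realType) (n : nat).
Local Notation mu := (lebesgue_measure_Rn R n).
Local Open Scope complex_scope.
Implicit Types (F G : Rn R n -> R[i]) (a t : R) (x xi : Rn R n).

Definition propagL2 a F t : Rn R n -> R[i] :=
  gftL2 1 (cinv R n) (fun xi => expi (t * normRn xi `^ a) * F xi).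

Lemma series_propag_piece a F t x J : L2 F ->
  \sum_(0 <= j < J.+1) propag a (piece F j) t x =
  propag a (fun xi => F xi * (\1_(ballRn (2 ^+ J)) xi : R)%:C) t x.
Proof.
move=> F2; elim: J => [|J IH].
  by rewrite big_nat1 /piece expr0.
rewrite big_nat_recr//= IH.
have D J' : cintegrable (fun xi => F xi * (\1_(ballRn (2 ^+ J')) xi : R)%:C).
  have [] // : D12 (fun xi => F xi * (\1_(ballRn (2 ^+ J')) xi : R)%:C).
  by apply: L2_indic_D12 => //; [exact: measurable_ballRn|apply: lebesgue_ballRn_lty; exact: exprn_gt0].
have P : cintegrable (piece F J.+1) by case: (piece_D12 J.+1 F2).
have E xi : F xi * (\1_(ballRn (2 ^+ J)) xi : R)%:C + piece F J.+1 xi = F xi * (\1_(ballRn (2 ^+ J.+1)) xi : R)%:C.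
  rewrite /piece -mulrDr; apply: (congr1 (fun z => F xi * z)); rewrite -rmorphD/= !indicE ballRn_annRn in_setU.
  have : ~ (ballRn (2 ^+ J) `&` annRn J) xi by rewrite ballRn_annRn0.
  case: (boolP (xi \in ballRn (2 ^+ J))) => [/set_mem h1|_]; case: (boolP (xi \in annRn J)) => [/set_mem h2|_] h; rewrite /= ?addr0 ?add0r//.
  by case: h.
have := @gft_lin R n 1 (cinv R n) 1 _ _ x (cintegrable_propag a t (D J)) (cintegrable_propag a t P).
rewrite mul1r => <-; apply: (congr1 (fun h => gft 1 (cinv R n) h x)); apply/funext => xi.
by rewrite mul1r -mulrDr E.
Qed.

(** The sum of the first k+1 pieces is the solution truncated to |xi| < 2^k, which converges in L^2;
    a subsequence converges a.e. The statement hides the subsequence so that it can be used for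
    countably many times at once. *)
Lemma propag_cluster a F t : L2 F -> {ae mu, forall x, forall N (e : R), 0 < e ->
  exists2 J, (N <= J)%N &
    sqn (\sum_(0 <= j < J) propag a (piece F j) t x - propagL2 a F t x) <= e}.
Proof.
move=> F2; have [mF F2'] := F2.
pose H xi := expi (t * normRn xi `^ a) * F xi.
have H2 : L2 H.
  split; first by apply: cmeasM => //; exact: cmeas_propag_phase.
  by rewrite (@eq_N2 _ _ _ mu _ F)// => xi; exact: sqn_expiM.
pose B k := @ballRn R n (2 ^+ k).
have mB k : measurable (B k) by exact: measurable_ballRn.
have DB k : D12 (fun x => H x * (\1_(B k) x : R)%:C).
  by apply: L2_indic_D12 => //; apply: lebesgue_ballRn_lty; exact: exprn_gt0.
have Bx (x : Rn R n) : exists N, forall k, (N <= k)%N -> B k x.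
  exists (Num.truncn (normRn x)).+1 => k hk; apply: lt_le_trans (truncnS_gt _) _.
  by apply: (@le_trans _ _ k%:R); rewrite ?ler_nat// -natrX ler_nat ltnW// ltn_expl.
have l2 := L2_trunc H2 mB Bx.
have s1 : (1 : R) ^+ 2 = 1 by rewrite expr1n.
have l3 := gftL2_continuous (cinv R n) s1 H2 (fun k => D12_L2 (DB k)) l2.
have [mU _] := gftL2_L2 (cinv R n) s1 H2.
have mU_ k : cmeas (gftL2 1 (cinv R n) (fun x => H x * (\1_(B k) x : R)%:C)).
  by have [] := gftL2_L2 (cinv R n) s1 (D12_L2 (DB k)).
have [phi [phik ph]] := ae_cvg0_subseq (fun k => measurable_sqn (cmeasB (mU_ k) mU)) (fun k x => sqn_ge0 _) l3.
have eqn : {ae mu, forall x k, gftL2 1 (cinv R n) (fun x => H x * (\1_(B k) x : R)%:C) x =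
    \sum_(0 <= j < k.+1) propag a (piece F j) t x}.
  apply/ae_foralln => k; apply: filterS (gftL2_D12 (cinv R n) s1 (DB k)) => x ->.
  rewrite series_propag_piece//; apply: (congr1 (fun h => gft 1 (cinv R n) h x)); apply/funext => xi.
  by rewrite /H mulrA.
apply: filterS2 eqn ph => x ex px N e e0.
have /cvgrPdist_lt/(_ _ e0)[N' _ hN] := px.
exists (phi (maxn N N')).+1.
  by apply: leqW; apply: leq_trans (phik _); exact: leq_maxl.
have := hN (maxn N N') (leq_maxr _ _); rewrite /= sub0r normrN ger0_norm ?sqn_ge0// ex.
exact: ltW.
Qed.

(** [L] is the real or the imaginary part. Index 0 stands for time 0 and index k+1 for [tt k], so a
    single countable family covers both the sequence and its limit in [tannery]. *)
Let cvg_component (L : R[i] -> R) a F (tt : nat -> R) x (m : nat -> R) :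
  {morph L : z w / z + w} -> L 0 = 0 -> (forall z, L z ^+ 2 <= sqn z) ->
  (forall j, continuous (fun t : R => L (propag a (piece F j) t x))) ->
  tt k @[k --> \oo] --> (0 : R) -> cvgn (series m) ->
  (forall k j, `|L (propag a (piece F j) (tt k) x)| <= m j) ->
  (forall (k : nat) N (e : R), 0 < e -> exists2 J, (N <= J)%N &
    sqn (\sum_(0 <= j < J) propag a (piece F j) (if k is k'.+1 then tt k' else 0) x -
         propagL2 a F (if k is k'.+1 then tt k' else 0) x) <= e) ->
  L (propagL2 a F (tt k) x) @[k --> \oo] --> L (propagL2 a F 0 x).
Proof.
move=> LD L0 Lsq Lc tt0 cm am cl.
have ab j : L (propag a (piece F j) (tt k) x) @[k --> \oo] --> L (propag a (piece F j) 0 x).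
  exact: (continuous_cvg _ (Lc j 0) tt0).
have Lsum t J : series (fun j => L (propag a (piece F j) t x)) J = L (\sum_(0 <= j < J) propag a (piece F j) t x).
  by rewrite (big_morph L LD L0).
have Lcl t : (forall N (e : R), 0 < e -> exists2 J, (N <= J)%N &
      sqn (\sum_(0 <= j < J) propag a (piece F j) t x - propagL2 a F t x) <= e) ->
    forall N (e : R), 0 < e -> exists2 J, (N <= J)%N &
      `|series (fun j => L (propag a (piece F j) t x)) J - L (propagL2 a F t x)| <= e.
  move=> h N e e0; have [|J NJ hJ] := h N (e ^+ 2); first exact: exprn_gt0.
  exists J => //; rewrite Lsum.
  rewrite (_ : L _ - L _ = L (\sum_(0 <= j < J) propag a (piece F j) t x - propagL2 a F t x)); last first.
    by apply/eqP; rewrite subr_eq -LD subrK.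
  rewrite -(@ler_pXn2r _ 2)// ?nnegrE ?(ltW e0)// real_normK ?num_real//.
  exact: le_trans (Lsq _) hJ.
apply: (tannery am _ cm ab (fun k => Lcl _ (cl k.+1)) (Lcl _ (cl 0%N))) => j.
by apply: (cvgr_to_le (cvg_norm (ab j))); apply: nearW => k; exact: am.
Qed.

Lemma cvg_complex (u : nat -> R[i]) (l : R[i]) :
  complex.Re (u k) @[k --> \oo] --> complex.Re l -> complex.Im (u k) @[k --> \oo] --> complex.Im l ->
  (u k : R[i]^o) @[k --> \oo] --> (l : R[i]^o).
Proof.
move=> hr hi; apply/cvgrPdist_lt => e e0.
(* In the order of the complex numbers a positive element is real, so e is given by its real
   part. *)
have [eE e1] : e = (complex.Re e)%:C /\ 0 < complex.Re e.
  by case: (e) e0 => x y; rewrite ltcE/= => /andP[/eqP -> ->].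
have e2 : 0 < complex.Re e / 2 by rewrite divr_gt0.
have /cvgrPdist_lt/(_ _ e2)[N1 _ h1] := hr; have /cvgrPdist_lt/(_ _ e2)[N2 _ h2] := hi.
exists (maxn N1 N2) => // k /= hk.
have := h1 k (leq_trans (leq_maxl _ _) hk); have := h2 k (leq_trans (leq_maxr _ _) hk) => /= b2 b1.
rewrite eE normc_def ltcR.
have [_ _] := normc_ReIm (l - u k); move: b1 b2; rewrite -!raddfB.
by rewrite /ComplexField.Normc.normc; case: (l - u k) => x y /=; lra.
Qed.

(** The exceptional set is the union of two null sets: that of [ae_summable], and the countable
    union over times from [propag_cluster]. Outside it, each piece is continuous in time and
    [tannery] applies to both components. *)
Lemma maximal_cvg a F (tt : nat -> R) : L2 F -> maximal_bound a F tt -> tt k @[k --> \oo] --> (0 : R) ->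
  {ae mu, forall x, (propagL2 a F (tt k) x : R[i]^o) @[k --> \oo] --> (propagL2 a F 0 x : R[i]^o)}.
Proof.
move=> F2 [C [q [C0 q0 q1 /choice[M hM]]]] tt0.
have sm : {ae mu, forall x, exists2 m : nat -> R, cvgn (series m) &
    forall j (y : R), ((y ^+ 2)%:E <= M j x)%E -> `|y| <= m j}.
  by apply: (ae_summable C0 q0 q1) => j; case: (hM j).
have cl : {ae mu, forall x, forall (k : nat) N (e : R), 0 < e -> exists2 J, (N <= J)%N &
    sqn (\sum_(0 <= j < J) propag a (piece F j) (if k is k'.+1 then tt k' else 0) x -
         propagL2 a F (if k is k'.+1 then tt k' else 0) x) <= e}.
  by apply/ae_foralln => k; exact: propag_cluster.
apply: filterS2 sm cl => x [m cm hm] clx.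
have bd k j z : z ^+ 2 <= sqn (propag a (piece F j) (tt k) x) -> `|z| <= m j.
  move=> hz; apply: hm; have [_ _ h _] := hM j; apply: le_trans (h k x).
  by rewrite lee_fin.
have co j : cintegrable (piece F j) by case: (piece_D12 j F2).
have sqR (z : R[i]) : complex.Re z ^+ 2 <= sqn z by rewrite lerDl sqr_ge0.
have sqI (z : R[i]) : complex.Im z ^+ 2 <= sqn z by rewrite lerDr sqr_ge0.
apply: cvg_complex.
  apply: (@cvg_component (@complex.Re R) a F tt x m) => //.
  - exact: raddfD.
  - by move=> j; case: (continuous_propag a x (co j)).
  - by move=> k j; apply: bd.
apply: (@cvg_component (@complex.Im R) a F tt x m) => //.
- exact: raddfD.
- by move=> j; case: (continuous_propag a x (co j)).
- by move=> k j; apply: bd.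
Qed.

End maximal_convergence.

(** * Pointwise convergence for Bessel potentials *)

Section corollary.
Context (R : realType) (n : nat).
Local Notation mu := (lebesgue_measure_Rn R n).
Local Open Scope complex_scope.

(** Through its spectrum F, the solution equals [propagL2] at every x, as [gftL2] does not
    distinguish a.e. equal arguments. Only the identification of f with the value at time 0 excludes
    a null set. *)
Lemma schroedinger_cvg a p r (f : Rn R n -> R[i]) (tt : nat -> R) :
  1 < p -> p < 2 -> 0 < r -> 0 < n%:R / 2 + r - n%:R / p -> tt k @[k --> \oo] --> (0 : R) ->
  (forall (F : Rn R n -> R[i]) (K : R), L2 F -> 0 <= K -> dyadic_bound (n%:R / 2 + r - n%:R / p) F K -> maximal_bound a F tt) ->
  bessel_space p r f ->
  {ae mu, forall x, (schroedinger a (tt k) f x : R[i]^o) @[k --> \oo] --> (f x : R[i]^o)}.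
Proof.
move=> p1 p2 r0 s0 tt0 mb fb.
have [F [K K0 [F2 db fE hE]]] := bessel_space_spectrum p1 p2 r0 s0 fb.
have UE t : schroedinger a t f = propagL2 a F t.
  rewrite /schroedinger inv_fourierL2E; apply: gftL2_ae.
  by apply: filterS hE => x ->.
have U0 : inv_fourierL2 F = propagL2 a F 0.
  rewrite inv_fourierL2E; apply: gftL2_ae; apply: aeW => x.
  by rewrite mul0r expi0 mul1r.
apply: filterS2 fE (maximal_cvg F2 (mb F K F2 K0 db) tt0) => x <- h.
have E : (fun k => schroedinger a (tt k) f x : R[i]^o) = fun k => propagL2 a F (tt k) x.
  by apply/funext => k; rewrite UE.
rewrite U0 E; exact: h.
Qed.

End corollary.

Theorem corollary2 (R : realType) (n : nat) (a p r s : R) (t : nat -> R)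
    (t_lt1 : t 0%N < 1) (t_decr : forall k : nat, t k.+1 < t k)
    (t_gt0 : forall k : nat, 0 < t k) (t_cvg0 : t k @[k --> \oo] --> (0 : R))
    (n_ge1 : (1 <= n)%N) (a_gt1 : 1 < a) (p_gt1 : 1 < p) (p_lt2 : p < 2)
    (r_gt0 : 0 < r) (sE : s = n%:R / 2 + r - n%:R / p) :
  (forall f : Rn R n -> R[i], bessel_space p r f -> 1 / 2 < s ->
     {ae lebesgue_measure_Rn R n, forall x,
        (schroedinger a (t k) f x : R[i]^o) @[k --> \oo] --> (f x : R[i]^o)})
  /\
  (0 < s -> s <= 1 / 2 ->
     let gamma := 2 * s / (a - s) in
     (\sum_(0 <= k <oo) (t k `^ gamma)%:E < +oo)%E ->
     forall f : Rn R n -> R[i], bessel_space p r f ->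
     {ae lebesgue_measure_Rn R n, forall x,
        (schroedinger a (t k) f x : R[i]^o) @[k --> \oo] --> (f x : R[i]^o)}).
Proof.
(* The local smoothing estimate lives in dimension m+1, where a dominant coordinate exists. *)
case: n n_ge1 sE => // m _ sE.
have tk1 k : t k < 1 by elim: k => // k; exact: lt_trans (t_decr k).
split=> [f fb s12|s0 s12 gam tgam f fb].
  have s0 : 0 < s by lra.
  apply: (schroedinger_cvg p_gt1 p_lt2 r_gt0 _ t_cvg0 _ fb); rewrite -sE// => F K F2 K0 db.
  by apply: (maximal_smooth a_gt1 _ F2 K0 db) => [|k]; [lra|rewrite !ltW].
apply: (schroedinger_cvg p_gt1 p_lt2 r_gt0 _ t_cvg0 _ fb); rewrite -sE// => F K F2 K0 db.
have tk01 k : 0 < t k < 1 by rewrite t_gt0 tk1.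
exact: (maximal_sparse a_gt1 s0 s12 F2 K0 db tk01 (erefl gam) tgam).
Qed.
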